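(* Let $\Omega\subset\mathbb{R}^N$ be a bounded $C^2$ domain, let $k=\sum_{j=1}^\ell k_j=N$, and let $u$ satisfy (in the viscosity sense) $$\mathcal{K}^-_{k_1,\dots,k_\ell}u\le0\ \text{ in }\Omega,\qquad u\ge0\ \text{ in }\mathbb{R}^N\setminus\Omega.$$ Assume $u\not\equiv0$ in $\Omega$. Then there exists a positive constant $c=c(\Omega,u)$ such that $$u(x)\ge c\,d(x)^s\quad\text{for all }x\in\overline\Omega.$$
   Context: Fix $N\in\mathbb{N}$, $s\in(0,1)$, $1\le\ell\le N$ and integers $1\le k_1\le\dots\le k_\ell\le N$ with $\sum_{j=1}^\ell k_j\le N$. Here $d(x)$ is the distance of $x$ from $\partial\Omega$. Functions in $L^\infty(\mathbb{R}^N)$ are bounded (Borel measurable) functions defined at every point. For an $n$-dimensional linear subspace $V\subset\mathbb{R}^N$, $$\mathcal{J}_Vu(x)=C_{n,s}\,P.V.\int_V\frac{u(x+z)-u(x)}{|z|^{n+2s}}\,d\mathcal{H}^n(z),$$ where $C_{n,s}>0$ is a fixed normalizing constant depending only on $n,s$. For $u\in L^\infty(\mathbb{R}^N)\cap C^2(\Omega)$ and $x \in \Omega$, $\mathcal{K}^-_{k_1,\dots,k_\ell}u(x)$ is the infimum of $\sum_{i=1}^\ell\mathcal{J}_{V_i}u(x)$ over all families $(V_1,\dots,V_\ell)$ of pairwise orthogonal linear subspaces of $\mathbb{R}^N$ with $\dim V_i=k_i$. Viscosity sense: $u\in L^\infty(\mathbb{R}^N)\cap LSC(\Omega)$ satisfies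 $\mathcal{K}^{-}_{k_1,\dots,k_\ell}u\le0$ in $\Omega$ if for every $x_0\in\Omega$, $\rho>0$ and $\varphi\in C^2(B_\rho(x_0))$ such that $x_0$ is a minimum point of $u-\varphi$, $$\inf_{(V_1,\dots,V_\ell)}\sum_{i=1}^\ell C_{k_i,s}\Big\{P.V.\int_{V_i\cap B_\rho(0)}\frac{\varphi(x_0+z)-\varphi(x_0)}{|z|^{k_i+2s}}d\mathcal{H}^{k_i}(z)+\int_{V_i\setminus B_\rho(0)}\frac{u(x_0+z)-u(x_0)}{|z|^{k_i+2s}}d\mathcal{H}^{k_i}(z)\Big\}\le0,$$ the infimum being over the same families. *)

(* Defs.v *)
From HB Require Import structures.
From mathcomp Require Import all_boot all_order all_algebra.
From mathcomp Require Import all_classical all_reals all_analysis.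

Set Implicit Arguments.
Unset Strict Implicit.
Unset Printing Implicit Defensive.

Import Order.TTheory GRing.Theory Num.Theory.
Import numFieldNormedType.Exports.

Local Open Scope classical_set_scope.
Local Open Scope ring_scope.

(* The canonical norm of 'rV[R]_N is the sup norm: it gives the usual topology
   but not the Euclidean length, balls and distance. *)
Section euclidean.
Context {R : realType} {N : nat}.
Implicit Types (x y : 'rV[R]_N) (Omega : set 'rV[R]_N).

Definition dot x y : R := \sum_i x 0 i * y 0 i.

Definition enorm x : R := Num.sqrt (dot x x).

Definition eball x (r : R) : set 'rV[R]_N := [set y | enorm (y - x) < r].

Definition ediam (E : set 'rV[R]_N) : R :=
  sup [set enorm (p.1 - p.2) | p in E `*` E].

Definition frontier Omega : set 'rV[R]_N := closure Omega `\` interior Omega.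

Definition boundary_dist Omega x : R :=
  inf [set enorm (x - y) | y in frontier Omega].

End euclidean.

Section hausdorff_measure.
Context {R : realType} {N : nat}.

(* Volume of the unit ball of R^n, through omega_(n+2) = 2 pi / (n+2) omega_n. *)
Fixpoint unit_ball_volume (n : nat) : R :=
  match n with
  | 0 => 1
  | 1 => 2
  | n'.+2 => 2 * pi / n%:R * unit_ball_volume n'
  end.

Definition small_cover (delta : R) (A : set 'rV[R]_N) :
    set ((set 'rV[R]_N)^nat) :=
  [set E | A `<=` \bigcup_j E j /\
           forall j x y, E j x -> E j y -> enorm (x - y) <= delta].

(* Empty pieces are dropped so that they have size 0 also when n = 0. *)
Definition hausdorff_content (n : nat) (delta : R) (A : set 'rV[R]_N) : \bar R :=
  ereal_inf
    [set (\sum_(0 <= j <oo | E j != set0)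
            (unit_ball_volume n * (ediam (E j) / 2) ^+ n)%:E)%E
    | E in small_cover delta A].

Definition hausdorff (n : nat) (A : set 'rV[R]_N) : \bar R :=
  ereal_sup [set hausdorff_content n delta A | delta in [set delta | 0 < delta]].

End hausdorff_measure.

(* R^N with its Borel sigma-algebra *)
Notation borel_rV R N := (g_sigma_algebraType (@open 'rV[R]_N)).

Section regularity.
Context {R : realType}.

Fixpoint Ck_on (m n : nat) (U : set 'rV[R]_n) (f : 'rV[R]_n -> R) : Prop :=
  (forall x, U x -> {for x, continuous f}) /\
  match m with
  | 0 => True
  | m'.+1 => forall i : 'I_n,
      (forall x, U x -> derivable f x (delta_mx 0 i)) /\
      Ck_on m' U ('D_(delta_mx 0 i) f)
  end.

(* Near each boundary point, up to the choice of the coordinate x_i and of its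
   sign, Omega is the part strictly above the graph of a C^2 function of the
   N - 1 other coordinates, which are the entries of col' i x. *)
Definition C2_boundary (N : nat) (Omega : set 'rV[R]_N) : Prop :=
  forall x0, frontier Omega x0 ->
  exists (r : R) (i : 'I_N) (b : bool) (gamma : 'rV[R]_N.-1 -> R),
    [/\ 0 < r, Ck_on 2 setT gamma &
      forall x, eball x0 r x ->
        (Omega x <-> gamma (col' i x) < (-1) ^+ b * x 0 i)].

Definition bounded_C2_domain (N : nat) (Omega : set 'rV[R]_N) : Prop :=
  [/\ Omega !=set0, open Omega, connected Omega, bounded_set Omega &
      C2_boundary Omega].

Definition Linfty (N : nat) (u : 'rV[R]_N -> R) : Prop :=
  (exists M : R, forall x, `|u x| <= M) /\
  measurable_fun [set: borel_rV R N] (u : borel_rV R N -> R).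

Definition LSC (N : nat) (Omega : set 'rV[R]_N) (u : 'rV[R]_N -> R) : Prop :=
  lower_semicontinuous ((fun x => (u x)%:E) : subspace Omega -> \bar R).

End regularity.

Section viscosity.
Context {R : realType} {N l : nat}.
Variables (k : 'I_l -> nat) (s : R) (C : nat -> R -> R).
Implicit Types (f u phi : 'rV[R]_N -> R) (V : 'I_l -> {vspace 'rV[R]_N}).

Definition orthogonal_families : set ('I_l -> {vspace 'rV[R]_N}) :=
  [set V | (forall i, \dim (V i) = k i) /\
           forall i j, i != j ->
             forall x y, x \in V i -> y \in V j -> dot x y = 0].

Local Open Scope ereal_scope.

Definition difference_quotient (n : nat) f (x z : 'rV[R]_N) : \bar R :=
  ((f (x + z) - f x) / enorm z `^ (n%:R + 2 * s))%R%:E.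

Definition hausdorff_integral (n : nat) (A : set 'rV[R]_N)
    (g : 'rV[R]_N -> \bar R) : \bar R :=
  \int[hausdorff n : set (borel_rV R N) -> \bar R]_(z in A) g z.

Definition pv_hausdorff_integral (n : nat) (A : set 'rV[R]_N)
    (g : 'rV[R]_N -> \bar R) : \bar R :=
  lim (hausdorff_integral n (A `\` eball 0%R eps) g @[eps --> 0%R^'+]).

Definition viscosity_sum (x0 : 'rV[R]_N) (rho : R) phi u V : \bar R :=
  \sum_(i < l) (C (k i) s)%:E *
    (pv_hausdorff_integral (k i) ([set` V i] `&` eball 0%R rho)
       (difference_quotient (k i) phi x0) +
     hausdorff_integral (k i) ([set` V i] `\` eball 0%R rho)
       (difference_quotient (k i) u x0)).

(* K^-_{k_1,...,k_l} u <= 0 in Omega in the viscosity sense. Only the values of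
   phi on the ball matter; phi may be unbounded below near the boundary of the
   ball, in which case the first integral may be -oo. *)
Definition viscosity_supersolution (Omega : set 'rV[R]_N) u : Prop :=
  forall (x0 : 'rV[R]_N) (rho : R) phi,
    Omega x0 -> (0 < rho)%R -> Ck_on 2 (eball x0 rho) phi ->
    (forall x, eball x0 rho x -> u x0 - phi x0 <= u x - phi x)%R ->
    ereal_inf [set viscosity_sum x0 rho phi u V | V in orthogonal_families] <= 0.

End viscosity.

(* Main.v *)
Require Import Defs.
From HB Require Import structures.
From mathcomp Require Import all_boot all_order all_algebra.
From mathcomp Require Import ring lra measurable_realfun.
From mathcomp Require Import all_classical all_reals all_analysis.

Set Implicit Arguments.
Unset Strict Implicit.
Unset Printing Implicit Defensive.

Import Order.TTheory GRing.Theory Num.Theory.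
Import numFieldNormedType.Exports.

Local Open Scope classical_set_scope.
Local Open Scope ring_scope.

Section euclidean_norm.
Context {R : realType} {N : nat}.
Implicit Types (x y z : 'rV[R]_N) (a r : R).

Lemma dotC x y : dot x y = dot y x.
Proof. by apply: eq_bigr => i _; rewrite mulrC. Qed.

Lemma dotDl x y z : dot (x + y) z = dot x z + dot y z.
Proof. by rewrite -big_split; apply: eq_bigr => i _; rewrite mxE mulrDl. Qed.

Lemma dotZl a x y : dot (a *: x) y = a * dot x y.
Proof. by rewrite mulr_sumr; apply: eq_bigr => i _; rewrite mxE mulrA. Qed.

Lemma dotNl x y : dot (- x) y = - dot x y.
Proof. by rewrite -scaleN1r dotZl mulN1r. Qed.

Lemma dotBl x y z : dot (x - y) z = dot x z - dot y z.
Proof. by rewrite dotDl dotNl. Qed.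

Lemma dot0l x : dot 0 x = 0.
Proof. by rewrite -(scale0r x) dotZl mul0r. Qed.

Lemma dotDr x y z : dot z (x + y) = dot z x + dot z y.
Proof. by rewrite dotC dotDl !(dotC _ z). Qed.

Lemma dotZr a x y : dot y (a *: x) = a * dot y x.
Proof. by rewrite dotC dotZl (dotC x). Qed.

Lemma dotNr x y : dot y (- x) = - dot y x.
Proof. by rewrite dotC dotNl (dotC x). Qed.

Lemma dotBr x y z : dot z (x - y) = dot z x - dot z y.
Proof. by rewrite dotDr dotNr. Qed.

Lemma dot0r x : dot x 0 = 0.
Proof. by rewrite dotC dot0l. Qed.

Definition dotE := (dotDl, dotDr, dotBl, dotBr, dotZl, dotZr, dotNl, dotNr,
  dot0l, dot0r).

Lemma dot_suml (I : Type) (s : seq I) (P : pred I) (F : I -> 'rV[R]_N) x :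
  dot (\sum_(i <- s | P i) F i) x = \sum_(i <- s | P i) dot (F i) x.
Proof.
by elim/big_rec2 : _ => [|i y z _ <-]; rewrite ?dot0l// dotDl.
Qed.

Lemma dot_sumr (I : Type) (s : seq I) (P : pred I) (F : I -> 'rV[R]_N) x :
  dot x (\sum_(i <- s | P i) F i) = \sum_(i <- s | P i) dot x (F i).
Proof. by rewrite dotC dot_suml; apply: eq_bigr => i _; rewrite dotC. Qed.

Lemma dot_ge0 x : 0 <= dot x x.
Proof. by apply: sumr_ge0 => i _; rewrite -expr2 sqr_ge0. Qed.

Lemma dot_eq0 x : (dot x x == 0) = (x == 0).
Proof.
apply/idP/eqP => [|->]; last by rewrite dot0l.
rewrite psumr_eq0 => [/allP x0|i _]; last by rewrite -expr2 sqr_ge0.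
apply/rowP => i; rewrite mxE; apply/eqP.
by have := x0 i (mem_index_enum _); rewrite mulf_eq0 orbb.
Qed.

Lemma enorm_ge0 x : 0 <= enorm x.
Proof. exact: sqrtr_ge0. Qed.

Lemma sqr_enorm x : enorm x ^+ 2 = dot x x.
Proof. by rewrite sqr_sqrtr// dot_ge0. Qed.

Lemma enorm_eq0 x : (enorm x == 0) = (x == 0).
Proof. by rewrite -dot_eq0 -sqr_enorm sqrf_eq0. Qed.

Lemma enorm0 : enorm (0 : 'rV[R]_N) = 0.
Proof. by apply/eqP; rewrite enorm_eq0. Qed.

Lemma enorm_gt0 x : (0 < enorm x) = (x != 0).
Proof. by rewrite lt_def enorm_ge0 andbT enorm_eq0. Qed.

Lemma enormZ a x : enorm (a *: x) = `|a| * enorm x.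
Proof.
by rewrite /enorm !dotE mulrA -expr2 sqrtrM ?sqr_ge0// sqrtr_sqr.
Qed.

Lemma enormN x : enorm (- x) = enorm x.
Proof. by rewrite -scaleN1r enormZ normrN1 mul1r. Qed.

Lemma enormBC x y : enorm (x - y) = enorm (y - x).
Proof. by rewrite -enormN opprB. Qed.

Lemma enorm_le x a : 0 <= a -> (enorm x <= a) = (dot x x <= a ^+ 2).
Proof.
by move=> a0; rewrite -sqr_enorm ler_pXn2r// nnegrE enorm_ge0.
Qed.

Lemma enorm_lt x a : 0 <= a -> (enorm x < a) = (dot x x < a ^+ 2).
Proof.
by move=> a0; rewrite -sqr_enorm ltr_pXn2r// nnegrE enorm_ge0.
Qed.

Lemma cauchy_schwarz_dot x y : dot x y <= enorm x * enorm y.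
Proof.
have [->|x0] := eqVneq x 0; first by rewrite dot0l enorm0 mul0r.
have x1 : 0 < enorm x by rewrite enorm_gt0.
have := dot_ge0 (enorm x ^+ 2 *: y - dot x y *: x).
rewrite !dotE -(sqr_enorm x) (dotC y x) -(sqr_enorm y).
set X := enorm x in x1 *; set Y := enorm y; set D := dot x y => h.
have {}h : 0 <= X ^+ 2 * ((X * Y) ^+ 2 - D ^+ 2).
  by apply: le_trans h _; rewrite le_eqVlt; apply/orP; left; apply/eqP; ring.
rewrite pmulr_rge0 ?exprn_gt0// subr_ge0 in h.
apply: le_trans (ler_norm _) _.
by rewrite -ler_sqr ?nnegrE// ?mulr_ge0 ?enorm_ge0 ?(ltW x1)// real_normK ?num_real.
Qed.

Lemma cauchy_schwarz_abs x y : `|dot x y| <= enorm x * enorm y.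
Proof.
rewrite ler_norml cauchy_schwarz_dot andbT lerNl -dotNl.
by rewrite (le_trans (cauchy_schwarz_dot _ _))// enormN.
Qed.

Lemma ler_enormD x y : enorm (x + y) <= enorm x + enorm y.
Proof.
rewrite enorm_le ?addr_ge0 ?enorm_ge0// !dotE (dotC y x) sqrrD !sqr_enorm.
by have := cauchy_schwarz_dot x y; lra.
Qed.

Lemma ler_enormB x y z : enorm (x - z) <= enorm (x - y) + enorm (y - z).
Proof. by have := ler_enormD (x - y) (y - z); rewrite addrA subrK. Qed.

Lemma ler_coord_enorm x i : `|x 0 i| <= enorm x.
Proof.
rewrite -(@ler_pXn2r _ 2) ?nnegrE ?enorm_ge0// sqr_enorm real_normK ?num_real//.
rewrite /dot (bigD1 i)//= -expr2 lerDl sumr_ge0// => j _.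
by rewrite -expr2 sqr_ge0.
Qed.

Lemma coord_le_norm x i : `|x 0 i| <= `|x|.
Proof.
rewrite [leRHS]/Num.norm /= mx_normrE; apply: le_trans (le_bigmax _ _ (0, i)).
by [].
Qed.

Lemma norm_le_enorm x : `|x| <= enorm x.
Proof.
rewrite [leLHS]/Num.norm /= mx_normrE; apply/bigmax_leP; split; first exact: enorm_ge0.
by move=> [i j] _ /=; rewrite (ord1 i) ler_coord_enorm.
Qed.

Lemma enorm_le_norm x : enorm x <= N%:R * `|x|.
Proof.
rewrite enorm_le ?mulr_ge0// exprMn.
apply: (@le_trans _ _ (\sum_(i < N) `|x| ^+ 2)).
  apply: ler_sum => i _; rewrite -expr2 -(real_normK (num_real _)).
  by rewrite ler_pXn2r ?nnegrE// coord_le_norm.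
rewrite sumr_const card_ord -[leLHS]mulr_natl ler_wpM2r ?sqr_ge0// -natrX ler_nat.
by case: (N) => // n; rewrite expnS expn1 leq_pmull.
Qed.

Lemma dist_enorm_le x y : `|enorm x - enorm y| <= N%:R * `|x - y|.
Proof.
rewrite (le_trans _ (enorm_le_norm _))// ler_norml.
have := ler_enormD (x - y) y; have := ler_enormD (y - x) x.
by rewrite !subrK enormBC => h1 h2; apply/andP; split; lra.
Qed.

Lemma continuous_enorm : continuous (@enorm R N).
Proof.
move=> x; apply: (proj2 (@cvgrPdist_le R R^o 'rV[R]_N (nbhs x) _ _ _)) => e e0.
have h : \forall y \near x, `|x - y| <= e / N.+1%:R.
  by apply: (@cvgr_dist_le R _ _ (nbhs x) _ id x); rewrite ?divr_gt0//; exact: cvg_id.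
near=> y; rewrite (le_trans (dist_enorm_le _ _))//.
have : `|x - y| <= e / N.+1%:R by near: y.
rewrite ler_pdivlMr// mulrC; apply: le_trans.
by rewrite ler_wpM2r// ler_nat.
Unshelve. all: by end_near. Qed.

Lemma continuous_dotl y : continuous (fun x => dot x y).
Proof.
apply: (@continuous_big R^o 'I_N +%R 0 xpredT _ 'rV[R]_N (index_enum 'I_N)
  (fun i x => x 0 i * y 0 i)).
- exact: add_continuous.
- move=> i _ z.
  by apply: (@cvgM R 'rV[R]_N (nbhs z)); [exact: (@coord_continuous R 1 N 0 i z)|exact: cvg_cst].
Qed.

Lemma continuous_subr x : continuous (fun y => y - x).
Proof.
by move=> y; apply: (@cvgB R _ _ (nbhs y)); [exact: cvg_id|exact: (@cvg_cst _ x _ (nbhs y))].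
Qed.

Lemma open_eball x r : open (eball x r).
Proof.
have -> : eball x r = (fun y => enorm (y - x)) @^-1` [set t | t < r] by [].
apply: open_comp; last exact: open_lt.
by move=> y _; apply: continuous_comp; [exact: continuous_subr|exact: continuous_enorm].
Qed.

Lemma eball_center x r : 0 < r -> eball x r x.
Proof. by move=> r0; rewrite /eball /= subrr enorm0. Qed.

Lemma nbhs_eball x r : 0 < r -> nbhs x (eball x r).
Proof.
by move=> r0; apply: open_nbhs_nbhs; split; [exact: open_eball|exact: eball_center].
Qed.

Lemma nbhs_eballP x (A : set 'rV[R]_N) :
  nbhs x A <-> exists2 r, 0 < r & eball x r `<=` A.
Proof.
split=> [/nbhs_ballP[r /= r0 rA]|[r r0 rA]]; last exact: filterS (nbhs_eball x r0).
exists r => // y; rewrite /eball /= enormBC => xy; apply: rA.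
by rewrite -ball_normE /ball_ /= (le_lt_trans (norm_le_enorm _)).
Qed.

Definition ceball x r : set 'rV[R]_N := [set y | enorm (y - x) <= r].

Lemma closed_ceball x r : closed (ceball x r).
Proof.
have -> : ceball x r = (fun y => enorm (y - x)) @^-1` [set t | t <= r] by [].
apply: closed_comp; last exact: closed_le.
by move=> y _; apply: continuous_comp; [exact: continuous_subr|exact: continuous_enorm].
Qed.

Lemma bounded_ceball x r : bounded_set (ceball x r).
Proof.
exists (r + enorm x); split; first exact: num_real.
move=> M rM y xy; apply: le_trans (norm_le_enorm _) (le_trans _ (ltW rM)).
have := ler_enormD (y - x) x; rewrite subrK => /le_trans; apply.
by rewrite lerD2r.
Qed.

Lemma compact_ceball x r : compact (ceball x r).
Proof.
by apply: bounded_closed_compact; [exact: bounded_ceball|exact: closed_ceball].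
Qed.

Lemma bounded_setP (A : set 'rV[R]_N) : bounded_set A ->
  exists2 D, 0 < D & forall x, A x -> enorm x <= D.
Proof.
move=> [M [_ MA]]; exists (N%:R * (`|M| + 1) + 1); first by rewrite ltr_wpDl// mulr_ge0// addr_ge0.
move=> x Ax; apply: le_trans (enorm_le_norm x) _.
have : `|x| <= `|M| + 1 by apply: MA => //; rewrite (le_lt_trans (ler_norm M))// ltrDl.
by move=> /(ler_wpM2l (ler0n R N)) /le_trans; apply; rewrite lerDl.
Qed.

End euclidean_norm.

Section hausdorff_outer.
Context {R : realType} {N : nat}.
Implicit Types (A B X : set 'rV[R]_N) (n : nat) (delta : R).
Local Open Scope ereal_scope.

Lemma unit_ball_volume_gt0 n : (0 < unit_ball_volume n :> R)%R.
Proof.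
suff : (0 < unit_ball_volume n :> R)%R /\ (0 < unit_ball_volume n.+1 :> R)%R.
  by case.
elim: n => [|n [IH1 IH2]]; first by rewrite /= ltr01 ltr0n.
split=> //; change (0 < 2 * pi / n.+2%:R * unit_ball_volume n :> R)%R.
by rewrite mulr_gt0// divr_gt0// mulr_gt0// pi_gt0.
Qed.

Let dists A : set R := [set enorm (p.1 - p.2) | p in A `*` A].

Lemma ediam_ge0 A : (0 <= ediam A)%R.
Proof.
rewrite /ediam -/(dists A).
have [h|/sup_out ->//] := pselect (has_sup (dists A)).
have [x Ax] := h.1; apply: (@le_trans _ _ x).
  by case: Ax => p _ <-; exact: enorm_ge0.
by apply: ub_le_sup => //; exact: h.2.
Qed.

Definition small delta A := forall x y, A x -> A y -> (enorm (x - y) <= delta)%R.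

Lemma small_le_ediam delta A x y : small delta A -> A x -> A y ->
  (enorm (x - y) <= ediam A)%R.
Proof.
move=> sA Ax Ay; apply: ub_le_sup; last by exists (x, y).
by exists delta => _ [[a b] /= [Aa Ab] <-]; exact: sA.
Qed.

Lemma ediam_le delta A : (0 <= delta)%R -> small delta A -> (ediam A <= delta)%R.
Proof.
move=> d0 sA; rewrite /ediam -/(dists A).
have [h|/sup_out ->//] := pselect (has_sup (dists A)).
apply: ge_sup; first exact: h.1.
by move=> _ [[a b] /= [Aa Ab] <-]; exact: sA.
Qed.

Definition hsize n A : R := (unit_ball_volume n * (ediam A / 2) ^+ n)%R.

Lemma hsize_ge0 n A : (0 <= hsize n A)%R.
Proof.
by rewrite mulr_ge0 ?(ltW (unit_ball_volume_gt0 _))// exprn_ge0// divr_ge0// ediam_ge0.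
Qed.

(** The cost of a covering piece: with pieces that are too large made infinitely
    expensive, the content becomes an instance of the generic extension of a set
    function to an outer measure. *)
Definition gauge n delta A : \bar R :=
  if A == set0 then 0 else if `[< small delta A >] then (hsize n A)%:E else +oo.

Lemma gauge0 n delta : gauge n delta set0 = 0.
Proof. by rewrite /gauge eqxx. Qed.

Lemma gauge_ge0 n delta A : 0 <= gauge n delta A.
Proof. by rewrite /gauge; do 2! case: ifP => // _; rewrite lee_fin hsize_ge0. Qed.

Local Notation alltype := (g_sigma_algebraType [set: set 'rV[R]_N]).

Lemma hausdorff_contentE n delta A :
  hausdorff_content n delta A =
  mu_ext (gauge n delta : set alltype -> \bar R) A.
Proof.
apply/eqP; rewrite eq_le; apply/andP; split.
- apply: le_ereal_inf_tmp => _ [E [_ AE] <-].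
  have [[i Ei]|noo] := pselect (exists i, gauge n delta (E i) = +oo).
    rewrite [leRHS](eseries_pinfty _ _ Ei) ?leey// => j _.
    by rewrite -ltNye (lt_le_trans _ (gauge_ge0 _ _ _)).
  apply: ereal_inf_lbound; exists E.
    split=> // j x y Ejx Ejy; apply: contra_notP noo => nxy; exists j.
    rewrite /gauge; case: eqP => [E0|_]; first by rewrite E0 in Ejx.
    by case: asboolP => // /(_ x y Ejx Ejy).
  rewrite eseries_mkcond; apply: eq_eseriesr => j _; rewrite /gauge.
  case: eqP => //= E0; case: asboolP => // nsm; exfalso; apply: noo.
  by exists j; rewrite /gauge; case: eqP => // _; case: asboolP.
- apply: le_ereal_inf_tmp => _ [E [AE sE] <-].
  apply: ereal_inf_lbound; exists E.
    by split=> // i; exact: sub_sigma_algebra.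
  rewrite [RHS]eseries_mkcond; apply: eq_eseriesr => j _; rewrite /gauge.
  by case: eqP => //= E0; case: asboolP => // nsm; exfalso; apply: nsm; exact: sE.
Qed.

Lemma hausdorff_content0 n delta : hausdorff_content n delta (set0 : set 'rV[R]_N) = 0.
Proof.
by rewrite hausdorff_contentE mu_ext0//; [exact: gauge0|exact: gauge_ge0].
Qed.

Lemma hausdorff_content_ge0 n delta A : 0 <= hausdorff_content n delta A.
Proof. by rewrite hausdorff_contentE mu_ext_ge0//; exact: gauge_ge0. Qed.

Lemma le_hausdorff_content n delta A B : A `<=` B ->
  hausdorff_content n delta A <= hausdorff_content n delta B.
Proof. by move=> AB; rewrite !hausdorff_contentE; exact: le_mu_ext. Qed.

Lemma hausdorff_content_sigma_subadditive n delta :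
  sigma_subadditive (@hausdorff_content R N n delta).
Proof.
move=> F; rewrite hausdorff_contentE.
under eq_eseriesr do rewrite hausdorff_contentE.
by apply: mu_ext_sigma_subadditive; exact: gauge_ge0.
Qed.

Lemma hausdorff_content_anti n delta delta' A : (delta <= delta')%R ->
  hausdorff_content n delta' A <= hausdorff_content n delta A.
Proof.
move=> dd; apply/ereal_inf_le_tmp => _ [E [AE sE] <-]; exists E => //.
by split=> // j x y Ex Ey; exact: le_trans (sE _ _ _ Ex Ey) dd.
Qed.

Lemma hausdorff_content_le n delta A : (0 < delta)%R ->
  hausdorff_content n delta A <= hausdorff n A.
Proof. by move=> d0; apply: ereal_sup_ubound; exists delta. Qed.

Lemma hausdorff0 n : hausdorff n (set0 : set 'rV[R]_N) = 0.
Proof.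
apply/eqP; rewrite eq_le; apply/andP; split.
  by apply: ge_ereal_sup => _ [d d0 <-]; rewrite hausdorff_content0.
by apply: le_trans (hausdorff_content_le n _ ltr01); rewrite hausdorff_content0.
Qed.

Lemma hausdorff_ge0 n A : 0 <= hausdorff n A.
Proof.
exact: le_trans (hausdorff_content_ge0 n 1 A) (hausdorff_content_le n A ltr01).
Qed.

Lemma le_hausdorff n : {homo @hausdorff R N n : A B / A `<=` B >-> A <= B}.
Proof.
move=> A B AB; apply: ge_ereal_sup => _ [d d0 <-].
exact: le_trans (le_hausdorff_content n d AB) (hausdorff_content_le n B d0).
Qed.

Lemma hausdorff_sigma_subadditive n : sigma_subadditive (@hausdorff R N n).
Proof.
move=> F; apply: ge_ereal_sup => _ [d d0 <-].
apply: le_trans (hausdorff_content_sigma_subadditive n d F) _.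
apply: lee_nneseries => [i _ _|i _]; first exact: hausdorff_content_ge0.
exact: hausdorff_content_le.
Qed.

HB.instance Definition _ n := isOuterMeasure.Build R 'rV[R]_N (@hausdorff R N n)
  (hausdorff0 n) (hausdorff_ge0 n) (@le_hausdorff n)
  (@hausdorff_sigma_subadditive n).

Definition separated_by (eta : R) A B :=
  forall x y, A x -> B y -> (eta <= enorm (x - y))%R.

Lemma hausdorff_content_separated n delta eta A B : (delta < eta)%R ->
  separated_by eta A B ->
  hausdorff_content n delta A + hausdorff_content n delta B <=
  hausdorff_content n delta (A `|` B).
Proof.
move=> de sAB; apply: le_ereal_inf_tmp => _ [E [ABE sE] <-].
pose part (X : set 'rV[R]_N) j := if E j `&` X == set0 then set0 else E j.
have partP (X : set 'rV[R]_N) : X `<=` \bigcup_j E j -> hausdorff_content n delta X <=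
    \sum_(0 <= j <oo) if part X j == set0 then 0 else (hsize n (E j))%:E.
  move=> XE; apply: ereal_inf_lbound; exists (part X).
    split=> [x Xx|j x y]; last by rewrite /part; case: ifP => // _; exact: sE.
    have [j _ Ejx] := XE _ Xx; exists j => //; rewrite /part.
    by case: eqP => // EX; have : (E j `&` X) x by []; rewrite EX.
  rewrite eseries_mkcond; apply: eq_eseriesr => j _.
  rewrite /part; case: (E j `&` X == set0); first by rewrite eqxx.
  by case: (E j == set0).
apply: le_trans (leeD (partP _ _) (partP _ _)) _.
- by move=> x Ax; apply: ABE; left.
- by move=> x Ax; apply: ABE; right.
rewrite -nneseriesD; [|by move=> j _ _; case: ifP; rewrite ?lee_fin ?hsize_ge0..].
rewrite [leRHS]eseries_mkcond; apply: lee_nneseries => [j _ _|j _].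
  by apply: adde_ge0; case: ifP; rewrite ?lee_fin ?hsize_ge0.
have sz0 : 0 <= (hsize n (E j))%:E by rewrite lee_fin hsize_ge0.
rewrite /part; case: (eqVneq (E j `&` A) set0) => [_|/set0P[x [Ex Ax]]].
  rewrite eqxx add0e; case: (E j `&` B == set0); rewrite ?eqxx;
  by case: (E j == set0).
case: (eqVneq (E j `&` B) set0) => [_|/set0P[y [Ey By]]].
  by rewrite eqxx adde0; case: (E j == set0).
by have := lt_le_trans de (sAB _ _ Ax By); rewrite ltNge (sE j).
Qed.

Lemma hausdorff_separated n eta A B : (0 < eta)%R -> separated_by eta A B ->
  hausdorff n A + hausdorff n B <= hausdorff n (A `|` B).
Proof.
move=> e0 sAB.
have key d1 d2 : (0 < d1)%R -> (0 < d2)%R ->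
    hausdorff_content n d1 A + hausdorff_content n d2 B <= hausdorff n (A `|` B).
  move=> d10 d20; pose d := (Num.min (Num.min d1 d2) (eta / 2))%R.
  have d0 : (0 < d)%R by rewrite !lt_min d10 d20 divr_gt0.
  apply: le_trans (hausdorff_content_le n _ d0).
  apply: le_trans (hausdorff_content_separated n _ sAB); last first.
    by rewrite !gt_min ltr_pdivrMr// ltr_pMr// ltr1n orbT.
  by apply: leeD; apply: hausdorff_content_anti; rewrite !ge_min lexx ?orbT.
have keyB d1 : (0 < d1)%R -> hausdorff_content n d1 A + hausdorff n B <= hausdorff n (A `|` B).
  move=> d10; have := key d1 _ d10; have := hausdorff_content_ge0 n d1 A.
  case: (hausdorff_content n d1 A) => [r _ h|_ h|//]; last first.
    have := h _ ltr01; rewrite addye ?leye_eq; last first.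
      by rewrite -ltNye (lt_le_trans _ (hausdorff_content_ge0 _ _ _)).
    by move=> /eqP ->; rewrite leey.
  rewrite addeC -leeBrDr//; apply: ge_ereal_sup => _ [d d0 <-].
  by rewrite leeBrDr// addeC h.
have := hausdorff_ge0 n B; move: keyB.
case: (hausdorff n B) => [r h _|h _|//]; last first.
  have := h _ ltr01; rewrite addey ?leye_eq; last first.
    by rewrite -ltNye (lt_le_trans _ (hausdorff_content_ge0 _ _ _)).
  by move=> /eqP ->; rewrite leey.
rewrite -leeBrDr//; apply: ge_ereal_sup => _ [d d0 <-].
by rewrite leeBrDr// h.
Qed.

Lemma hausdorff_separated_seq n (F : (set 'rV[R]_N)^nat) m :
  (forall j, exists2 eta, (0 < eta)%R &
     separated_by eta (\big[setU/set0]_(i < j) F i) (F j)) ->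
  \sum_(i < m) hausdorff n (F i) <= hausdorff n (\big[setU/set0]_(i < m) F i).
Proof.
move=> sF; elim: m => [|m IH]; first by rewrite !big_ord0 hausdorff0.
rewrite !big_ord_recr/=; have [eta e0 se] := sF m.
by apply: le_trans (hausdorff_separated n e0 se); exact: leeD.
Qed.

End hausdorff_outer.

Section hausdorff_borel.
Context {R : realType} {N : nat}.
Implicit Types (A B X U : set 'rV[R]_N) (n : nat).
Local Open Scope ereal_scope.

(** Points of X that keep distance at least 1/(k+1) from the complement of U. *)
Definition deep U X k : set 'rV[R]_N :=
  [set x | X x /\ forall y, ~ U y -> (k.+1%:R^-1 <= enorm (x - y))%R].

Lemma deep_sub U X k : deep U X k `<=` deep U X k.+1.
Proof.
move=> x [Xx xU]; split=> // y /xU; apply: le_trans.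
by rewrite lef_pV2 ?posrE// ler_nat.
Qed.

Lemma deep_mono U X k m : (k <= m)%N -> deep U X k `<=` deep U X m.
Proof.
move=> /subnK <-; elim: (m - k)%N => // j IH.
by apply: subset_trans IH _; rewrite addSn; exact: deep_sub.
Qed.

Definition layer U X k := deep U X k.+1 `\` deep U X k.

Lemma open_deep U X : open U -> X `&` U = \bigcup_k deep U X k.
Proof.
move=> oU; apply/seteqP; split=> [x [Xx Ux]|x [k _ [Xx xU]]]; last first.
  split=> //; apply: contrapT => /xU.
  by rewrite subrr enorm0 leNgt invr_gt0 ltr0n.
have [r r0 rU] := (nbhs_eballP _ _).1 (open_nbhs_nbhs (conj oU Ux)).
exists (Num.truncn r^-1) => //; split=> // y Uy; rewrite leNgt; apply/negP => xy.
apply: Uy; apply: rU; rewrite /eball /= enormBC (lt_trans xy)//.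
rewrite invf_plt ?posrE//.
exact: truncnS_gt.
Qed.

Lemma deep_layer U X k m :
  deep U X (k + m)%N `<=` deep U X k `|` \bigcup_(i in [set i | (k <= i)%N]) layer U X i.
Proof.
elim: m => [|m IH x xkm]; first by rewrite addn0; left.
have [/IH //|nx] := pselect (deep U X (k + m)%N x).
right; exists (k + m)%N; first by rewrite /= leq_addr.
by split=> //; rewrite -addnS.
Qed.

Lemma layer_separated U X k : separated_by (k.+2%:R^-1 - k.+3%:R^-1)%R
  (deep U X k.+1) (layer U X k.+2).
Proof.
move=> x z [Xx xU] [[Xz _] nz].
have [y [Uy zy]] : exists y, ~ U y /\ (enorm (z - y) < k.+3%:R^-1)%R.
  apply: contrapT => nex; apply: nz; split=> // y Uy.
  by rewrite leNgt; apply/negP => zy; apply: nex; exists y.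
have := xU _ Uy; have := ler_enormB x z y => h1 h2; rewrite lerBlDr.
by apply: le_trans h2 (le_trans h1 _); rewrite lerD2l ltW.
Qed.

Lemma sum_layer_le n U X m (e : nat) : 
  \sum_(i < m) hausdorff n (layer U X (i.*2 + e)%N) <= hausdorff n X.
Proof.
apply: (@le_trans _ _ (hausdorff n (\big[setU/set0]_(i < m) layer U X (i.*2 + e)%N))).
  apply: (hausdorff_separated_seq n (F := fun i => layer U X (i.*2 + e)%N)) => -[|j].
    by exists 1%R => // x y; rewrite big_ord0.
  pose k := (j.*2 + e)%N; exists (k.+2%:R^-1 - k.+3%:R^-1)%R.
    by rewrite subr_gt0 ltf_pV2 ?posrE// ltr_nat.
  move=> x y Hx; rewrite doubleS !addSn; apply: (@layer_separated U X); move: Hx.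
  rewrite -(bigcup_mkord j.+1 (fun i => layer U X (i.*2 + e)%N)) => -[i /= ij [+ _]].
  by apply: deep_mono; rewrite ltnS leq_add2r leq_double -ltnS.
apply: le_hausdorff; rewrite -(bigcup_mkord m (fun i => layer U X (i.*2 + e)%N)).
by move=> x [i _ [[Xx _] _]].
Qed.

Lemma nneseries_layer n U X : hausdorff n X < +oo ->
  \sum_(0 <= i <oo) hausdorff n (layer U X i) < +oo.
Proof.
move=> Xoo; apply: (@le_lt_trans _ _ (hausdorff n X + hausdorff n X)); last first.
  by rewrite lte_add_pinfty.
apply: lime_le; first by apply: is_cvg_nneseries => *; exact: hausdorff_ge0.
have E m : \sum_(0 <= i < m.*2) hausdorff n (layer U X i) =
    \sum_(i < m) hausdorff n (layer U X (i.*2 + 0)%N) +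
    \sum_(i < m) hausdorff n (layer U X (i.*2 + 1)%N).
  elim: m => [|m IH]; first by rewrite big_nil !big_ord0 adde0.
  rewrite doubleS !big_nat_recr//= IH !big_ord_recr /= addn0 addn1.
  rewrite -!addeA; congr (_ + _).
  by rewrite addeC -!addeA; congr (_ + _); rewrite addeC.
near=> m; apply: (@le_trans _ _ (\sum_(0 <= i < m.*2) hausdorff n (layer U X i))).
  rewrite (@big_cat_nat _ _ _ m 0 m.*2)//=; last by rewrite -addnn leq_addr.
  by rewrite leeDl// sume_ge0// => *; exact: hausdorff_ge0.
rewrite E.
by apply: leeD; exact: sum_layer_le.
Unshelve. all: by end_near. Qed.

(** The Caratheodory criterion for metric outer measures. *)
Lemma open_caratheodory n U : open U -> caratheodory_measurable (@hausdorff R N n) U.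
Proof.
move=> oU; apply: le_caratheodory_measurable => X.
change (hausdorff n (X `&` U) + hausdorff n (X `&` ~` U) <= hausdorff n X).
have [Xoo|] := ltP (hausdorff n X) +oo; last by rewrite leye_eq => /eqP ->; rewrite leey.
have tail0 := nneseries_tail_cvg (nneseries_layer U Xoo)
  (fun k _ => hausdorff_ge0 n (layer U X k)).
have XCfin : hausdorff n (X `&` ~` U) \is a fin_num.
  rewrite ge0_fin_numE ?hausdorff_ge0//; apply: le_lt_trans Xoo.
  by apply: le_hausdorff => x [].
have Xfin : hausdorff n X \is a fin_num by rewrite ge0_fin_numE ?hausdorff_ge0.
rewrite -leeBrDr// -[leRHS]adde0.
have lim1 : (hausdorff n X - hausdorff n (X `&` ~` U) +
    \sum_(k <= i <oo) hausdorff n (layer U X i)) @[k --> \oo] -->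
    hausdorff n X - hausdorff n (X `&` ~` U) + 0.
  apply: cvgeD => //; last exact: cvg_cst.
  by rewrite fin_num_adde_defl.
rewrite -(cvg_lim _ lim1)//; apply: lime_ge; first by apply/cvg_ex; eexists; exact: lim1.
near=> k.
have h1 : hausdorff n (X `&` U) <= hausdorff n (deep U X k) +
    \sum_(k <= i <oo) hausdorff n (layer U X i).
  apply: (@le_trans _ _ (hausdorff n (deep U X k `|`
     \bigcup_i (if (k <= i)%N then layer U X i else set0)))).
    apply: le_hausdorff; rewrite open_deep// => x [m _ xm].
    have : deep U X (k + m)%N x by apply: deep_mono xm; rewrite leq_addl.
    move=> /deep_layer[xk|[i /= ki xi]]; first by left.
    by right; exists i => //; rewrite ki.
  apply: le_trans (outer_measureU2 _ _ _) _.
  rewrite leeD2l//; apply: le_trans (hausdorff_sigma_subadditive n _) _.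
  rewrite [leRHS]eseries_cond [leRHS]eseries_mkcond.
  apply: lee_nneseries => [i _ _|i _]; first exact: hausdorff_ge0.
  by case: ifP => //; rewrite hausdorff0.
apply: (le_trans h1); rewrite leeD2r// leeBrDr//.
have k0 : (0 < k.+1%:R^-1 :> R)%R by rewrite invr_gt0 ltr0n.
apply: le_trans (hausdorff_separated n k0 _) _.
  by move=> x y [Xx xU] [Xy Uy]; exact: xU.
by apply: le_hausdorff => x [[]|[]].
Unshelve. all: by end_near. Qed.

Lemma borel_caratheodory n (A : set (borel_rV R N)) :
  measurable A -> caratheodory_measurable (@hausdorff R N n) A.
Proof.
rewrite -[caratheodory_measurable _ A]/
  (@measurable _ (caratheodory_type (@hausdorff R N n)) A).
apply: smallest_sub; first exact: sigma_algebra_measurable.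
exact: open_caratheodory.
Qed.

Let hausdorff_semi_sigma_additive n :
  semi_sigma_additive (hausdorff n : set (borel_rV R N) -> \bar R).
Proof.
move=> F mF tF mUF.
apply: (@caratheodory_measure_sigma_additive _ _ (@hausdorff R N n)) => //.
- by move=> i; exact: borel_caratheodory.
- exact: borel_caratheodory.
Qed.

HB.instance Definition _ n := isMeasure.Build _ (borel_rV R N) R
  (hausdorff n : set (borel_rV R N) -> \bar R)
  (hausdorff0 n) (hausdorff_ge0 n) (@hausdorff_semi_sigma_additive n).

End hausdorff_borel.

Section hausdorff_lipschitz.
Context {R : realType} {N : nat}.
Implicit Types (A : set 'rV[R]_N) (n : nat) (f : 'rV[R]_N -> 'rV[R]_N).
Local Open Scope ereal_scope.

Lemma hausdorff_lipschitz n (L : R) A f : (0 < L)%R ->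
  (forall x y, A x -> A y -> (enorm (f x - f y) <= L * enorm (x - y))%R) ->
  hausdorff n (f @` A) <= (L ^+ n)%:E * hausdorff n A.
Proof.
move=> L0 fL; apply: ge_ereal_sup => _ [d /= d0 <-].
apply: (@le_trans _ _ ((L ^+ n)%:E * hausdorff_content n (L^-1 * d) A)); last first.
  by rewrite lee_wpmul2l ?lee_fin ?exprn_ge0 ?(ltW L0)// hausdorff_content_le// mulr_gt0// invr_gt0.
rewrite muleC -lee_pdivrMr ?exprn_gt0//; apply: le_ereal_inf_tmp => _ [E [AE sE] <-].
rewrite lee_pdivrMr ?exprn_gt0// muleC -nneseriesZl; last first.
  by move=> i _; rewrite lee_fin hsize_ge0.
apply: (@le_trans _ _ (\sum_(0 <= j <oo | f @` (E j `&` A) != set0)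
    (hsize n (f @` (E j `&` A)))%:E)).
  apply: ereal_inf_lbound; exists (fun j => f @` (E j `&` A)) => //.
  split=> [_ [x Ax <-]|j _ _ [x [Ex Ax] <-] [y [Ey Ay] <-]].
    by have [j _ Ejx] := AE _ Ax; exists j => //; exists x.
  apply: le_trans (fL _ _ Ax Ay) _; rewrite -ler_pdivlMl//.
  exact: sE Ex Ey.
rewrite eseries_mkcond [leRHS]eseries_mkcond; apply: lee_nneseries => [j _ _|j _].
  by case: ifP; rewrite ?lee_fin ?hsize_ge0.
case: ifPn => [/set0P[_ [x [Ex Ax] _]]|_]; last first.
  by case: ifP => // _; rewrite -EFinM lee_fin mulr_ge0 ?exprn_ge0 ?(ltW L0) ?hsize_ge0.
case: ifPn => [_|/negPn/eqP E0]; last by rewrite E0 in Ex.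
rewrite -EFinM lee_fin /hsize mulrCA ler_wpM2l ?(ltW (unit_ball_volume_gt0 _))//.
rewrite -exprMn lerXn2r ?nnegrE ?mulr_ge0 ?(ltW L0) ?invr_ge0 ?ediam_ge0//.
rewrite mulrA ler_wpM2r ?invr_ge0//.
apply: ediam_le; first by rewrite mulr_ge0 ?(ltW L0) ?ediam_ge0.
move=> _ _ [a [Ea Aa] <-] [b [Eb Ab] <-]; apply: le_trans (fL _ _ Aa Ab) _.
by rewrite ler_wpM2l ?(ltW L0)// (small_le_ediam (sE j)).
Qed.

Lemma hausdorff_isometry n A f g : 
  (forall x y, enorm (f x - f y) = enorm (x - y)) -> cancel f g ->
  hausdorff n (f @` A) = hausdorff n A.
Proof.
move=> fi fg; apply/eqP; rewrite eq_le; apply/andP; split.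
  have := @hausdorff_lipschitz n 1%R A f ltr01; rewrite expr1n mul1e; apply.
  by move=> x y _ _; rewrite mul1r fi.
have := @hausdorff_lipschitz n 1%R (f @` A) g ltr01; rewrite expr1n mul1e.
rewrite image_comp (_ : g \o f = id) ?image_id; last exact/funext.
by apply=> _ _ [x Ax <-] [y Ay <-]; rewrite mul1r !fg fi.
Qed.

Lemma hausdorffZ n A (t : R) : (0 < t)%R ->
  hausdorff n ((fun x => t *: x)%R @` A) = (t ^+ n)%:E * hausdorff n A.
Proof.
move=> t0; apply/eqP; rewrite eq_le; apply/andP; split.
  apply: hausdorff_lipschitz => // x y _ _.
  by rewrite -scalerBr enormZ (ger0_norm (ltW t0)).
rewrite muleC -lee_pdivlMr ?exprn_gt0// muleC -exprVn.
have := @hausdorff_lipschitz n t^-1 ((fun x => t *: x)%R @` A) (fun x => t^-1 *: x)%R.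
rewrite invr_gt0 image_comp (_ : _ \o _ = id) ?image_id; last first.
  by apply/funext => x /=; rewrite scalerA mulVf ?gt_eqF// scale1r.
apply=> // x y _ _.
by rewrite -scalerBr enormZ ger0_norm// invr_ge0 ltW.
Qed.

End hausdorff_lipschitz.

Section orthonormal.
Context {R : realType} {N : nat}.
Implicit Types (V : {vspace 'rV[R]_N}) (e : nat -> 'rV[R]_N) (n m : nat).

Definition orthonormal_in V n e :=
  (forall i, (i < n)%N -> e i \in V) /\
  forall i j, (i < n)%N -> (j < n)%N -> dot (e i) (e j) = (i == j)%:R.

Definition onproj n e (v : 'rV[R]_N) := \sum_(i < n) dot v (e i) *: e i.

Lemma dot_onsum V n e (t : 'I_n -> R) j : orthonormal_in V n e ->
  dot (\sum_(i < n) t i *: e i) (e (j : 'I_n)) = t j.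
Proof.
move=> [_ oe]; rewrite dot_suml (bigD1 j)//= dotZl oe// eqxx mulr1.
rewrite big1 ?addr0// => i ij; rewrite dotZl oe//.
by rewrite -val_eqE in ij; rewrite (negbTE ij) mulr0.
Qed.

Lemma orthonormal_leq_dim V n e : orthonormal_in V n e -> (n <= \dim V)%N.
Proof.
move=> oe; pose X := [tuple e i | i < n].
have fX : free X.
  apply/freeP => t; under eq_bigr do rewrite -tnth_nth tnth_mktuple.
  by move=> t0 i; rewrite -(dot_onsum t i oe) t0 dot0l.
move: (fX); rewrite /free size_tuple => /eqP <-; apply: dimvS.
by apply/span_subvP => _ /tnthP[i ->]; rewrite tnth_mktuple oe.1.
Qed.

Lemma orthonormal_extend V n e v : orthonormal_in V n e -> v \in V ->
  v - onproj n e v != 0 -> exists e', orthonormal_in V n.+1 e'.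
Proof.
move=> oe vV; set w := v - _ => w0.
have we j : (j < n)%N -> dot w (e j) = 0.
  move=> jn; rewrite dotBl (dot_onsum (fun i => dot v (e i)) (Ordinal jn) oe).
  by rewrite subrr.
have wV : w \in V.
  rewrite memvB// memv_suml// => i _; rewrite memvZ// oe.1//.
exists (fun j => if j == n then (enorm w)^-1 *: w else e j); split=> [i|i j].
  by case: eqP => [_ _|/eqP ni]; [exact: memvZ|rewrite ltnS leq_eqVlt (negbTE ni)/=; exact: oe.1].
rewrite ltnS (leq_eqVlt i) ltnS (leq_eqVlt j); have [->|ni] := eqVneq i n; last first.
  have [->|nj] /= := eqVneq j n => iN jN; last exact: oe.2.
  by rewrite dotZr dotC we// mulr0 (negbTE ni).
have [->|nj] /= := eqVneq j n => _ jN; last by rewrite dotZl we// mulr0.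
rewrite dotZl dotZr -sqr_enorm expr2 mulKf ?enorm_eq0// mulVf ?enorm_eq0//.
Qed.

Lemma orthonormal_exists V n : (n <= \dim V)%N -> exists e, orthonormal_in V n e.
Proof.
elim: n => [|n IH] nV; first by exists (fun=> 0); split.
have [e oe] := IH (ltnW nV).
suff [v vV v0] : exists2 v, v \in V & v - onproj n e v != 0.
  exact: orthonormal_extend oe vV v0.
apply: contrapT => nex.
have : (V <= <<[tuple e i | i < n]>>)%VS.
  apply/subvP => v vV; have /eqP : v - onproj n e v = 0.
    by apply: contrapT => /eqP v0; apply: nex; exists v.
  rewrite subr_eq0 => /eqP ->; apply: memv_suml => i _; apply: memvZ.
  by apply: memv_span; apply/tnthP; exists i; rewrite tnth_mktuple.
move=> /dimvS; have := dim_span [tuple e i | i < n]; rewrite size_tuple => h1 h2.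
by have := leq_trans nV (leq_trans h2 h1); rewrite ltnn.
Qed.

Lemma onprojE V n e v : \dim V = n -> orthonormal_in V n e -> v \in V ->
  v = \sum_(i < n) dot v (e i) *: e i.
Proof.
move=> dV oe vV; apply/eqP; rewrite -subr_eq0; apply/negPn/negP => v0.
have [e' oe'] := orthonormal_extend oe vV v0.
by have := orthonormal_leq_dim oe'; rewrite dV ltnn.
Qed.

Lemma sqr_enorm_onsum V n e (t : 'I_n -> R) : orthonormal_in V n e ->
  enorm (\sum_(i < n) t i *: e i) ^+ 2 = \sum_(i < n) t i ^+ 2.
Proof.
move=> oe; rewrite sqr_enorm dot_sumr; apply: eq_bigr => j _.
by rewrite dotZr (dot_onsum t j oe) expr2.
Qed.

End orthonormal.

Section grid_count.
Context {R : realType}.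
Implicit Types (n m : nat).

Lemma card_box_leq n m K (S : {set {ffun 'I_n -> 'I_m}}) :
  (forall g h i, g \in S -> h \in S -> (g i <= h i + K)%N) ->
  (#|S| <= K.+1 ^ n)%N.
Proof.
move=> SK; have [->|/set0Pn[g0 g0S]] := eqVneq S finset.set0.
  by rewrite cards0.
pose a i := [arg min_(g < g0 in S) (g i : nat)] i : nat.
have aS i : exists2 h, h \in S & a i = h i.
  by rewrite /a; case: arg_minnP => // h hS _; exists h.
have a_le i g : g \in S -> (a i <= g i)%N.
  by rewrite /a; case: arg_minnP => // h hS hm gS; exact: hm.
pose phi (g : {ffun 'I_n -> 'I_m}) : {ffun 'I_n -> 'I_K.+1} :=
  [ffun i => inord (g i - a i)].
have phi_inj : {in S &, injective phi}.
  move=> g h gS hS /ffunP gh; apply/ffunP => i; apply/val_inj.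
  have := congr1 val (gh i); rewrite !ffunE /= !inordK ?ltnS ?leq_subLR; last 2 first.
  - by have [k kS ->] := aS i; exact: SK.
  - by have [k kS ->] := aS i; exact: SK.
  by move=> /(congr1 (addn (a i))); rewrite !subnKC ?a_le.
rewrite -(card_in_imset phi_inj); apply: leq_trans (max_card _) _.
by rewrite card_ffun !card_ord.
Qed.

End grid_count.

Section counting.
Context {R : realType} {N : nat}.
Implicit Types (V : {vspace 'rV[R]_N}) (e : nat -> 'rV[R]_N) (n m M : nat).

Definition unit_cube V n e : set 'rV[R]_N :=
  [set z | z \in V /\ forall i, (i < n)%N -> 0 <= dot z (e i) <= 1].

(** A grid of mesh 1/m has m^n points in the cube, and a piece of diameter D
    contains at most (m D + 1)^n of them. *)
Lemma grid_count V n e M (F : nat -> set 'rV[R]_N) (D : nat -> R) m :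
  orthonormal_in V n e -> (0 < m)%N -> (forall j, 0 <= D j) ->
  (forall j, small (D j) (F j)) ->
  unit_cube V n e `<=` \bigcup_(j in `I_M) F j ->
  1 <= \sum_(j < M) (D j + m%:R^-1) ^+ n.
Proof.
move=> oe m0 D0 sF cF.
have mR : 0 < m%:R :> R by rewrite ltr0n.
pose p (g : {ffun 'I_n -> 'I_m}) := \sum_(i < n) ((g i)%:R / m%:R) *: e i.
have pQ g : unit_cube V n e (p g).
  split=> [|i ni]; first by apply: memv_suml => i _; apply/memvZ/oe.1.
  rewrite (dot_onsum (fun i => (g i)%:R / m%:R) (Ordinal ni) oe).
  by rewrite divr_ge0// ler_pdivrMr// mul1r ler_nat ltnW.
pose S j : {set {ffun 'I_n -> 'I_m}} := [set g | `[< F j (p g) >]]%SET.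
have inS j g : (g \in S j) -> F j (p g) by rewrite inE; case: asboolP.
have cS j : (#|S j| <= (Num.truncn (m%:R * D j)).+1 ^ n)%N.
  apply: card_box_leq => g h i /inS Fg /inS Fh.
  rewrite -leq_subLR.
  have gh : (g i)%:R - (h i)%:R <= m%:R * D j.
    rewrite -ler_pdivrMl// mulrC mulrBl -(dot_onsum (fun i => (g i)%:R / m%:R) i oe).
    rewrite -(dot_onsum (fun i => (h i)%:R / m%:R) i oe) -dotBl.
    apply: le_trans (cauchy_schwarz_dot _ _) _.
    have -> : enorm (e i) = 1.
      by rewrite /enorm oe.2// eqxx sqrtr1.
    by rewrite mulr1; exact: (sF j _ _ Fg Fh).
  rewrite truncn_ge_nat ?mulr_ge0//.
  have [hg|/ltnW hg] := leqP (h i) (g i); first by rewrite natrB.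
  by move: hg; rewrite -subn_eq0 => /eqP ->; rewrite mulr_ge0.
have card_le : (m ^ n <= \sum_(j < M) #|S j|)%N.
  have -> : (m ^ n = \sum_(g : {ffun 'I_n -> 'I_m}) 1)%N.
    by rewrite sum1_card card_ffun !card_ord.
  under [X in (_ <= X)%N]eq_bigr do rewrite -sum1_card big_mkcond /=.
  rewrite exchange_big /=; apply: leq_sum => g _.
  have [j /= jM Fj] := cF _ (pQ g).
  by rewrite (bigD1 (Ordinal jM))//= inE; case: asboolP.
have : (m%:R ^+ n <= \sum_(j < M) (m%:R * (D j + m%:R^-1)) ^+ n :> R).
  rewrite -natrX; move: card_le; rewrite -(ler_nat R) => /le_trans; apply.
  rewrite natr_sum; apply: ler_sum => j _.
  apply: (@le_trans _ _ ((Num.truncn (m%:R * D j)).+1 ^ n)%:R); first by rewrite ler_nat cS.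
  rewrite natrX lerXn2r ?nnegrE ?mulr_ge0 ?addr_ge0 ?invr_ge0 ?D0//.
  by rewrite mulrDr mulfV ?gt_eqF// -natr1 lerD2r truncn_le ?mulr_ge0.
under eq_bigr do rewrite exprMn.
by rewrite -mulr_sumr -{1}(mulr1 (_ ^+ n)) ler_pM2l// exprn_gt0.
Qed.

Lemma continuous_expn_near (d : R) n (eps : R) : 0 < eps ->
  exists2 eta, 0 < eta & (d + eta) ^+ n <= d ^+ n + eps.
Proof.
move=> e0; have c : {for 0, continuous (fun t : R => (d + t) ^+ n)}.
  apply: (@continuous_comp R R R (fun t => d + t) (fun x => x ^+ n)).
    by apply: (@cvgD R R R (nbhs (0:R))); [exact: cvg_cst|exact: cvg_id].
  exact: exprn_continuous.
have : nbhs (0:R) [set t | `|(d + 0) ^+ n - (d + t) ^+ n| <= eps].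
  exact: (@cvgr_dist_le R R R (nbhs (0:R)) _ _ _ c eps e0).
move=> /nbhs_ballP[r /= r0 rP].
exists (r / 2); first by rewrite divr_gt0.
have := rP (r / 2); rewrite /= -ball_normE /= sub0r normrN.
rewrite gtr0_norm ?divr_gt0// ltr_pdivrMr// ltr_pMr// ltr1n => /(_ isT).
by rewrite addr0 distrC ler_norml lerBlDl => /andP[].
Qed.

Lemma cube_cover_count V n e M (F : nat -> set 'rV[R]_N) (D : nat -> R) :
  orthonormal_in V n e -> (forall j, 0 <= D j) ->
  (forall j, small (D j) (F j)) ->
  unit_cube V n e `<=` \bigcup_(j in `I_M) F j ->
  1 <= \sum_(j < M) D j ^+ n.
Proof.
move=> oe D0 sF cF; rewrite leNgt; apply/negP => lt1.
pose gap := (1 - \sum_(j < M) D j ^+ n) / M.+1%:R.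
have gap0 : 0 < gap by rewrite divr_gt0 ?subr_gt0.
have /choice[eta etaP] : forall j, exists t : R, 0 < t /\ (D j + t) ^+ n <= D j ^+ n + gap.
  by move=> j; have [t t0 tP] := continuous_expn_near (D j) n gap0; exists t.
pose t := \big[Num.min/1]_(j < M) eta j.
have t0 : 0 < t by apply/bigmin_gtP; split=> // j _; exact: (etaP j).1.
pose m := (Num.truncn t^-1).+1.
have mt : m%:R^-1 <= t.
  by rewrite invf_ple ?posrE// ltW// truncnS_gt.
have := grid_count oe (ltn0Sn _ : (0 < m)%N) D0 sF cF.
rewrite leNgt => /negP; apply.
apply: (@le_lt_trans _ _ (\sum_(j < M) (D j ^+ n + gap))).
  apply: ler_sum => j _; apply: le_trans (etaP j).2.
  rewrite lerXn2r ?nnegrE ?addr_ge0 ?invr_ge0 ?D0 ?(ltW (etaP j).1)//.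
  by rewrite lerD2l (le_trans mt)// /t (bigD1 j)//= ge_min lexx.
rewrite big_split /= sumr_const card_ord -ltrBrDl -mulr_natl.
rewrite /gap mulrCA gtr_pMr ?subr_gt0// ltr_pdivrMr// mul1r ltr_nat//.
Qed.

Lemma compact_unit_cube V n e : \dim V = n -> orthonormal_in V n e ->
  compact (unit_cube V n e).
Proof.
move=> dV oe.
have -> : unit_cube V n e = [set z | z = onproj n e z] `&`
    \bigcap_(i in `I_n) ((fun z => dot z (e i)) @^-1` `[0, 1]).
  apply/seteqP; split=> [z [zV ze]|z /= [zp ze]].
    by split=> [|i ni] /=; [exact: onprojE dV oe zV|rewrite in_itv /= ze].
  split; first by rewrite zp; apply: memv_suml => i _; apply/memvZ/oe.1.
  by move=> i ni; have := ze i ni; rewrite /= in_itv.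
apply: bounded_closed_compact.
  exists (n%:R); split; first exact: num_real.
  move=> M nM z [/= zp ze]; apply: le_trans (norm_le_enorm _) (le_trans _ (ltW nM)).
  rewrite zp enorm_le// /onproj -sqr_enorm (sqr_enorm_onsum (fun i => dot z (e i)) oe).
  apply: (@le_trans _ _ (\sum_(i < n) 1)).
    apply: ler_sum => i _; have := ze i (ltn_ord i); rewrite /= in_itv /= => /andP[z0 z1].
    by rewrite expr_le1.
  rewrite sumr_const card_ord -natrX ler_nat.
  by case: (n) => // k; rewrite expnS expn1 leq_pmull.
apply: closedI; last first.
  apply: closed_bigI => i _; apply: closed_comp; last exact: itv_closed.
  by move=> z _; exact: continuous_dotl.
have -> : [set z | z = onproj n e z] =
    (fun z => enorm (z - onproj n e z)) @^-1` [set t | t <= 0].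
  apply/seteqP; split=> z /=; first by move=> zp; rewrite -zp subrr enorm0.
  by rewrite le_eqVlt ltNge enorm_ge0 orbF enorm_eq0 subr_eq0 => /eqP.
apply: closed_comp; last exact: closed_le.
move=> z _; apply: continuous_comp; last exact: continuous_enorm.
apply: (@cvgB R _ _ (nbhs z)); first exact: cvg_id.
apply: (@continuous_big 'rV[R]_N 'I_n +%R 0 xpredT _ 'rV[R]_N (index_enum 'I_n)
  (fun i z => dot z (e i) *: e i)); first exact: add_continuous.
move=> i _ y; apply: (@cvgZ R _ _ (nbhs y)); first exact: continuous_dotl.
exact: (@cvg_cst _ _ _ (nbhs y)).
Qed.

End counting.

Section hausdorff_bounds.
Context {R : realType} {N : nat}.
Implicit Types (V : {vspace 'rV[R]_N}) (e : nat -> 'rV[R]_N) (n m : nat).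
Local Open Scope ereal_scope.

Lemma hsize0 n : (0 < n)%N -> hsize n (set0 : set 'rV[R]_N) = 0%R.
Proof.
move=> n0; rewrite /hsize (_ : ediam _ = 0%R) ?mul0r ?expr0n ?gtn_eqF ?mulr0//.
apply/eqP; rewrite eq_le ediam_ge0 andbT; apply: ediam_le => //.
Qed.

(** Distances dominate differences of coordinates, so a cover of the unit cube
    has to be as expensive as counting grid points predicts. *)
Lemma hausdorff_cube_ge V n e : (0 < n)%N -> \dim V = n -> orthonormal_in V n e ->
  (unit_ball_volume n / 2 ^+ n)%:E <= hausdorff n (unit_cube V n e).
Proof.
move=> n0 dV oe; apply: le_trans (hausdorff_content_le n _ ltr01).
apply: le_ereal_inf_tmp => _ [E [QE sE] <-].
have -> : \sum_(0 <= j <oo | E j != set0)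
    (unit_ball_volume n * (ediam (E j) / 2) ^+ n)%:E = \sum_(0 <= j <oo) (hsize n (E j))%:E.
  rewrite eseries_mkcond; apply: eq_eseriesr => j _; case: ifPn => //.
  by move=> /negPn/eqP ->; rewrite hsize0.
apply/lee_addgt0Pr => eps eps0.
have v0 : (0 < unit_ball_volume n / 2 ^+ n :> R)%R.
  by rewrite divr_gt0 ?exprn_gt0// unit_ball_volume_gt0.
have /choice[eta etaP] : forall j, exists t : R, (0 < t)%R /\
    (unit_ball_volume n / 2 ^+ n * (ediam (E j) + t) ^+ n <=
     hsize n (E j) + eps / (2 ^ j.+1)%:R)%R.
  move=> j; have e'0 : (0 < eps / (2 ^ j.+1)%:R / (unit_ball_volume n / 2 ^+ n))%R.
    by rewrite !divr_gt0// ?unit_ball_volume_gt0// ?ltr0n ?expn_gt0.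
  have [t t0 tP] := continuous_expn_near (ediam (E j)) n e'0.
  exists t; split=> //; move: tP; rewrite -(ler_pM2l v0) => /le_trans; apply.
  rewrite mulrDr mulrCA divff ?gt_eqF// mulr1 lerD2r /hsize expr_div_n.
  by rewrite le_eqVlt; apply/orP; left; apply/eqP; rewrite mulrA mulrAC -mulrA.
pose U j := \bigcup_(x in E j) eball x (eta j / 2).
pose D j : R := (ediam (E j) + eta j)%R.
have D0 j : (0 <= D j)%R by rewrite addr_ge0 ?ediam_ge0// ltW// (etaP j).1.
have sU j : small (D j) (U j).
  move=> x y [a Ea xa] [b Eb yb]; rewrite /eball /= in xa yb.
  have := small_le_ediam (sE j) Ea Eb; have := ler_enormB x a y.
  have := ler_enormB a b y; rewrite (enormBC b y) /D; move: xa yb.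
  by move: (eta j) => t; lra.
have oU j : open (U j) by apply: bigcup_open => x _; exact: open_eball.
have := compact_unit_cube dV oe; rewrite compact_cover.
move=> /(_ _ setT U (fun j _ => oU j)) [|D' _ QD'].
  move=> x /QE[j _ Ejx]; exists j => //; exists x => //.
  by apply: eball_center; rewrite divr_gt0// (etaP j).1.
pose M := (\max_(j <- finmap.enum_fset D') j).+1.
have QM : unit_cube V n e `<=` \bigcup_(j in `I_M) U j.
  move=> x /QD'[j jD' Ujx]; exists j => //=.
  by rewrite /M ltnS; apply: (@leq_bigmax_seq _ _ xpredT id).
have := cube_cover_count oe D0 sU QM; rewrite -(ler_pM2l v0) mulr1 mulr_sumr.
rewrite -lee_fin => /le_trans; apply.
apply: (@le_trans _ _ (\sum_(j < M) (hsize n (E j) + eps / (2 ^ j.+1)%:R)%:E)).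
  by rewrite sumEFin lee_fin; apply: ler_sum => j _; exact: (etaP j).2.
have h0 j : 0 <= (hsize n (E j))%:E by rewrite lee_fin hsize_ge0.
apply: le_trans (epsilon_trick xpredT h0 (ltW eps0)).
rewrite -(big_mkord xpredT (fun j => (hsize n (E j) + eps / (2 ^ j.+1)%:R)%:E)).
apply: (nneseries_lim_ge (P := xpredT)) => j _ _.
by rewrite lee_fin addr_ge0 ?hsize_ge0// divr_ge0// ltW.
Qed.

Definition cell V n e m (g : 'I_n -> nat) : set 'rV[R]_N :=
  [set z | z \in V /\ forall i : 'I_n,
    (`|dot z (e i) + 1 - (2 * (g i)%:R + 1) / m%:R| <= m%:R^-1)%R].

Lemma small_cell V n e m g : \dim V = n -> orthonormal_in V n e ->
  small (2 * n%:R / m%:R) (@cell V n e m g).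
Proof.
move=> dV oe x y [xV xg] [yV yg].
have m0 : (0 <= 2 * n%:R / m%:R :> R)%R by rewrite divr_ge0// mulr_ge0.
rewrite -(@ler_pXn2r _ 2)// ?nnegrE ?enorm_ge0//.
rewrite (onprojE dV oe (memvB xV yV)) (sqr_enorm_onsum (fun i => dot (x - y) (e i)) oe).
apply: (@le_trans _ _ (\sum_(i < n) (2 / m%:R) ^+ 2)%R).
  apply: ler_sum => i _; rewrite -(real_normK (num_real (dot _ _))).
  rewrite lerXn2r ?nnegrE ?divr_ge0// dotBl.
  have := xg i; have := yg i; rewrite !ler_norml.
  move: (dot x (e i)) (dot y (e i)) ((2 * (g i)%:R + 1) / m%:R : R)%R (m%:R^-1 : R)%R => a b c d.
  by move=> /andP[? ?] /andP[? ?]; apply/andP; split; lra.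
rewrite sumr_const card_ord -[leLHS]mulr_natl.
rewrite mulrAC [leRHS]exprMn mulrC ler_wpM2l ?sqr_ge0// -natrX ler_nat.
by case: (n) => // k; rewrite expnS expn1 leq_pmull.
Qed.

Lemma cell_cover V n e m z : (0 < m)%N -> orthonormal_in V n e -> z \in V ->
  (enorm z <= 1)%R -> exists g : {ffun 'I_n -> 'I_m}, @cell V n e m (fun i => g i) z.
Proof.
move=> m0 oe zV z1; have mR : (0 < m%:R :> R)%R by rewrite ltr0n.
have c1 (i : 'I_n) : (`|dot z (e i)| <= 1)%R.
  apply: le_trans (cauchy_schwarz_abs _ _) _.
  by rewrite /enorm (oe.2 i i)// eqxx sqrtr1 mulr1.
pose h (i : 'I_n) : nat := minn m.-1 (Num.truncn (m%:R * (dot z (e i) + 1) / 2)).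
have hm i : (h i < m)%N by rewrite /h -[X in (_ < X)%N](prednK m0) ltnS geq_minl.
exists [ffun i => Ordinal (hm i)]; split=> // i; rewrite ffunE /=.
set c := dot z (e i); have := c1 i; rewrite -/c ler_norml => /andP[cl cu].
set t := (m%:R * (c + 1) / 2)%R.
have t0 : (0 <= t)%R by rewrite divr_ge0// mulr_ge0// -lerBlDr sub0r.
have tm : (t <= m%:R)%R by rewrite /t -mulrA ler_piMr//; lra.
have [ht1 ht2] : ((h i)%:R <= t /\ t <= (h i)%:R + 1)%R.
  have tr := truncn_itv t0; rewrite /h -/c -/t; have [tm1|tm1] := leqP m.-1 (Num.truncn t).
    split; last by rewrite natr1 prednK.
    apply: le_trans (_ : (Num.truncn t)%:R <= t)%R; first by rewrite ler_nat.
    by case/andP: tr.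
  by case/andP: tr => t1 t2; split=> //; rewrite natr1 ltW.
have -> : (c + 1 = 2 * t / m%:R)%R.
  by rewrite /t mulrC [(_ * (c + 1))%R]mulrC; field; rewrite gt_eqF.
rewrite -mulrBl normrM [X in (_ * X)%R]ger0_norm ?invr_ge0// ler_piMl ?invr_ge0//.
by rewrite ler_norml; apply/andP; split; lra.
Qed.

Lemma hausdorff_unit_ball_le V n : (0 < n)%N -> \dim V = n ->
  hausdorff n ([set` V] `&` ceball 0%R 1%R) <= (unit_ball_volume n * n%:R ^+ n)%:E.
Proof.
move=> n0 dV; have [e oe] := @orthonormal_exists R N V n (eq_leq (esym dV)).
apply: ge_ereal_sup => _ [d /= d0 <-].
pose m := (Num.truncn (2 * n%:R / d)%R).+1.
have mR : (0 < m%:R :> R)%R by rewrite ltr0n.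
have md : (2 * n%:R / m%:R <= d)%R.
  by rewrite ler_pdivrMr// -ler_pdivrMl// mulrC ltW// truncnS_gt.
pose K := #|{ffun 'I_n -> 'I_m}|.
pose F (j : nat) : set 'rV[R]_N :=
  if insub j is Some o then @cell V n e m (fun i => enum_val (o : 'I_K) i) else set0.
have sF j : small (2 * n%:R / m%:R) (F j).
  by rewrite /F; case: insubP => [k _ _|_]//; exact: small_cell.
apply: (@le_trans _ _ (\sum_(0 <= j <oo) (hsize n (F j))%:E)).
  apply: ereal_inf_lbound; exists F.
    split=> [z [zV]|j x y Fx Fy]; last exact: le_trans (sF j _ _ Fx Fy) md.
    rewrite /ceball /= subr0 => z1.
    have [g gz] := cell_cover (ltn0Sn _ : (0 < m)%N) oe zV z1.
    exists (enum_rank g) => //; rewrite /F valK.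
    by move: gz; rewrite /cell /= enum_rankK.
  rewrite eseries_mkcond; apply: eq_eseriesr => j _; case: ifPn => // /negPn/eqP ->.
  by rewrite hsize0.
rewrite (nneseries_split 0 K); last by move=> *; rewrite lee_fin hsize_ge0.
rewrite [X in _ + X]eseries0 ?adde0; last first.
  by move=> j Kj _; rewrite /F insubF ?hsize0// ltnNge Kj.
apply: (@le_trans _ _ (\sum_(0 <= j < 0 + K) (unit_ball_volume n * (n%:R / m%:R) ^+ n)%:E)).
  apply: lee_sum => j _; rewrite lee_fin ler_wpM2l ?(ltW (unit_ball_volume_gt0 _))//.
  rewrite lerXn2r ?nnegrE ?divr_ge0 ?ediam_ge0//.
  have h : (ediam (F j) <= 2 * n%:R / m%:R)%R.
    by apply: ediam_le; [rewrite divr_ge0// mulr_ge0|exact: sF].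
  by rewrite ler_pdivrMr// mulrC mulrA.
rewrite sumEFin lee_fin sumr_const_nat subn0 add0n /K card_ffun !card_ord.
by rewrite -[leLHS]mulr_natr natrX -mulrA -exprMn mulfVK// gt_eqF.
Qed.

End hausdorff_bounds.

Section borel_measurability.
Context {R : realType} {N : nat}.
Local Notation E := (borel_rV R N).
Implicit Types (V : {vspace 'rV[R]_N}).

Lemma continuous_measurable_rV (f : 'rV[R]_N -> R) : continuous f ->
  measurable_fun [set: E] (f : E -> R).
Proof.
move=> cf; apply: (measurability _ (RGenOInfty.measurableE R)).
move=> _ [_ [x ->] <-]; rewrite setTI; apply: sub_sigma_algebra => /=.
by apply: open_comp => // y _; exact: cf.
Qed.

Lemma measurable_open (U : set 'rV[R]_N) : open U -> measurable (U : set E).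
Proof. exact: sub_sigma_algebra. Qed.

Lemma measurable_closed (U : set 'rV[R]_N) : closed U -> measurable (U : set E).
Proof.
move=> cU; rewrite -(setCK U); apply: measurableC; apply: measurable_open.
exact: closed_openC.
Qed.

(** Open sets are countable unions of rational boxes, so measurability into R^N
    can be tested on coordinates. *)
Lemma measurable_fun_coord d (T : measurableType d) (f : T -> E) :
  (forall i, measurable_fun [set: T] (fun x => (f x : 'rV[R]_N) 0 i)) ->
  measurable_fun [set: T] f.
Proof.
move=> mf; apply: (@measurability _ _ T E setT f (@open 'rV[R]_N) erefl) => _ [U oU <-]; rewrite setTI.
pose box (qk : 'rV[rat]_N * nat) : set 'rV[R]_N :=
  [set x | forall i, `|x 0 i - ratr (qk.1 0 i)| < qk.2.+1%:R^-1].
pose F qk : set T := if `[< box qk `<=` U >] then f @^-1` box qk else set0.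
have -> : f @^-1` U = \bigcup_qk F qk.
  apply/seteqP; split=> [x Ux|x [qk _]]; last first.
    by rewrite /F; case: asboolP => // bU /bU.
  have [r r0 rU] := (nbhs_ballP _ _).1 (open_nbhs_nbhs (conj oU Ux)).
  pose k := Num.truncn (2 / r).
  have k0 : 0 < k.+1%:R^-1 :> R by rewrite invr_gt0.
  have kr : k.+1%:R^-1 < r / 2.
    by rewrite invf_plt ?posrE ?divr_gt0// invf_div truncnS_gt.
  have /choice[q qP] : forall i, exists q : rat, `|(f x : 'rV[R]_N) 0 i - ratr q| < k.+1%:R^-1.
    move=> i; have : (f x : 'rV[R]_N) 0 i < (f x : 'rV[R]_N) 0 i + k.+1%:R^-1 by rewrite ltrDl.
    move=> /rat_in_itvoo[q]; rewrite in_itv /= => /andP[q1 q2]; exists q.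
    by rewrite distrC gtr0_norm ?subr_gt0// ltrBlDl.
  exists (\row_i q i, k) => //; rewrite /F asboolT => [i /=|y yb]; first by rewrite mxE.
  apply: rU; split=> // i j; rewrite (ord1 i) /ball /=.
  have := yb j; rewrite /= mxE => h1; have h2 := qP j.
  rewrite (le_lt_trans (ler_distD (ratr (q j)) _ _))// [X in _ + X]distrC.
  apply: lt_trans (ltrD h2 h1) _; move: (k.+1%:R^-1 : R) kr => a; lra.
apply: countable_bigcupT_measurable => // qk; rewrite /F; case: ifP => // _.
have -> : f @^-1` box qk = \bigcap_(i in [set: 'I_N])
    ((fun x => (f x : 'rV[R]_N) 0 i) @^-1` (@ball R R (ratr (qk.1 0 i)) qk.2.+1%:R^-1)).
  apply/seteqP; split=> [x h i _|x h i]; first by rewrite /ball /= distrC; exact: h.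
  by have := h i I; rewrite /ball /= distrC.
apply: fin_bigcap_measurable => // i _; rewrite -[X in measurable X]setTI.
by apply: mf => //; exact: measurable_ball.
Qed.

Lemma measurable_scale_pair :
  measurable_fun [set: E * R] (fun p => (p.2 *: (p.1 : 'rV[R]_N)) : E).
Proof.
apply: measurable_fun_coord => i; under eq_fun do rewrite mxE.
apply: measurable_funM; first exact: measurable_snd.
apply: (measurableT_comp (f := fun x : E => (x : 'rV[R]_N) 0 i)) => //.
by apply: continuous_measurable_rV => x; exact: coord_continuous.
Qed.

Lemma measurable_scale (t : R) :
  measurable_fun [set: E] (fun x => (t *: (x : 'rV[R]_N)) : E).
Proof.
apply: measurable_fun_coord => i; under eq_fun do rewrite mxE.
apply: measurable_funM; first exact: measurable_cst.
by apply: continuous_measurable_rV => x; exact: coord_continuous.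
Qed.

Lemma measurable_opp_rV :
  measurable_fun [set: E] (fun x => (- (x : 'rV[R]_N)) : E).
Proof.
by under eq_fun do rewrite -scaleN1r; exact: measurable_scale.
Qed.

Lemma measurable_shift (a : 'rV[R]_N) :
  measurable_fun [set: E] (fun x => (a + (x : 'rV[R]_N)) : E).
Proof.
apply: measurable_fun_coord => i; under eq_fun do rewrite mxE.
apply: measurable_funD; first exact: measurable_cst.
by apply: continuous_measurable_rV => x; exact: coord_continuous.
Qed.

Lemma measurable_enorm : measurable_fun [set: E] (enorm : E -> R).
Proof. by apply: continuous_measurable_rV; exact: continuous_enorm. Qed.

Lemma closed_vspace V : closed ([set` V] : set 'rV[R]_N).
Proof.
have [e oe] := @orthonormal_exists R N V _ (leqnn _).
have -> : [set` V] = (fun z => enorm (z - onproj (\dim V) e z)) @^-1` [set t | t <= 0].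
  apply/seteqP; split=> z /= => [zV|].
    by rewrite /onproj -(onprojE erefl oe zV) subrr enorm0.
  rewrite le_eqVlt ltNge enorm_ge0 orbF enorm_eq0 subr_eq0 => /eqP ->.
  by apply: memv_suml => i _; apply/memvZ/oe.1.
apply: closed_comp; last exact: closed_le.
move=> z _; apply: continuous_comp; last exact: continuous_enorm.
apply: (@cvgB R _ _ (nbhs z)); first exact: cvg_id.
apply: (@continuous_big 'rV[R]_N 'I_(\dim V) +%R 0 xpredT _ 'rV[R]_N (index_enum 'I_(\dim V))
  (fun i z => dot z (e i) *: e i)); first exact: add_continuous.
move=> i _ y; apply: (@cvgZ R _ _ (nbhs y)); first exact: continuous_dotl.
exact: (@cvg_cst _ _ _ (nbhs y)).
Qed.

Lemma measurable_vspace V : measurable ([set` V] : set E).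
Proof. by apply: measurable_closed; exact: closed_vspace. Qed.

Lemma measurable_eball (x : 'rV[R]_N) r : measurable (eball x r : set E).
Proof. by apply: measurable_open; exact: open_eball. Qed.

Lemma measurable_ceball (x : 'rV[R]_N) r : measurable (ceball x r : set E).
Proof. by apply: measurable_closed; exact: closed_ceball. Qed.

End borel_measurability.

Section integral_invariance.
Context {R : realType} {N : nat}.
Local Notation E := (borel_rV R N).
Local Notation H n := (hausdorff n : set E -> \bar R).
Implicit Types (V : {vspace 'rV[R]_N}) (F : E -> \bar R).
Local Open Scope ereal_scope.

Lemma vspace_scaleE V (t : R) : (t != 0)%R ->
  (fun x : E => (t *: (x : 'rV[R]_N))%R : E) @^-1` [set` V] = [set` V].
Proof.
move=> t0; apply/seteqP; split=> z /= zV; last exact: memvZ.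
by have := memvZ t^-1 zV; rewrite scalerA mulVf// scale1r.
Qed.

Lemma hausdorff_integral_scale n V F (t : R) : (0 < t)%R ->
  measurable_fun [set: E] F -> (forall z, 0 <= F z) ->
  \int[H n]_(z in [set` V]) F (t *: (z : 'rV[R]_N))%R =
  (t^-1 ^+ n)%:E * \int[H n]_(z in [set` V]) F z.
Proof.
move=> t0 mF F0; pose phi := fun x : E => (t *: (x : 'rV[R]_N))%R : E.
have mphi : measurable_fun [set: E] phi by exact: measurable_scale.
have mV := @measurable_vspace R N V.
have c0 : (0 <= t^-1 ^+ n)%R by rewrite exprn_ge0// invr_ge0 ltW.
rewrite -[X in X%:E * _]/((NngNum c0)%:num).
rewrite -ge0_integral_mscale//; last exact: measurable_funTS.
transitivity (\int[pushforward (H n) phi]_(z in [set` V]) F z).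
  rewrite (ge0_integral_pushforward mphi)//; last exact: measurable_funTS.
  by rewrite /phi vspace_scaleE// gt_eqF.
apply: eq_measure_integral => A mA _.
rewrite /mscale /= /pushforward.
have -> : phi @^-1` A = (fun x => t^-1 *: x)%R @` A.
  apply/seteqP; split=> [z Az|_ [z Az <-]].
    by exists (phi z) => //; rewrite /phi scalerA mulVf ?gt_eqF// scale1r.
  by rewrite /phi /= scalerA mulfV ?gt_eqF// scale1r.
by rewrite hausdorffZ// invr_gt0.
Qed.

Lemma hausdorff_integral_opp n (D : set E) F : measurable D ->
  (forall z : 'rV[R]_N, D z -> D (- z)%R) -> measurable_fun [set: E] F ->
  \int[H n]_(z in D) F (- (z : 'rV[R]_N))%R = \int[H n]_(z in D) F z.
Proof.
move=> mD sD mF; pose phi := fun x : E => (- (x : 'rV[R]_N))%R : E.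
have mphi : measurable_fun [set: E] phi by exact: measurable_opp_rV.
have key G : measurable_fun [set: E] G -> (forall z, 0 <= G z) ->
    \int[H n]_(z in D) G (phi z) = \int[H n]_(z in D) G z.
  move=> mG G0; transitivity (\int[pushforward (H n) phi]_(z in D) G z).
    rewrite (ge0_integral_pushforward mphi)//; last exact: measurable_funTS.
    congr (integral _ _ _); apply/seteqP; split=> z; first exact: sD.
    by move/sD; rewrite /phi/= opprK.
  apply: eq_measure_integral => A mA _.
  change (hausdorff n (phi @^-1` A) = hausdorff n A).
  have -> : phi @^-1` A = (fun x : 'rV[R]_N => - x)%R @` A.
    apply/seteqP; split=> [z Az|_ [z Az <-]]; last by rewrite /phi/= opprK.
    by exists (phi z) => //; rewrite /phi opprK.
  apply: (@hausdorff_isometry _ _ n A -%R -%R); last exact: opprK.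
  by move=> x y; rewrite -opprD enormN.
rewrite integralE [RHS]integralE; congr (_ - _).
  rewrite -[RHS](key _ _ (funepos_ge0 F)); last exact: measurable_funepos.
  by apply: eq_integral => x _; rewrite !funeposE.
rewrite -[RHS](key _ _ (funeneg_ge0 F)); last exact: measurable_funeneg.
by apply: eq_integral => x _; rewrite !funenegE.
Qed.

Lemma hausdorff_ball_lty n V (r : R) : (0 < n)%N -> \dim V = n -> (0 < r)%R ->
  hausdorff n ([set` V] `&` ceball 0%R r) < +oo.
Proof.
move=> n0 dV r0.
have -> : [set` V] `&` ceball 0%R r = (fun x => r *: x)%R @` ([set` V] `&` ceball 0%R 1%R).
  apply/seteqP; split=> [z [/= zV]|_ [z [/= zV zr] <-]].
    rewrite /ceball /= subr0 => zr.
    exists (r^-1 *: z)%R; last by rewrite scalerA mulfV ?gt_eqF// scale1r.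
    split; first exact: memvZ.
    have ri : (0 <= r^-1)%R by rewrite invr_ge0 ltW.
    by rewrite /ceball /= subr0 enormZ (ger0_norm ri) ler_pdivrMl// mulr1.
  split; first exact: memvZ.
  move: zr; rewrite /ceball/= !subr0 enormZ (ger0_norm (ltW r0)) => zr.
  by rewrite ler_piMr// ltW.
rewrite hausdorffZ//; apply: (@le_lt_trans _ _ ((r ^+ n)%:E * (unit_ball_volume n * n%:R ^+ n)%:E)).
  by rewrite lee_wpmul2l ?lee_fin ?exprn_ge0 ?(ltW r0)// hausdorff_unit_ball_le.
by rewrite -EFinM ltry.
Qed.

Lemma hausdorff_vspace_sigma_finite V : (0 < \dim V)%N ->
  sigma_finite [set: E] (mrestr (H (\dim V)) (@measurable_vspace R N V)).
Proof.
move=> V0; exists (fun k => ceball 0%R k.+1%:R).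
  apply/seteqP; split=> z // _; exists (Num.truncn (enorm (z : 'rV[R]_N))) => //.
  by rewrite /ceball /= subr0 ltW// truncnS_gt.
move=> i; split; first exact: measurable_ceball.
by rewrite /mrestr setIC hausdorff_ball_lty.
Qed.

End integral_invariance.

Section vspace_measure.
Context {R : realType} {N : nat}.
Variable (V : {vspace 'rV[R]_N}) (V0 : (0 < \dim V)%N).
Local Notation E := (borel_rV R N).

Definition vspace_measure of (0 < \dim V)%N : set E -> \bar R :=
  mrestr (hausdorff (\dim V) : set E -> \bar R) (@measurable_vspace R N V).

HB.instance Definition _ := Measure.on (vspace_measure V0).

HB.instance Definition _ := @Measure_isSigmaFinite.Build _ E R
  (vspace_measure V0) (hausdorff_vspace_sigma_finite V0).

End vspace_measure.

Section ftc_closed.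
Context {R : realType}.
Local Notation mu := (@lebesgue_measure R).
Implicit Types (f F : R -> R) (a b : R).

Lemma FTC2_is_derive f F a b : a <= b ->
  (forall x, a <= x <= b -> is_derive x 1 F (f x)) ->
  (forall x, a <= x <= b -> {for x, continuous f}) ->
  (\int[mu]_(x in `[a, b]) (f x)%:E = (F b - F a)%:E)%E.
Proof.
rewrite le_eqVlt => /predU1P[-> _ _|ab dF cf].
  by rewrite set_itv1 integral_set1 subrr.
rewrite EFinB; apply: continuous_FTC2 => //.
- apply: continuous_in_subspaceT => x; rewrite inE /= in_itv /=; exact: cf.
- have cF x : a <= x <= b -> F y @[y --> x] --> F x.
    by move=> /dF dFx; apply: differentiable_continuous; apply/derivable1_diffP.
  split=> [x| |].
  + by rewrite in_itv /= => /andP[ax xb]; case: (dF x); rewrite ?(ltW ax) ?(ltW xb).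
  + by apply: cvg_at_right_filter; apply: cF; rewrite lexx ltW.
  + by apply: cvg_at_left_filter; apply: cF; rewrite lexx ltW.
- move=> x; rewrite in_itv /= => /andP[ax xb].
  by rewrite derive1E; case: (dF x); rewrite ?(ltW ax) ?(ltW xb).
Qed.

Lemma continuous_powR_pos p x : 0 < x -> {for x, continuous ((@powR R)^~ p)}.
Proof.
move=> x0; apply: differentiable_continuous; apply/derivable1_diffP.
by case: (is_derive1_powR p x0).
Qed.

Lemma integral_powR a b p : 0 < a -> a <= b -> p + 1 != 0 ->
  (\int[mu]_(x in `[a, b]) (x `^ p)%:E = ((b `^ (p + 1) - a `^ (p + 1)) / (p + 1))%:E)%E.
Proof.
move=> a0 ab p1; rewrite mulrC mulrBr.
apply: (@FTC2_is_derive _ (fun x => (p + 1)^-1 * x `^ (p + 1))) => // x /andP[ax _].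
  have x0 := lt_le_trans a0 ax.
  apply: (is_derive_eq (is_deriveZ (p + 1)^-1 (is_derive1_powR (p + 1) x0))).
  by rewrite addrK; exact: mulKf.
by apply: continuous_powR_pos; exact: lt_le_trans a0 ax.
Qed.

Lemma integral_inv_half a : 0 < a ->
  (\int[mu]_(x in `[(a / 2)%R, a]) (x^-1)%:E = (ln 2)%:E)%E.
Proof.
move=> a0; have a2 : 0 < a / 2 by rewrite divr_gt0.
have -> : ln 2 = ln a - ln (a / 2) :> R.
  by rewrite ln_div ?posrE// opprB addrC subrK.
apply: FTC2_is_derive.
- by rewrite ler_pdivrMr// ler_pMr// ler1n.
- by move=> x /andP[ax _]; apply: is_derive1_ln; exact: lt_le_trans a2 ax.
- by move=> x /andP[ax _]; apply: inv_continuous; rewrite gt_eqF// (lt_le_trans a2).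
Qed.

End ftc_closed.

Section polar.
Context {R : realType} {N : nat}.
Local Notation E := (borel_rV R N).
Variables (V : {vspace 'rV[R]_N}) (V0 : (0 < \dim V)%N).
Local Notation n := (\dim V).
Local Notation H := (hausdorff n : set E -> \bar R).
Local Notation lam := (@lebesgue_measure R).
Local Open Scope ereal_scope.

Definition shell : set E := [set z : 'rV[R]_N | (1 <= enorm z <= 2)%R].

Lemma in_shell (z : 'rV[R]_N) : (z \in shell) = (1 <= enorm z <= 2)%R.
Proof. by apply/idP/idP; rewrite inE. Qed.

Lemma measurable_shell : measurable shell.
Proof.
have -> : shell = ceball 0%R 2%R `\` eball 0%R 1%R.
  apply/seteqP; split=> z; rewrite /shell /ceball /eball /= subr0.
    by move=> /andP[z1 z2]; split=> //; rewrite ltNge z1.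
  by move=> [z2 /negP]; rewrite -leNgt => ->.
by apply: measurableD; [exact: measurable_ceball|exact: measurable_eball].
Qed.

Lemma vspace_integralE (F : E -> \bar R) :
  \int[H]_(z in [set` V]) F z = \int[vspace_measure V0]_(z in [set` V]) F z.
Proof.
apply: eq_measure_integral => A mA AV.
by rewrite /vspace_measure /mrestr; congr (hausdorff _ _); apply/esym/setIidl.
Qed.

Lemma vspace_measure_integralT (F : E -> \bar R) :
  measurable_fun [set: E] F -> (forall z, 0 <= F z) ->
  \int[vspace_measure V0]_z F z = \int[vspace_measure V0]_(z in [set` V]) F z.
Proof.
move=> mF F0; have mV := @measurable_vspace R N V.
rewrite -(setvU [set` V]) ge0_integral_setU//; last 3 first.
- exact: measurableC.
- by rewrite setvU.
- by apply/disj_setPS => x [].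
rewrite (_ : \int[_]_(x in ~` _) _ = 0) ?add0e//.
apply: (null_set_integral (measurableC mV)); first exact: measurable_funTS.
change (hausdorff n (~` [set` V] `&` [set` V]) = 0).
by rewrite setICl; exact: hausdorff0.
Qed.

Definition radial_weight (p : E * R) : R :=
  if (0 < p.2)%R && (p.2 <= enorm (p.1 : 'rV[R]_N) <= 2 * p.2)%R then (p.2 `^ (-1))%R else 0%R.

Lemma measurable_radial_weight : measurable_fun [set: E * R] radial_weight.
Proof.
have me : measurable_fun [set: E * R] (fun p => enorm (p.1 : 'rV[R]_N)).
  by apply: (measurableT_comp (f := enorm : E -> R)); [exact: measurable_enorm|exact: measurable_fst].
apply: measurable_fun_ifT => //.
- apply: measurable_and; first by apply: measurable_fun_ltr.
  apply: measurable_and; first by apply: measurable_fun_ler.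
  by apply: measurable_fun_ler => //; apply: measurable_funM.
- by apply: (measurableT_comp (measurable_powR _)); exact: measurable_snd.
Qed.

(** Polar coordinates without the sphere: averaging the dilation-invariant
    measure over all dilations replaces V by a shell times half a line. *)
Lemma polar_coordinates (F : E -> \bar R) :
  measurable_fun [set: E] F -> (forall z, 0 <= F z) -> F (0%R : 'rV[R]_N) = 0 ->
  (ln 2)%:E * \int[H]_(z in [set` V]) F z =
  \int[H]_(z in [set` V] `&` shell)
    \int[lam]_(t in `]0%R, +oo[) (F (t *: (z : 'rV[R]_N))%R * (t ^+ n.-1)%:E).
Proof.
move=> mF F0 Fz0; have mV := @measurable_vspace R N V.
have w0 p : (0 <= radial_weight p)%R by rewrite /radial_weight; case: ifP; rewrite ?powR_ge0.
pose G1 (p : E * R) := F p.1 * (radial_weight p)%:E.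
have mG1 : measurable_fun [set: E * R] G1.
  apply: emeasurable_funM; first by apply: measurableT_comp mF _; exact: measurable_fst.
  by apply/measurable_EFinP; exact: measurable_radial_weight.
have G10 p : 0 <= G1 p by rewrite mule_ge0// lee_fin.
pose chi (p : E * R) : R := (\1_(shell `*` `]0%R, +oo[) p)%R.
pose G2 (p : E * R) := F (p.2 *: (p.1 : 'rV[R]_N))%R * (chi p * p.2 ^+ n.-1)%R%:E.
have mch : measurable_fun [set: E * R] chi.
  by apply: measurable_indic; apply: measurableX => //; exact: measurable_shell.
have mG2 : measurable_fun [set: E * R] G2.
  apply: emeasurable_funM; first by apply: measurableT_comp mF _; exact: measurable_scale_pair.
  apply/measurable_EFinP/measurable_funM => //.
  by apply: measurable_funX; exact: measurable_snd.
have chi0 z t : (chi (z, t) * t ^+ n.-1 >= 0)%R.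
  rewrite /chi indicE; case: (boolP (_ \in _)); rewrite ?mul0r// mul1r inE /= in_itv/= andbT.
  by move=> [_ t0]; rewrite exprn_ge0// ltW.
have G20 p : 0 <= G2 p by case: p => z t; rewrite mule_ge0// lee_fin chi0.
have step1 : (ln 2)%:E * \int[H]_(z in [set` V]) F z =
    \int[vspace_measure V0]_z \int[lam]_t G1 (z, t).
  rewrite vspace_integralE -vspace_measure_integralT// -ge0_integralZl//; last first.
    by rewrite lee_fin ln_ge0// ler1n.
  apply: eq_integral => z _; rewrite /G1 /= ge0_integralZl//; last 2 first.
  - by apply/measurable_EFinP; apply: (measurable_fun_pair2 _ measurable_radial_weight).
  - by move=> t _; rewrite lee_fin.
  have [->|z0] := eqVneq (z : 'rV[R]_N) 0%R; first by rewrite Fz0 mule0 mul0e.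
  rewrite muleC; congr (_ * _); rewrite -(integral_inv_half (a := enorm (z : 'rV[R]_N))) ?enorm_gt0//.
  rewrite [LHS]integral_mkcond; apply: eq_integral => t _.
  rewrite patchE /radial_weight /=; have zp : (0 < enorm (z : 'rV[R]_N))%R by rewrite enorm_gt0.
  rewrite mem_setE /= in_itv /= ler_pdivrMr// [(t * 2)%R]mulrC andbC.
  case: (ltP 0%R t) => t0 /=; first by case: ifP => //; rewrite powR_inv1// ltW.
  by case: ifP => // /andP[_ zt]; have := lt_le_trans zp zt; rewrite pmulr_rgt0// ltNge t0.
have step2 t : \int[vspace_measure V0]_z G1 (z, t) = \int[vspace_measure V0]_z G2 (z, t).
  rewrite vspace_measure_integralT//; last exact: (measurable_fun_pair1 _ mG1).
  rewrite vspace_measure_integralT//; last exact: (measurable_fun_pair1 _ mG2).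
  rewrite -!vspace_integralE; have [t0|t0] := ltP 0%R t; last first.
    transitivity (\int[H]_(z in [set` V]) (cst 0 : E -> _) z).
      by apply: eq_integral => z _; rewrite /G1 /radial_weight /= ltNge t0/= mule0.
    apply: eq_integral => z _; rewrite /G2 /chi indicE memNset ?mul0r ?mule0//=.
    by rewrite in_itv /= ltNge t0 => -[].
  pose Phi (z : E) := F (t *: (z : 'rV[R]_N))%R * (\1_shell z * t `^ (-1))%R%:E.
  have mPhi : measurable_fun [set: E] Phi.
    apply: emeasurable_funM; first by apply: measurableT_comp mF _; exact: measurable_scale.
    apply/measurable_EFinP/measurable_funM => //.
    by apply: measurable_indic; exact: measurable_shell.
  have Phi0 z : 0 <= Phi z by rewrite mule_ge0// lee_fin mulr_ge0// powR_ge0.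
  have ti : (0 < t^-1)%R by rewrite invr_gt0.
  transitivity (\int[H]_(z in [set` V]) Phi (t^-1 *: (z : 'rV[R]_N))%R).
    apply: eq_integral => z _; rewrite /G1 /Phi scalerA mulfV ?gt_eqF// scale1r.
    rewrite /radial_weight /= t0 /= indicE in_shell.
    rewrite enormZ (ger0_norm (ltW ti)) ler_pdivlMl// mulr1 ler_pdivrMl// [(t * 2)%R]mulrC.
    by case: ifP; rewrite ?mul1r ?mul0r.
  rewrite hausdorff_integral_scale// invrK -ge0_integralZl//; last 2 first.
  - exact: measurable_funTS.
  - by rewrite lee_fin exprn_ge0// ltW.
  apply: eq_integral => z _; rewrite /Phi /G2 muleCA; congr (_ * _).
  rewrite -EFinM; congr EFin; rewrite mulrCA; congr (_ * _)%R.
    rewrite /chi !indicE; congr ((nat_of_bool _)%:R)%R; apply/idP/idP; rewrite !inE/= in_itv/= t0 andbT.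
      by move=> zs; split.
    by case.
  by rewrite powR_inv1 ?(ltW t0)// -[X in (t ^+ X)%R](prednK V0) exprS mulrC mulKf// gt_eqF.
rewrite step1 (fubini_tonelli (m1 := vspace_measure V0) (m2 := lam))//.
under eq_integral do rewrite step2.
rewrite -(fubini_tonelli (m1 := vspace_measure V0) (m2 := lam) G2)//.
rewrite vspace_measure_integralT; last 2 first.
- exact: (@measurable_fun_fubini_tonelli_F _ _ _ _ _ lam G2 mG2 G20).
- by move=> z; exact: integral_ge0.
rewrite -vspace_integralE integral_mkcondr; apply: eq_integral => z _.
rewrite patchE; case: ifPn => zs.
  rewrite [RHS]integral_mkcond; apply: eq_integral => t _; rewrite patchE /G2 /chi indicE /=.
  case: ifPn => tp; first by rewrite mem_set ?mul1r//; split; [exact: set_mem zs|exact: set_mem tp].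
  by rewrite memNset ?mul0r ?mule0// => -[_ /mem_set]; rewrite (negbTE tp).
rewrite (_ : (fun t => G2 (z, t)) = cst 0) ?integral0//; apply/funext => t /=.
by rewrite /G2 /chi indicE memNset ?mul0r ?mule0// => -[/mem_set]; rewrite (negbTE zs).
Qed.

End polar.

Section pospow.
Context {R : realType}.
Variable s : R.
Hypothesis s01 : 0 < s < 1.
Implicit Types x y t p q : R.

Let s0 : 0 < s. Proof. by case/andP: s01. Qed.
Let s1 : s < 1. Proof. by case/andP: s01. Qed.
Let sle1 : s <= 1. Proof. exact: ltW. Qed.

Lemma powR_subadd x y : 0 <= x -> 0 <= y -> (x + y) `^ s <= x `^ s + y `^ s.
Proof.
move=> x0 y0; have [->|xy0] := eqVneq (x + y) 0.
  by rewrite powR0 ?gt_eqF// addr_ge0// powR_ge0.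
have xy : 0 < x + y by rewrite lt_def xy0 addr_ge0.
have key z : 0 <= z -> z <= x + y -> z / (x + y) * (x + y) `^ s <= z `^ s.
  move=> z0 zxy; have [->|zn0] := eqVneq z 0; first by rewrite !mul0r powR_ge0.
  have zp : 0 < z by rewrite lt_def zn0.
  rewrite -[in leRHS](mulfVK xy0 z) powRM ?(ltW xy) ?divr_ge0 ?(ltW xy)//.
  rewrite ler_wpM2r ?powR_ge0// ger1_powR// divr_gt0//= ler_pdivrMr// mul1r//.
have := lerD (key x x0 _) (key y y0 _); rewrite lerDl lerDr => /(_ y0 x0).
by rewrite -mulrDl -mulrDl divff// mul1r.
Qed.

Definition pospow y := (Num.max 0 y) `^ s.

Lemma pospow_ge0 y : 0 <= pospow y.
Proof. exact: powR_ge0. Qed.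

Lemma pospowE y : 0 <= y -> pospow y = y `^ s.
Proof. by move=> y0; rewrite /pospow max_r. Qed.

Lemma pospow_le0 y : y <= 0 -> pospow y = 0.
Proof. by move=> y0; rewrite /pospow max_l// powR0// gt_eqF. Qed.

Lemma le_pospow x y : x <= y -> pospow x <= pospow y.
Proof.
move=> xy; apply: ge0_ler_powR; first exact: ltW.
- by rewrite nnegrE le_max lexx.
- by rewrite nnegrE le_max lexx.
- by rewrite ge_max !le_max lexx xy orbT.
Qed.

Lemma pospow_distD x y : pospow (x + y) <= pospow x + pospow `|y|.
Proof.
have [x0|/ltW x0] := leP 0 x.
  apply: (@le_trans _ _ (pospow (x + `|y|))); first by rewrite le_pospow// lerD2l ler_norm.
  by rewrite !pospowE ?addr_ge0// powR_subadd.
rewrite (pospow_le0 x0) add0r le_pospow//; have := ler_norm y; lra.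
Qed.

Lemma continuous_pospow : continuous pospow.
Proof.
move=> x; apply: (proj2 (@cvgrPdist_le R R R (nbhs x) _ _ _)) => e e0.
have e1 : 0 < e `^ s^-1 by rewrite powR_gt0.
have h : \forall y \near x, `|x - y| <= e `^ s^-1.
  by apply: (@cvgr_dist_le R _ _ (nbhs x) _ id x); [exact: cvg_id|].
near=> y; have : `|x - y| <= e `^ s^-1 by near: y.
move=> /le_pospow; rewrite [leRHS]pospowE ?(ltW e1)// -powRrM mulVf ?gt_eqF// powRr1 ?(ltW e0)//.
move=> xy; rewrite ler_norml.
have := pospow_distD x (y - x); have := pospow_distD y (x - y).
rewrite !subrKC ?addrCA ?subrr ?addr0 [in `|y - x|]distrC => h1 h2.
by apply/andP; split; lra.
Unshelve. all: by end_near. Qed.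

Lemma pospowM x y : 0 <= x -> pospow (x * y) = x `^ s * pospow y.
Proof.
move=> x0; have [y0|/ltW y0] := leP 0 y.
  by rewrite !pospowE ?mulr_ge0// powRM.
by rewrite !pospow_le0 ?mulr0// mulr_ge0_le0.
Qed.

(** Bernoulli. *)
Lemma powR_le_bernoulli x : 0 <= x -> x `^ s <= 1 + s * (x - 1).
Proof.
move=> x0; have t0 : 0 < 1 - s by rewrite subr_gt0.
have := @conjugate_powR R (x `^ s) 1 (s^-1) ((1 - s)^-1) (powR_ge0 _ _) ler01.
rewrite !invr_gt0 !invrK => /(_ s0 t0); rewrite addrC subrK => /(_ erefl).
rewrite mulr1 powR1 -powRrM mulfV ?gt_eqF// powRr1// mul1r.
by move=> /le_trans; apply; rewrite le_eqVlt; apply/orP; left; apply/eqP; ring.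
Qed.

(** A quadratic minorant of the power function, tangent at 1. *)
Lemma pospow_ge_quadratic x : 1 + s * (x - 1) - (x - 1) ^+ 2 <= pospow x.
Proof.
have [x0|x0] := ltP 0 x; last first.
  rewrite pospow_le0//; have : x * (s + 2) <= 0 by rewrite mulr_le0_ge0// addr_ge0// ltW.
  by have := sqr_ge0 x; have := s0; rewrite !expr2; lra.
rewrite pospowE ?(ltW x0)//.
have := powR_le_bernoulli (x := x^-1); rewrite invr_ge0 (ltW x0) => /(_ isT).
have xs0 : 0 < x `^ s by rewrite powR_gt0.
have -> : x^-1 `^ s = (x `^ s)^-1 by rewrite -powR_inv1 ?(ltW x0)// powRAC powR_inv1 ?ltW.
set X := x `^ s in xs0 *.
have D0 : 0 < s + (1 - s) * x by rewrite ltr_pwDl// mulr_ge0 ?subr_ge0// ltW.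
move=> h; have xX : x <= (s + (1 - s) * x) * X.
  have : X^-1 * (X * x) <= (1 + s * (x^-1 - 1)) * (X * x) by rewrite ler_wpM2r// mulr_ge0// ltW.
  rewrite mulKf ?gt_eqF// => /le_trans; apply.
  by rewrite le_eqVlt; apply/orP; left; apply/eqP; field; rewrite gt_eqF.
rewrite -(ler_pM2l D0); apply: le_trans xX.
rewrite -subr_ge0.
have -> : x - (s + (1 - s) * x) * (1 + s * (x - 1) - (x - 1) ^+ 2) =
  (x - 1) ^+ 2 * (s ^+ 2 + (1 - s) * x) by ring.
by rewrite mulr_ge0 ?sqr_ge0// addr_ge0 ?sqr_ge0// mulr_ge0 ?subr_ge0// ltW.
Qed.

End pospow.

Section line_integral.
Context {R : realType}.
Variable s : R.
Hypothesis s01 : 0 < s < 1.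
Implicit Types x y t p q v a b : R.
Local Notation lam := (@lebesgue_measure R).

Let s0 : 0 < s. Proof. by case/andP: s01. Qed.
Let s1 : s < 1. Proof. by case/andP: s01. Qed.

Definition radial_kernel p q t := pospow s ((p + t) * (q - t)) * t `^ (- (1 + 2 * s)).

Lemma powR_inversion y : 0 < y ->
  (y ^+ 2)^-1 `^ s * (y^-1 `^ (- (1 + 2 * s)) * y ^- 2) = y^-1.
Proof.
move=> y0; have e1 : y^-1 = y `^ (-1) by rewrite powR_inv1// ltW.
have e2 : y ^- 2 = y `^ (- 2) by rewrite powRN -powR_mulrn// ltW.
rewrite e2 e1 -!powRrM -!powRD ?(gt_eqF y0) ?implybT//.
by congr (_ `^ _); ring.
Qed.

Lemma is_derive_inv_shift a v : 0 < v + a ->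
  is_derive v 1 (fun x => (x + a)^-1) (- (v + a) ^- 2).
Proof.
move=> va; have h : is_derive v 1 (fun x => x + a) 1.
  rewrite -[X in is_derive _ _ _ X]addr0.
  exact: (is_deriveD (is_derive_id v 1) (is_derive_cst a v 1)).
apply: (is_derive_eq (@is_deriveV R _ v 1 1 (lt0r_neq0 va) h)).
by rewrite /GRing.scale /= mulr1.
Qed.

Lemma derive1_inv_shift a v : 0 < v + a ->
  derive1 (fun x => (x + a)^-1) v = - (v + a) ^- 2.
Proof.
by move=> va; rewrite derive1E; case: (is_derive_inv_shift va).
Qed.

Lemma continuous_inv_shift a v n : 0 < v + a ->
  {for v, continuous (fun x : R => (x + a) ^- n)}.
Proof.
move=> va; apply: (@continuous_comp R R R (fun x => x + a) (fun x => x ^- n)).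
  by apply: (@cvgD R R R (nbhs v)); [exact: cvg_id|exact: cvg_cst].
apply: (@continuous_comp R R R (fun x => x ^+ n) (@GRing.inv R)).
  exact: exprn_continuous.
by apply: inv_continuous; rewrite expf_neq0// gt_eqF.
Qed.

Lemma continuous_radial_kernel p q t : 0 < t -> {for t, continuous (radial_kernel p q)}.
Proof.
move=> t0; apply: (@cvgM R R (nbhs t)); last exact: continuous_powR_pos.
apply: (@continuous_comp R R R (fun t => (p + t) * (q - t)) (pospow s)); last exact: continuous_pospow.
apply: (@cvgM R R (nbhs t)).
  by apply: (@cvgD R R R (nbhs t)); [exact: cvg_cst|exact: cvg_id].
by apply: (@cvgB R R R (nbhs t)); [exact: cvg_cst|exact: cvg_id].
Qed.

(** The inversion t = 1 / (v + 1/q) sends both ends of the segment to fixed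
    places: the boundary point q to 0 and the singularity to infinity. *)
Lemma integral_radial_kernel p q t : 0 < p -> 0 < q -> 0 < t -> t <= q ->
  (\int[lam]_(x in `[t, q]) (radial_kernel p q x)%:E =
   \int[lam]_(v in `[0%R, (t^-1 - q^-1)%R])
     ((p * q) `^ s * ((v * (v + p^-1 + q^-1)) `^ s / (v + q^-1)))%:E)%E.
Proof.
move=> p0 q0 t0 tq; set a := q^-1; set b := p^-1.
have a0 : 0 < a by rewrite invr_gt0.
have B0 : 0 <= t^-1 - a by rewrite subr_ge0 lef_pV2.
pose F v := (v + a)^-1.
have -> : `[t, q] = `[F (t^-1 - a), F 0].
  by rewrite /F subrK !add0r !invrK.
have dF v : -a < v -> derive1 F v = - (v + a) ^- 2.
  by move=> va; apply: derive1_inv_shift; rewrite -ltrBlDr sub0r.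
have ndF v : -a < v -> \forall x \near v, - (x + a) ^- 2 = derive1 F x.
  by move=> va; near=> x; rewrite dF//; near: x; exact: lt_nbhsr.
have cdF v : -a < v -> {for v, continuous (derive1 F)}.
  move=> va; change (derive1 F x @[x --> v] --> derive1 F v); rewrite dF//.
  apply: cvg_trans.
    by apply: near_eq_cvg; exact: ndF.
  by apply: (@cvgN R R); apply: (@continuous_inv_shift a v 2); rewrite -ltrBlDr sub0r.
have cF v : -a < v -> {for v, continuous F}.
  move=> va; have := @continuous_inv_shift a v 1; rewrite -ltrBlDr sub0r => /(_ va).
  exact.
have na0 : -a < 0 by rewrite oppr_lt0.
have naB : -a < t^-1 - a by rewrite ltrBrDr addNr invr_gt0.
rewrite (@integration_by_substitution_decreasing _ F)//.
- apply: eq_integral => v; rewrite inE /= in_itv /= => /andP[v0 vB]; congr EFin.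
  have va : 0 < v + a by rewrite ltr_wpDl.
  have nav : - a < v by rewrite -ltrBlDr sub0r in va.
  change (radial_kernel p q (F v) * - derive1 F v =
    (p * q) `^ s * ((v * (v + b + a)) `^ s / (v + a))).
  rewrite dF// /radial_kernel opprK.
  have -> : (p + F v) * (q - F v) = (p * q) * ((v * (v + b + a)) / (v + a) ^+ 2).
    rewrite /F -[p in LHS]invrK -[q in LHS]invrK -[p in RHS]invrK -[q in RHS]invrK -/a -/b.
    have b0 : b != 0 by rewrite gt_eqF// invr_gt0.
    have -> : v * (v + b + a) = (v + a - a) * (v + a + b) by ring.
    by move: (v + a) va => y y0; field; rewrite b0 !gt_eqF.
  have P0 : 0 <= v * (v + b + a) by rewrite mulr_ge0// !addr_ge0// ?invr_ge0 ltW.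
  have PV0 : 0 <= v * (v + b + a) / (v + a) ^+ 2 by rewrite divr_ge0// sqr_ge0.
  have pq0 := mulr_ge0 (ltW p0) (ltW q0).
  rewrite pospowE; last exact: mulr_ge0.
  rewrite powRM// (powRM _ P0) ?invr_ge0 ?sqr_ge0// -!mulrA; congr (_ * (_ * _)).
  exact: powR_inversion.
- move=> x y; rewrite !in_itv /= => /andP[x0 _] /andP[y0 _] xy.
  have xa := ltr_wpDl x0 a0; have ya := ltr_wpDl y0 a0.
  by rewrite /F ltf_pV2 ?posrE// ltrD2r.
- by move=> v; rewrite in_itv /= => /andP[v0 _]; apply: cdF; exact: lt_trans v0.
- by apply/cvg_ex; exists (derive1 F 0); apply: cvg_at_right_filter; exact: cdF.
- by apply/cvg_ex; exists (derive1 F (t^-1 - a)); apply: cvg_at_left_filter; exact: cdF.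
- split.
  + move=> v; rewrite in_itv /= => /andP[v0 _].
    by case: (@is_derive_inv_shift a v) => //; exact: addr_gt0.
  + by apply: cvg_at_right_filter; exact: cF.
  + by apply: cvg_at_left_filter; exact: cF.
- apply: continuous_in_subspaceT => x; rewrite inE /= in_itv /= => /andP[tx _].
  apply: continuous_radial_kernel; apply: lt_le_trans tx.
  by rewrite /F subrK invrK.
Unshelve. all: by end_near. Qed.


End line_integral.

Section line_integral_bound.
Context {R : realType}.
Variable s : R.
Hypothesis s01 : 0 < s < 1.
Implicit Types x y t p q v a b : R.
Local Notation lam := (@lebesgue_measure R).

Let s0 : 0 < s. Proof. by case/andP: s01. Qed.
Let s1 : s < 1. Proof. by case/andP: s01. Qed.

Definition kappa : R := 3 / 2 / s + (1 - s)^-1 + 1.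

Let Q a b v := (v + a) * (v + b).

Let is_derive_Q a b v : is_derive v 1 (Q a b) (2 * v + a + b).
Proof.
have h c : is_derive v 1 (fun x => x + c) 1.
  rewrite -[X in is_derive _ _ _ X]addr0.
  exact: (is_deriveD (is_derive_id v 1) (is_derive_cst c v 1)).
apply: (is_derive_eq (is_deriveM (h a) (h b))).
by rewrite /GRing.scale /=; ring.
Qed.

Let is_derive_Qpow a b e v : 0 < Q a b v ->
  is_derive v 1 (fun x => Q a b x `^ e) (e * Q a b v `^ (e - 1) * (2 * v + a + b)).
Proof.
move=> Q0; exact: (@is_derive1_comp R (fun y => y `^ e) (Q a b) v _ _
  (is_derive1_powR e Q0) (is_derive_Q a b v)).
Qed.

Let continuous_Q a b : continuous (Q a b).
Proof.
move=> v; apply: differentiable_continuous; apply/derivable1_diffP.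
by case: (is_derive_Q a b v).
Qed.

Let f a b v := pospow s (v * (v + b + a)) * (v + a)^-1.

Let continuous_f a b v : 0 < v + a -> {for v, continuous (f a b)}.
Proof.
move=> va; apply: (@cvgM R R (nbhs v)); last exact: (@continuous_inv_shift R a v 1).
apply: (@continuous_comp R R R (fun v => v * (v + b + a)) (pospow s)); last exact: continuous_pospow.
have -> : (fun v => v * (v + b + a)) = Q 0 (b + a).
  by apply/funext => x; rewrite /Q addr0 addrA.
exact: continuous_Q.
Qed.

Let within_f a b c d : 0 < c + a -> {within `[c, d], continuous (f a b)}.
Proof.
move=> ca; apply: continuous_in_subspaceT => x; rewrite inE /= in_itv /= => /andP[cx _].
by apply: continuous_f; apply: lt_le_trans ca _; rewrite lerD2r.
Qed.

Let measurable_f a b c d : 0 < c + a -> measurable_fun `[c, d] (f a b).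
Proof.
by move=> ca; apply: subspace_continuous_measurable_fun => //; exact: within_f.
Qed.

Let f_ge0 a b v : 0 < v + a -> 0 <= f a b v.
Proof. by move=> va; rewrite mulr_ge0 ?pospow_ge0// invr_ge0 ltW. Qed.

Let fC a b v : f a b v = pospow s (v * (v + a + b)) * (v + a)^-1.
Proof. by rewrite /f -!addrA [b + a]addrC. Qed.

(** The two inversions turn both halves of the line into the same polynomial P,
    and the weights add up to an exact derivative: 1/(v+a) + 1/(v+b) = P'/(P+ab). *)
Let sum_f_ge a b v : 0 < a -> 0 < b -> 0 <= v ->
  Q a b v `^ (s - 2) * (v * (v + b + a) * (2 * v + a + b)) <= f a b v + f b a v.
Proof.
move=> a0 b0 v0; have va := ltr_wpDl v0 a0; have vb := ltr_wpDl v0 b0.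
have Q0 : 0 < Q a b v by rewrite mulr_gt0.
rewrite (fC b a v) /f -mulrDr.
set P := v * (v + b + a).
have P0 : 0 <= P by rewrite mulr_ge0// !addr_ge0// ltW.
have PQ : P <= Q a b v by have := mulr_ge0 (ltW a0) (ltW b0); rewrite /P /Q; lra.
have -> : (v + a)^-1 + (v + b)^-1 = (2 * v + a + b) / Q a b v.
  by rewrite /Q; field; rewrite !gt_eqF.
rewrite pospowE// mulrA [leRHS]mulrA [leRHS]mulrAC ler_wpM2r//.
  by rewrite !addr_ge0 ?mulr_ge0// ltW.
have e1 : P = P `^ s * P `^ (1 - s).
  by rewrite -powRD ?subrKC ?powRr1 ?oner_eq0.
have e2 : (Q a b v)^-1 = Q a b v `^ (1 - s) * Q a b v `^ (s - 2).
  rewrite -powRD ?(gt_eqF Q0) ?implybT// -powR_inv1 ?(ltW Q0)//.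
  by congr (_ `^ _); ring.
rewrite mulrC [X in X * _ <= _]e1 -mulrA ler_wpM2l ?powR_ge0// e2.
by rewrite ler_wpM2r ?powR_ge0// ge0_ler_powR ?nnegrE ?subr_ge0// ltW.
Qed.

Let integral_sum_f_ge a b L : 0 < a -> 0 < b -> 0 <= L ->
  ((Q a b L `^ s / s - (a * b) `^ s * (s^-1 + (1 - s)^-1))%:E <=
   \int[lam]_(v in `[0%R, L]) (f a b v)%:E + \int[lam]_(v in `[0%R, L]) (f b a v)%:E)%E.
Proof.
move=> a0 b0 L0.
have m1 := @measurable_f a b 0 L; have m2 := @measurable_f b a 0 L.
rewrite !add0r in m1 m2.
rewrite -ge0_integralD//; last 4 first.
- by move=> v; rewrite /= in_itv /= => /andP[v0 _]; rewrite lee_fin f_ge0// ltr_wpDl.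
- by apply/measurable_EFinP; exact: m1.
- by move=> v; rewrite /= in_itv /= => /andP[v0 _]; rewrite lee_fin f_ge0// ltr_wpDl.
- by apply/measurable_EFinP; exact: m2.
have Qp v : 0 <= v -> 0 < Q a b v.
  by move=> v0; rewrite mulr_gt0// ltr_wpDl.
pose h v := Q a b v `^ (s - 2) * (v * (v + b + a) * (2 * v + a + b)).
pose Hf v := s^-1 * Q a b v `^ s + a * b / (1 - s) * Q a b v `^ (s - 1).
have dH v : 0 <= v <= L -> is_derive v 1 Hf (h v).
  move=> /andP[v0 _]; have Q0 := Qp _ v0.
  have d1 := is_deriveZ s^-1 (is_derive_Qpow s Q0).
  have d2 := is_deriveZ (a * b / (1 - s)) (is_derive_Qpow (s - 1) Q0).
  apply: (is_derive_eq (is_deriveD d1 d2)).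
  rewrite /GRing.scale /= /h.
  have -> : s - 1 - 1 = s - 2 by ring.
  have <- : Q a b v * Q a b v `^ (s - 2) = Q a b v `^ (s - 1).
    rewrite -[X in X * _](powRr1 (ltW Q0)) -powRD ?(gt_eqF Q0) ?implybT//.
    by congr (_ `^ _); ring.
  by rewrite /Q; field; rewrite ?gt_eqF ?subr_gt0.
have ch v : 0 <= v -> {for v, continuous h}.
  move=> v0; have Q0 := Qp _ v0; apply: (@cvgM R R (nbhs v)).
    apply: (@continuous_comp R R R (Q a b) (fun y => y `^ (s - 2))); first exact: continuous_Q.
    exact: continuous_powR_pos.
  apply: (@cvgM R R (nbhs v)).
    by have := @continuous_Q 0 (b + a) v; rewrite /Q; under eq_fun do rewrite addr0 addrA.
  apply: (@cvgD R R R (nbhs v)); last exact: cvg_cst.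
  apply: (@cvgD R R R (nbhs v)); last exact: cvg_cst.
  by apply: (@cvgM R R (nbhs v)); [exact: cvg_cst|exact: cvg_id].
apply: (@le_trans _ _ (\int[lam]_(v in `[0%R, L]) (h v)%:E)%E).
  rewrite (@FTC2_is_derive R h Hf)//; last by move=> v /andP[v0 _]; exact: ch.
  rewrite lee_fin.
  have ab0 : 0 < a * b by rewrite mulr_gt0.
  have -> : Hf 0 = (a * b) `^ s * (s^-1 + (1 - s)^-1).
    rewrite /Hf (_ : Q a b 0 = a * b); last by rewrite /Q !add0r.
    rewrite mulrDr [s^-1 * _]mulrC; congr (_ + _).
    rewrite mulrAC mulrC -[X in _ * (X * _)](powRr1 (ltW ab0)).
    rewrite -powRD ?(gt_eqF ab0) ?implybT// mulrC subrKC//.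
  rewrite lerD2r /Hf mulrC lerDl mulr_ge0 ?powR_ge0// divr_ge0 ?subr_ge0 ?(ltW s1)//.
  exact: ltW.
apply: ge0_le_integral => //.
- move=> v; rewrite /= in_itv /= => /andP[v0 _].
  by rewrite lee_fin mulr_ge0 ?powR_ge0// !mulr_ge0// !addr_ge0 ?mulr_ge0// ltW.
- apply/measurable_EFinP; apply: subspace_continuous_measurable_fun => //.
  by apply: continuous_in_subspaceT => x; rewrite inE /= in_itv /= => /andP[x0 _]; exact: ch.
- by apply: emeasurable_funD; apply/measurable_EFinP; [exact: m1|exact: m2].
- move=> v; rewrite /= in_itv /= => /andP[v0 _]; rewrite lee_fin; exact: sum_f_ge.
Qed.

Let integral_f_tail a b L M : 0 < a -> a <= b -> b <= L -> L <= M ->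
  ((((M + a) `^ (2 * s) - (L + a) `^ (2 * s)) / (2 * s) -
    (a * b) `^ s * ln ((M + a) / (L + a)))%:E <=
   \int[lam]_(v in `[L, M]) (f a b v)%:E)%E.
Proof.
move=> a0 ab bL LM; have b0 := lt_le_trans a0 ab; have L0 := lt_le_trans b0 bL.
have La := addr_gt0 L0 a0; have ab0 := mulr_gt0 a0 b0.
have M0 : 0 < M + a by apply: lt_le_trans La _; rewrite lerD2r.
pose k v := (v + a) `^ (2 * s - 1) - (a * b) `^ s * (v + a)^-1.
pose K v := (2 * s)^-1 * (v + a) `^ (2 * s) - (a * b) `^ s * ln (v + a).
have sh v : is_derive v 1 (fun x => x + a) 1.
  rewrite -[X in is_derive _ _ _ X]addr0.
  exact: (is_deriveD (is_derive_id v 1) (is_derive_cst a v 1)).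
have va v : L <= v -> 0 < v + a by move=> Lv; apply: lt_le_trans La _; rewrite lerD2r.
have dK v : L <= v <= M -> is_derive v 1 K (k v).
  move=> /andP[/va v0 _].
  have d1 := is_deriveZ (2 * s)^-1 (@is_derive1_comp R (fun y => y `^ (2 * s)) _ v _ _
    (is_derive1_powR (2 * s) v0) (sh v)).
  have d2 := is_deriveZ ((a * b) `^ s) (@is_derive1_comp R (@ln R) _ v _ _
    (is_derive1_ln v0) (sh v)).
  apply: (is_derive_eq (is_deriveB d1 d2)).
  by rewrite /GRing.scale /= !mulr1 mulKf// mulf_neq0// gt_eqF.
have ck v : L <= v -> {for v, continuous k}.
  move=> /va v0; apply: (@cvgB R R R (nbhs v)).
    apply: (@continuous_comp R R R (fun x => x + a) (fun y => y `^ (2 * s - 1))).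
      by apply: (@cvgD R R R (nbhs v)); [exact: cvg_id|exact: cvg_cst].
    exact: continuous_powR_pos.
  apply: (@cvgM R R (nbhs v)); first exact: cvg_cst.
  exact: (@continuous_inv_shift R a v 1).
have kE v : L <= v -> k v = ((v + a) `^ (2 * s) - (a * b) `^ s) * (v + a)^-1.
  move=> /va v0; rewrite /k powRB ?(gt_eqF v0) ?implybT// powRr1 ?(ltW v0)//.
  by rewrite mulrBl.
have sq v : L <= v -> (v + a) `^ (2 * s) = ((v + a) ^+ 2) `^ s.
  by move=> /va v0; rewrite powRrM powR_mulrn// ltW.
have -> : ((M + a) `^ (2 * s) - (L + a) `^ (2 * s)) / (2 * s) -
    (a * b) `^ s * ln ((M + a) / (L + a)) = K M - K L.
  by rewrite /K ln_div ?posrE//; ring.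
rewrite -(@FTC2_is_derive R k K)//; last by move=> v /andP[Lv _]; exact: ck.
apply: ge0_le_integral => //.
- move=> v; rewrite /= in_itv /= => /andP[Lv _]; rewrite lee_fin kE// mulr_ge0//; last first.
    by rewrite invr_ge0 ltW// va.
  rewrite subr_ge0 sq// ge0_ler_powR ?nnegrE ?sqr_ge0 ?(ltW ab0) ?(ltW s0)//.
  by have := le_trans bL Lv; nra.
- apply/measurable_EFinP; apply: subspace_continuous_measurable_fun => //.
  by apply: continuous_in_subspaceT => x; rewrite inE /= in_itv /= => /andP[x0 _]; exact: ck.
- by apply/measurable_EFinP; exact: measurable_f.
- move=> v; rewrite /= in_itv /= => /andP[Lv _]; rewrite lee_fin kE// /f.
  have v0 := va _ Lv; rewrite ler_wpM2r ?invr_ge0 ?(ltW v0)// lerBlDr sq//.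
  have vv : 0 <= v by apply: le_trans Lv; exact: ltW.
  have P0 : 0 <= v * (v + b + a) by rewrite mulr_ge0// !addr_ge0// ltW.
  rewrite pospowE//; apply: le_trans (powR_subadd s01 P0 (ltW ab0)).
  apply: ge0_ler_powR; rewrite ?nnegrE ?sqr_ge0 ?addr_ge0 ?(ltW ab0) ?(ltW s0)//.
  have := mulr_ge0 vv (_ : 0 <= b - a); rewrite subr_ge0 => /(_ ab).
  by have := mulr_ge0 (ltW a0) (_ : 0 <= b - a); rewrite subr_ge0 => /(_ ab); nra.
Qed.


Lemma kappa_ge0 : 0 <= kappa.
Proof.
by rewrite !addr_ge0// ?invr_ge0 ?subr_ge0 ?(ltW s1)// divr_ge0// ltW.
Qed.

Let integral_kernelE p q t : 0 < p -> 0 < q -> 0 < t -> t <= q ->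
  (\int[lam]_(x in `[t, q]) (radial_kernel s p q x)%:E =
   ((p * q) `^ s)%:E * \int[lam]_(v in `[0%R, (t^-1 - q^-1)%R]) (f q^-1 p^-1 v)%:E)%E.
Proof.
move=> p0 q0 t0 tq; rewrite integral_radial_kernel//.
have qi : 0 < q^-1 by rewrite invr_gt0.
rewrite -ge0_integralZl; last 4 first.
- exact: measurable_itv.
- by apply/measurable_EFinP; apply: measurable_f; rewrite add0r.
- by move=> v; rewrite /= in_itv /= => /andP[v0 _]; rewrite lee_fin f_ge0// ltr_wpDl.
- by rewrite lee_fin powR_ge0.
apply: eq_integral => v; rewrite inE /= in_itv /= => /andP[v0 _].
rewrite -EFinM /f pospowE// mulr_ge0// !addr_ge0// ?invr_ge0 ltW//.
Qed.

(** The s-power of the distance to the ends of a segment has a bounded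
    one-dimensional fractional Laplacian, uniformly in the segment and in the
    point: the large negative contribution near the point is compensated. *)
Lemma line_integral_ge p q t : 0 < p -> p <= q -> 0 < t -> t <= p / 2 ->
  t `^ (2 - 2 * s) <= p ^+ 2 * (p * q) `^ (- s) ->
  (((p * q) `^ s * t `^ (- (2 * s)) / s - kappa)%:E <=
   \int[lam]_(x in `[t, p]) (radial_kernel s q p x)%:E +
   \int[lam]_(x in `[t, q]) (radial_kernel s p q x)%:E)%E.
Proof.
move=> p0 pq t0 tp2 tsmall; have q0 := lt_le_trans p0 pq.
have tp : t <= p by apply: le_trans tp2 _; lra.
have tq := le_trans tp pq.
rewrite !integral_kernelE// [q * p]mulrC.
set a := q^-1; set b := p^-1; set Y := t^-1.
have a0 : 0 < a by rewrite invr_gt0.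
have b0 : 0 < b by rewrite invr_gt0.
have Y0 : 0 < Y by rewrite invr_gt0.
have ab : a <= b by rewrite lef_pV2.
have Yb : 2 * b <= Y by rewrite -[2]invrK -invfM lef_pV2 ?posrE ?mulr_gt0// mulrC.
have bL : b <= Y - b by lra.
have LM : Y - b <= Y - a by lra.
have L0 : 0 <= Y - b by lra.
have PQ0 : 0 < (p * q) `^ s by rewrite powR_gt0// mulr_gt0.
rewrite -muleDr//; last first.
  by apply: ge0_adde_def; rewrite inE; apply: integral_ge0 => v;
    rewrite /= in_itv /= => /andP[v0 _]; rewrite lee_fin f_ge0// ltr_wpDl.
have split_le : (\int[lam]_(v in `[0%R, (Y - b)%R]) (f a b v)%:E +
    \int[lam]_(v in `[(Y - b)%R, (Y - a)%R]) (f a b v)%:E <=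
    \int[lam]_(v in `[0%R, (Y - a)%R]) (f a b v)%:E)%E.
  have mf : measurable_fun `[0, Y - a] (f a b) by apply: measurable_f; rewrite add0r.
  have e : `[0, Y - a]%classic = `[0, Y - b] `|` `](Y - b), (Y - a)] :> set R.
    by rewrite -itv_bndbnd_setU ?bnd_simp.
  rewrite e ge0_integral_setU//.
  - rewrite leeD2l// integral_itv_obnd_cbnd//; apply/measurable_EFinP.
    apply: measurable_funS mf => // x; rewrite /= !in_itv /= => /andP[x1 ->].
    by rewrite andbT (le_trans L0)// ltW.
  - by rewrite -e; apply/measurable_EFinP.
  - by rewrite -e => v; rewrite /= in_itv /= => /andP[v0 _]; rewrite lee_fin f_ge0// ltr_wpDl.
  - apply/disj_setPS => x [] /=; rewrite !in_itv /= => /andP[_ x1] /andP[x2 _].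
    by have := le_lt_trans x1 x2; rewrite ltxx.
have h1 := integral_sum_f_ge a0 b0 L0.
have h2 := integral_f_tail a0 ab bL LM.
have h : ((Y `^ s * Y `^ s / s - kappa * (a * b) `^ s)%:E <=
  \int[lam]_(v in `[0%R, (Y - b)%R]) (f b a v)%:E +
  \int[lam]_(v in `[0%R, (Y - a)%R]) (f a b v)%:E)%E.
  apply: (@le_trans _ _ (\int[lam]_(v in `[0%R, (Y - b)%R]) (f b a v)%:E +
   (\int[lam]_(v in `[0%R, (Y - b)%R]) (f a b v)%:E +
    \int[lam]_(v in `[(Y - b)%R, (Y - a)%R]) (f a b v)%:E))%E); last exact: leeD2l.
  rewrite addeA [X in (_ <= X + _)%E]addeC.
  apply: le_trans (leeD h1 h2); rewrite -EFinD lee_fin.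
  rewrite /Q !subrK.
  have X0 : 0 < Y - b + a by lra.
  set D := (a * b) `^ s; have D0 : 0 <= D by exact: powR_ge0.
  rewrite powRM ?(ltW X0) ?(ltW Y0)//.
  have -> : Y `^ (2 * s) = Y `^ s * Y `^ s.
    by rewrite -powRD ?(gt_eqF Y0) ?implybT//; congr (_ `^ _); ring.
  have -> : (Y - b + a) `^ (2 * s) = (Y - b + a) `^ s * (Y - b + a) `^ s.
    by rewrite -powRD ?(gt_eqF X0) ?implybT//; congr (_ `^ _); ring.
  have ln1 : ln (Y / (Y - b + a)) <= 1.
    have r0 : 0 < Y / (Y - b + a) by rewrite divr_gt0.
    have -> : Y / (Y - b + a) = 1 + (b - a) / (Y - b + a).
      by field; rewrite gt_eqF.
    apply: le_trans (le_ln1Dx _) _.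
      by apply: lt_le_trans (_ : 0 <= _) ; rewrite ?ltrN10// divr_ge0 ?subr_ge0// ltW.
    by rewrite ler_pdivrMr// mul1r; lra.
  have diff1 : Y `^ s - (Y - b + a) `^ s <= b * Y `^ (s - 1).
    have r1 : 0 < (Y - b + a) / Y <= 1.
      by rewrite divr_gt0//= ler_pdivrMr// mul1r; lra.
    have Yi0 : 0 <= Y^-1 by rewrite invr_ge0 ltW.
    have := ger1_powR r1 (ltW s1); rewrite (powRM _ (ltW X0) Yi0).
    have -> : Y^-1 `^ s = (Y `^ s)^-1 by rewrite -powRN -(powR_inv1 (ltW Y0)) -powRrM mulN1r.
    have Ys0 : 0 < Y `^ s by rewrite powR_gt0.
    rewrite ler_pdivlMr// powRB ?(gt_eqF Y0) ?implybT// powRr1 ?(ltW Y0)// => hh.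
    have -> : b * (Y `^ s / Y) = Y `^ s - (Y - b) / Y * Y `^ s.
      by field; rewrite gt_eqF.
    rewrite lerD2l lerN2; apply: le_trans hh.
    apply: ler_wpM2r; first exact: ltW.
    apply: ler_wpM2r; first by rewrite invr_ge0 ltW.
    by rewrite lerDl ltW.
  have diff0 : 0 <= Y `^ s - (Y - b + a) `^ s.
    by rewrite subr_ge0 ge0_ler_powR ?nnegrE ?(ltW s0) ?(ltW X0) ?(ltW Y0)//; lra.
  have diff2 : (Y `^ s - (Y - b + a) `^ s) ^+ 2 <= D.
    apply: (@le_trans _ _ ((b * Y `^ (s - 1)) ^+ 2)).
      have bY0 : 0 <= b * Y `^ (s - 1) by rewrite mulr_ge0 ?powR_ge0// ltW.
      by apply: lerXn2r; rewrite ?nnegrE; [exact: diff0|exact: bY0|exact: diff1].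
    have -> : D = (p * q) `^ (- s).
      rewrite /D /a /b -invfM [q * p]mulrC -powR_inv1; last exact: mulr_ge0 (ltW p0) (ltW q0).
      by rewrite -powRrM mulN1r.
    rewrite exprMn /b exprVn ler_pdivrMl ?exprn_gt0//; apply: le_trans tsmall.
    rewrite -powR_mulrn ?powR_ge0// -powRrM /Y -powR_inv1 ?(ltW t0)// -powRrM.
    by rewrite le_eqVlt; apply/orP; left; apply/eqP; congr (_ `^ _); ring.
  have Dln : D * ln (Y / (Y - b + a)) <= D by rewrite ler_piMr.
  move: diff2 Dln; set X := (Y - b + a) `^ s; set Z := Y `^ s; set l := ln _ => diff2 Dln.
  rewrite /kappa -subr_ge0.
  have -> : X * Z / s - D * (s^-1 + (1 - s)^-1) + ((Z * Z - X * X) / (2 * s) - D * l) -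
    (Z * Z / s - (3 / 2 / s + (1 - s)^-1 + 1) * D) =
    (D - (Z - X) ^+ 2) / (2 * s) + (D - D * l).
    by field; rewrite !gt_eqF// subr_gt0.
  by rewrite addr_ge0 ?subr_ge0// divr_ge0 ?subr_ge0// mulr_ge0// ltW.
apply: (@le_trans _ _ (((p * q) `^ s)%:E * (Y `^ s * Y `^ s / s - kappa * (a * b) `^ s)%:E)%E); last first.
  by rewrite lee_wpmul2l// lee_fin powR_ge0.
rewrite -EFinM lee_fin mulrBr.
have -> : (p * q) `^ s * (kappa * (a * b) `^ s) = kappa.
  rewrite mulrCA -powRM ?mulr_ge0 ?(ltW p0) ?(ltW q0) ?(ltW a0) ?(ltW b0)//.
  rewrite (_ : p * q * (a * b) = 1) ?powR1 ?mulr1//.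
  by rewrite /a /b; field; rewrite !gt_eqF.
have -> : t `^ (- (2 * s)) = Y `^ s * Y `^ s.
  rewrite /Y -powR_inv1 ?(ltW t0)// -powRrM -powRD ?(gt_eqF t0) ?implybT//.
  by congr (_ `^ _); ring.
by rewrite !mulrA.
Qed.

End line_integral_bound.

Section radial_comparison.
Context {R : realType} {N : nat}.
Local Notation E := (borel_rV R N).
Local Notation lam := (@lebesgue_measure R).
Variable s : R.
Hypothesis s01 : 0 < s < 1.
Implicit Types (V : {vspace 'rV[R]_N}) (n : nat) (phi : E -> R).

Let s0 : 0 < s. Proof. by case/andP: s01. Qed.
Let s1 : s < 1. Proof. by case/andP: s01. Qed.

Definition frac_kernel n (z : 'rV[R]_N) : R := (enorm z `^ (n%:R + 2 * s))^-1.

Let expo_gt0 n : 0 < n%:R + 2 * s.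
Proof. by rewrite ltr_wpDl// mulr_gt0. Qed.

Lemma frac_kernel_ge0 n z : 0 <= frac_kernel n z.
Proof. by rewrite invr_ge0 powR_ge0. Qed.

Lemma frac_kernel0 n : frac_kernel n 0 = 0.
Proof. by rewrite /frac_kernel enorm0 powR0 ?invr0// gt_eqF. Qed.

Lemma frac_kernelN n z : frac_kernel n (- z) = frac_kernel n z.
Proof. by rewrite /frac_kernel enormN. Qed.

Lemma measurable_frac_kernel n :
  measurable_fun [set: E] (frac_kernel n : E -> R).
Proof.
have -> : frac_kernel n = (fun x : R => x `^ (- (n%:R + 2 * s))) \o enorm.
  by apply/funext => z; rewrite /frac_kernel /= powRN.
by apply: (measurableT_comp (measurable_powR _)); exact: measurable_enorm.
Qed.

Lemma frac_kernel_le n z a : 0 < a -> a <= enorm z ->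
  frac_kernel n z <= (a `^ (n%:R + 2 * s))^-1.
Proof.
move=> a0 az; rewrite lef_pV2 ?posrE ?powR_gt0 ?(lt_le_trans a0)//.
by rewrite ge0_ler_powR ?nnegrE ?enorm_ge0// ltW.
Qed.

Lemma frac_kernel_scale n z t : (0 < n)%N -> 0 < t ->
  frac_kernel n (t *: z) * t ^+ n.-1 = frac_kernel n z * t `^ (- (1 + 2 * s)).
Proof.
move=> n0 t0; rewrite /frac_kernel enormZ (ger0_norm (ltW t0)).
rewrite powRM ?enorm_ge0 ?(ltW t0)// invfM mulrAC mulrC; congr (_ * _).
rewrite -powR_mulrn ?(ltW t0)// -powRN -powRD ?(gt_eqF t0) ?implybT//.
have -> : n%:R = n.-1%:R + 1 :> R by rewrite natr1 prednK.
by congr (_ `^ _); ring.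
Qed.

(** The mass of the part of a shell lying on a subspace, up to the factor
    produced by the averaging over dilations. *)
Definition shell_bound n : R := (unit_ball_volume n * (2 * n%:R) ^+ n) / ln 2.

Let ln2_gt0 : 0 < ln 2 :> R. Proof. by rewrite ln_gt0// ltr1n. Qed.

Lemma shell_bound_ge0 n : 0 <= shell_bound n.
Proof.
by rewrite divr_ge0 ?(ltW ln2_gt0)// mulr_ge0 ?(ltW (unit_ball_volume_gt0 _)).
Qed.

Local Open Scope ereal_scope.

Lemma hausdorff_shell_le V n : (0 < n)%N -> \dim V = n ->
  hausdorff n ([set` V] `&` shell) <= (ln 2 * shell_bound n)%:E.
Proof.
move=> n0 dV; have t0 : (0 < 2 :> R)%R by [].
apply: (@le_trans _ _ (hausdorff n ((fun x => 2 *: x)%R @` ([set` V] `&` ceball 0%R 1%R)))).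
  apply: le_hausdorff => z [/= zV /andP[_ z2]].
  exists (2^-1 *: z)%R; last by rewrite scalerA mulfV ?gt_eqF// scale1r.
  split; first exact: memvZ.
  have h0 : (0 <= 2^-1 :> R)%R by [].
  by rewrite /ceball /= subr0 enormZ (ger0_norm h0) ler_pdivrMl// mulr1.
rewrite hausdorffZ// /shell_bound mulrC divfK ?gt_eqF//.
rewrite exprMn mulrCA EFinM lee_wpmul2l ?lee_fin ?exprn_ge0//.
exact: hausdorff_unit_ball_le.
Qed.

Definition radial_integral phi (z : 'rV[R]_N) : \bar R :=
  \int[lam]_(t in `]0%R, +oo[) (phi (t *: z) * t `^ (- (1 + 2 * s)))%R%:E.

Lemma measurable_radial_integral phi : measurable_fun [set: E] phi ->
  (forall z, (0 <= phi z)%R) ->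
  measurable_fun [set: E] (radial_integral phi).
Proof.
move=> mphi phi0.
pose G (p : E * R) : \bar R :=
  ((\1_(`]0%R, +oo[ : set R) p.2 : R) * (phi (p.2 *: (p.1 : 'rV[R]_N)) * p.2 `^ (- (1 + 2 * s))))%R%:E.
have mG : measurable_fun [set: E * R] G.
  apply/measurable_EFinP/measurable_funM.
    apply: (measurableT_comp (f := (\1_(`]0%R, +oo[ : set R) : R -> R)) _ measurable_snd).
    exact: measurable_indic.
  apply: measurable_funM; first exact: measurableT_comp mphi measurable_scale_pair.
  exact: measurableT_comp (measurable_powR _) measurable_snd.
have G0 p : 0 <= G p by rewrite lee_fin !mulr_ge0// powR_ge0.
have := @measurable_fun_fubini_tonelli_F _ _ _ _ _ lam G mG G0.
apply: eq_measurable_fun => z _; rewrite /fubini_F /radial_integral [RHS]integral_mkcond.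
apply: eq_integral => t _; rewrite patchE /G /= indicE.
by case: ifP; rewrite ?mul1r ?mul0r.
Qed.

Lemma radial_integral_ge0 phi z : (forall z, (0 <= phi z)%R) -> 0 <= radial_integral phi z.
Proof.
by move=> phi0; apply: integral_ge0 => t _; rewrite lee_fin mulr_ge0// powR_ge0.
Qed.

Lemma polar_frac_kernel V n phi : (0 < n)%N -> \dim V = n ->
  measurable_fun [set: E] phi -> (forall z, (0 <= phi z)%R) ->
  (ln 2)%:E * \int[hausdorff n : set E -> \bar R]_(z in [set` V]) (phi z * frac_kernel n z)%:E =
  \int[hausdorff n : set E -> \bar R]_(z in [set` V] `&` shell)
    ((frac_kernel n z)%:E * radial_integral phi z).
Proof.
move=> n0 dV mphi phi0; have V0 : (0 < \dim V)%N by rewrite dV.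
have mk := @measurable_frac_kernel n.
have := @polar_coordinates R N V V0 (fun z => (phi z * frac_kernel n z)%:E).
rewrite dV => ->; last 3 first.
- by apply/measurable_EFinP/measurable_funM.
- by move=> z; rewrite lee_fin mulr_ge0// frac_kernel_ge0.
- by rewrite frac_kernel0 mulr0.
apply: eq_integral => z _.
rewrite /radial_integral -ge0_integralZl//; last 3 first.
- apply/measurable_EFinP/measurable_funM; last exact: measurable_funTS (measurable_powR _).
  apply: measurable_funTS; apply: measurableT_comp mphi _.
  apply: measurable_fun_coord => i; under eq_fun do rewrite mxE.
  exact: measurable_funM.
- by move=> t _; rewrite lee_fin mulr_ge0// powR_ge0.
- by rewrite lee_fin frac_kernel_ge0.
apply: eq_integral => t; rewrite inE /= in_itv /= andbT => t0.
by rewrite -!EFinM -mulrA frac_kernel_scale// mulrCA.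
Qed.

(** Comparing two kernel integrals over a subspace reduces to comparing them
    along the lines through the origin. *)
Lemma radial_compare V n phi1 phi2 (m : R) : (0 < n)%N -> \dim V = n ->
  measurable_fun [set: E] phi1 -> (forall z, (0 <= phi1 z)%R) ->
  measurable_fun [set: E] phi2 -> (forall z, (0 <= phi2 z)%R) -> (0 <= m)%R ->
  (forall z, z \in V -> shell z ->
    radial_integral phi2 z <= radial_integral phi1 z + m%:E) ->
  \int[hausdorff n : set E -> \bar R]_(z in [set` V]) (phi2 z * frac_kernel n z)%:E <=
  \int[hausdorff n : set E -> \bar R]_(z in [set` V]) (phi1 z * frac_kernel n z)%:E
    + (m * shell_bound n)%:E.
Proof.
move=> n0 dV mphi1 phi10 mphi2 phi20 m0 le21.
have mVs : measurable (([set` V] : set E) `&` (shell : set E)).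
  by apply: measurableI; [exact: measurable_vspace|exact: measurable_shell].
have mk := @measurable_frac_kernel n.
have l2 : 0 < (ln 2 : R)%:E by rewrite lte_fin.
have mi phi : measurable_fun [set: E] phi -> (forall z, (0 <= phi z)%R) ->
    measurable_fun (([set` V] : set E) `&` (shell : set E)) (fun z : E => (frac_kernel n z)%:E * radial_integral phi z).
  move=> mphi phi0; apply: measurable_funTS; apply: emeasurable_funM; first exact/measurable_EFinP.
  exact: measurable_radial_integral.
have i0 phi z : (forall z, (0 <= phi z)%R) -> 0 <= (frac_kernel n z)%:E * radial_integral phi z.
  by move=> phi0; rewrite mule_ge0 ?lee_fin ?frac_kernel_ge0// radial_integral_ge0.
have I1 : 0 <= \int[hausdorff n : set E -> \bar R]_(z in [set` V]) (phi1 z * frac_kernel n z)%:E.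
  by apply: integral_ge0 => z _; rewrite lee_fin mulr_ge0// frac_kernel_ge0.
have I2 : 0 <= (m * shell_bound n)%:E by rewrite lee_fin mulr_ge0// shell_bound_ge0.
have l2fin : (ln 2 : R)%:E \is a fin_num by [].
rewrite -(lee_pmul2l l2fin l2) (ge0_muleDr _ I1 I2).
rewrite !polar_frac_kernel//.
apply: (@le_trans _ _ (\int[hausdorff n : set E -> \bar R]_(z in [set` V] `&` shell)
    ((frac_kernel n z)%:E * radial_integral phi1 z + m%:E))).
  apply: ge0_le_integral => //.
  - by move=> z _; exact: i0.
  - exact: mi.
  - by apply: emeasurable_funD => //; exact: mi.
  - move=> z [zV zs]; have k1 : (frac_kernel n z <= 1)%R.
      by have /andP[z1 _] := zs; have := frac_kernel_le n ltr01 z1; rewrite powR1 invr1.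
    apply: (@le_trans _ _ ((frac_kernel n z)%:E * (radial_integral phi1 z + m%:E))).
      by rewrite lee_wpmul2l ?lee_fin ?frac_kernel_ge0// le21.
    rewrite ge0_muleDr ?lee_fin// ?radial_integral_ge0// leeD2l// -EFinM lee_fin.
    by rewrite ler_piMl.
rewrite ge0_integralD//; last 2 first.
- by move=> z _; exact: i0.
- exact: mi.
rewrite leeD2l// integral_cst//= muleC.
apply: le_trans (lee_wpmul2r _ (hausdorff_shell_le n0 dV)) _; first by rewrite lee_fin.
by rewrite -!EFinM lee_fin le_eqVlt; apply/orP; left; apply/eqP; ring.
Qed.

End radial_comparison.

Section lines_through_ball.
Context {R : realType} {N : nat}.
Local Notation E := (borel_rV R N).
Local Notation lam := (@lebesgue_measure R).
Variable s : R.
Hypothesis s01 : 0 < s < 1.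
Implicit Types (z c : 'rV[R]_N) (r rho : R).

Let s0 : 0 < s. Proof. by case/andP: s01. Qed.
Let s1 : s < 1. Proof. by case/andP: s01. Qed.

Lemma powR_neg_cvg0 (e : R) : 0 < e -> x `^ (- e) @[x --> +oo] --> (0 : R).
Proof.
move=> e0; apply/cvgrPdist_le => eps eps0; near=> x.
have x0 : eps `^ (- e^-1) <= x by near: x; apply: nbhs_pinfty_ge; exact: num_real.
have y0 : 0 < eps `^ (- e^-1) by rewrite powR_gt0.
rewrite sub0r normrN ger0_norm ?powR_ge0// powRN.
rewrite invf_ple ?posrE ?powR_gt0 ?(lt_le_trans y0 x0)//.
apply: (@le_trans _ _ ((eps `^ (- e^-1)) `^ e)).
  by rewrite -powRrM mulNr mulVf ?gt_eqF// powR_inv1// ltW.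
by rewrite ge0_ler_powR ?nnegrE ?(ltW e0) ?(ltW y0)// (le_trans (ltW y0)).
Unshelve. all: by end_near. Qed.

Lemma integral_powR_tail (t : R) : 0 < t ->
  (\int[lam]_(x in `[t, +oo[) (x `^ (- (1 + 2 * s)))%:E =
   (t `^ (- (2 * s)) / (2 * s))%:E)%E.
Proof.
move=> t0; have e0 : 0 < 2 * s by rewrite mulr_gt0.
pose F (x : R) := - (2 * s)^-1 * x `^ (- (2 * s)).
have dF (x : R) : 0 < x -> is_derive x 1 F (x `^ (- (1 + 2 * s))).
  move=> x0; apply: (is_derive_eq (is_deriveZ (- (2 * s)^-1) (is_derive1_powR (- (2 * s)) x0))).
  rewrite /GRing.scale /= mulrA mulrNN mulVf ?gt_eqF// mul1r.
  by congr (_ `^ _); ring.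
rewrite (@ge0_continuous_FTC2y R _ F t 0).
- by rewrite sub0e /F mulNr -EFinN opprK mulrC.
- by move=> x _; exact: powR_ge0.
- apply: continuous_in_subspaceT => x; rewrite inE /= in_itv /= andbT => tx.
  by apply: continuous_powR_pos; exact: lt_le_trans t0 tx.
- rewrite -(mulr0 (- (2 * s)^-1)); apply: cvgM; first exact: cvg_cst.
  exact: powR_neg_cvg0.
- by move=> x tx; case: (dF x (lt_trans t0 tx)).
- apply: cvg_at_right_filter; apply: differentiable_continuous; apply/derivable1_diffP.
  by case: (dF t t0).
- by move=> x; rewrite in_itv /= andbT => tx; rewrite derive1E; case: (dF x (lt_trans t0 tx)).
Qed.

Definition outside rho : E -> R := \1_(~` (eball 0 rho : set E)).

Lemma measurable_outside rho : measurable_fun [set: E] (outside rho).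
Proof. by apply: measurable_indic; apply: measurableC; exact: measurable_eball. Qed.

Lemma outside_ge0 rho z : 0 <= outside rho z.
Proof. by rewrite /outside indicE. Qed.

Lemma outsideE rho z : outside rho z = (rho <= enorm z)%R%:R.
Proof.
rewrite /outside indicE; congr ((nat_of_bool _)%:R); apply/idP/idP.
  by rewrite inE /eball /= subr0 => /negP; rewrite -leNgt.
by rewrite inE /eball /= subr0 => h; apply/negP; rewrite -leNgt.
Qed.

Lemma radial_integral_outside (phi : E -> R) rho z : 0 < rho -> z != 0 ->
  radial_integral s (fun z => phi z * outside rho z) z =
  (\int[lam]_(t in `[(rho / enorm z)%R, +oo[)
     (phi (t *: z) * t `^ (- (1 + 2 * s)))%:E)%E.
Proof.
move=> rho0 z0; have zp : 0 < enorm z by rewrite enorm_gt0.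
have rz0 : 0 < rho / enorm z by rewrite divr_gt0.
rewrite /radial_integral [LHS]integral_mkcond [RHS]integral_mkcond.
apply: eq_integral => t _; rewrite !patchE !mem_setE /= !in_itv /= !andbT.
rewrite outsideE enormZ ler_pdivrMr//.
case: ltP => t0; first by rewrite (ger0_norm (ltW t0)); case: ifP; rewrite ?mulr1 ?mulr0 ?mul0r.
by case: ifP => // h; have := lt_le_trans rho0 h; rewrite pmulr_lgt0// ltNge t0.
Qed.

Lemma radial_integral_tail (a : R) rho z : 0 <= a -> 0 < rho -> z != 0 ->
  radial_integral s (fun z => a * outside rho z) z =
  (a * ((rho / enorm z) `^ (- (2 * s)) / (2 * s)))%:E.
Proof.
move=> a0 rho0 z0; rewrite (radial_integral_outside (fun=> a))//.
have rz0 : 0 < rho / enorm z by rewrite divr_gt0// enorm_gt0.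
rewrite [RHS]EFinM -integral_powR_tail// -ge0_integralZl//.
- by apply/measurable_EFinP; exact: measurable_funTS (measurable_powR _).
- by move=> t _; rewrite lee_fin powR_ge0.
Qed.

Definition barrier c r (x : 'rV[R]_N) : R := pospow s (r ^+ 2 - dot (x - c) (x - c)).

Lemma barrier_ge0 c r x : 0 <= barrier c r x.
Proof. exact: pospow_ge0. Qed.

Lemma barrier_out c r x : 0 <= r -> r <= enorm (x - c) -> barrier c r x = 0.
Proof.
by move=> r0 rx; apply: pospow_le0 => //; rewrite subr_le0 -sqr_enorm lerXn2r ?nnegrE ?enorm_ge0.
Qed.

Lemma barrier_le c r x : 0 <= r -> barrier c r x <= r `^ (2 * s).
Proof.
move=> r0; apply: (@le_trans _ _ (pospow s (r ^+ 2))).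
  by apply: le_pospow => //; rewrite lerBlDr lerDl dot_ge0.
by rewrite pospowE ?sqr_ge0// powRrM powR_mulrn.
Qed.

Lemma continuous_barrier c r : continuous (barrier c r).
Proof.
have -> : barrier c r = pospow s \o ((fun t : R => r ^+ 2 - t ^+ 2) \o (enorm \o (fun y => y - c))).
  by apply/funext => y; rewrite /barrier /= sqr_enorm.
move=> x; apply: continuous_comp; last exact: continuous_pospow.
apply: continuous_comp.
  by apply: continuous_comp; [exact: continuous_subr|exact: continuous_enorm].
apply: (@cvgB R R R (nbhs _)); first exact: cvg_cst.
exact: exprn_continuous.
Qed.

Lemma sqr_dotD (y z : 'rV[R]_N) t :
  dot (y + t *: z) (y + t *: z) = dot y y + 2 * t * dot y z + t ^+ 2 * dot z z.
Proof. by rewrite !dotE (dotC z y); ring. Qed.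

(** Restricted to a line through a point of the ball, the barrier is a power of
    the product of the distances to the ends of the chord. *)
Lemma barrier_chord c r x z : enorm (x - c) < r -> 1 <= enorm z <= 2 ->
  exists p q, [/\ 0 < p, 0 < q, p <= 2 * r, q <= 2 * r &
   (r ^+ 2 - dot (x - c) (x - c)) / 4 <= p * q /\
   forall t, barrier c r (x + t *: z) =
     (enorm z ^+ 2) `^ s * pospow s ((p + t) * (q - t))].
Proof.
move=> xr /andP[z1 z2]; set y := x - c; set Z := enorm z.
have r0 : 0 < r by apply: le_lt_trans xr; exact: enorm_ge0.
set q0 := r ^+ 2 - dot y y.
have q00 : 0 < q0.
  by rewrite subr_gt0 -sqr_enorm ltrXn2r ?nnegrE ?enorm_ge0// ltW.
have Z0 : 0 < Z by apply: lt_le_trans z1.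
have Z20 : 0 < Z ^+ 2 by rewrite exprn_gt0.
set b := dot y z; pose S := Num.sqrt (b ^+ 2 + q0 * Z ^+ 2).
have D0 : 0 <= b ^+ 2 + q0 * Z ^+ 2 by rewrite addr_ge0 ?sqr_ge0// mulr_ge0// ltW.
have S2 : S ^+ 2 = b ^+ 2 + q0 * Z ^+ 2 by rewrite sqr_sqrtr.
have Sb : `|b| < S.
  rewrite -(@ltr_pXn2r _ 2) ?nnegrE ?sqrtr_ge0// S2 real_normK ?num_real//.
  by rewrite ltrDl mulr_gt0.
have bZ : `|b| <= r * Z.
  apply: le_trans (cauchy_schwarz_abs _ _) _; rewrite ler_wpM2r ?enorm_ge0//.
  exact: ltW.
have SZ : S <= r * Z.
  rewrite -(@ler_pXn2r _ 2) ?nnegrE ?sqrtr_ge0 ?mulr_ge0 ?enorm_ge0 ?(ltW r0)// S2.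
  have : b ^+ 2 <= dot y y * Z ^+ 2.
    by rewrite -sqr_enorm -exprMn -(real_normK (num_real b)) lerXn2r ?nnegrE ?mulr_ge0 ?enorm_ge0// cauchy_schwarz_abs.
  by rewrite /q0; lra.
have bound e : `|e| <= r * Z -> (e + S) / Z ^+ 2 <= 2 * r.
  move=> he; rewrite ler_pdivrMr//; apply: (@le_trans _ _ (2 * r * Z)).
    by have := ler_norm e; lra.
  by rewrite ler_wpM2l ?mulr_ge0 ?(ltW r0)// expr2 ler_peMl// ltW.
have := Sb; rewrite ltr_norml => /andP[Sb1 Sb2].
exists ((b + S) / Z ^+ 2), ((- b + S) / Z ^+ 2); split.
- by rewrite divr_gt0//; lra.
- by rewrite divr_gt0//; lra.
- exact: bound.
- by apply: bound; rewrite normrN.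
have pq : (b + S) / Z ^+ 2 * ((- b + S) / Z ^+ 2) = q0 / Z ^+ 2.
  have -> : q0 = (S ^+ 2 - b ^+ 2) / Z ^+ 2 by rewrite S2; field; rewrite gt_eqF.
  by field; rewrite gt_eqF.
have Z24 : Z ^+ 2 <= 4.
  by rewrite (_ : 4 = 2 ^+ 2); [rewrite lerXn2r ?nnegrE ?(ltW Z0)|rewrite -natrX].
split; first by rewrite pq ler_wpM2l ?(ltW q00)// lef_pV2 ?posrE.
move=> t; rewrite /barrier -pospowM ?sqr_ge0//; congr (pospow _ _).
rewrite addrAC -/y sqr_dotD -/b -(sqr_enorm z) -/Z.
have -> : Z ^+ 2 * (((b + S) / Z ^+ 2 + t) * ((- b + S) / Z ^+ 2 - t)) =
  (S ^+ 2 - b ^+ 2) / Z ^+ 2 - 2 * t * b - t ^+ 2 * Z ^+ 2 by field; rewrite gt_eqF.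
by rewrite S2 /q0; field; rewrite gt_eqF.
Qed.

End lines_through_ball.

Section barrier_on_subspaces.
Context {R : realType} {N : nat}.
Local Notation E := (borel_rV R N).
Local Notation lam := (@lebesgue_measure R).
Variable s : R.
Hypothesis s01 : 0 < s < 1.
Implicit Types (z c : 'rV[R]_N) (r rho : R) (V : {vspace 'rV[R]_N}) (n : nat).

Let s0 : 0 < s. Proof. by case/andP: s01. Qed.
Let s1 : s < 1. Proof. by case/andP: s01. Qed.

Let measurable_kernel (p q t : R) A : 0 < t -> (forall x, A x -> t <= x) -> measurable A ->
  measurable_fun A (radial_kernel s p q).
Proof.
move=> t0 At mA; apply: subspace_continuous_measurable_fun => //.
apply: continuous_in_subspaceT => x; rewrite inE => /At tx.
by apply: continuous_radial_kernel => //; exact: lt_le_trans t0 tx.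
Qed.

Let kernel_ge0 p q t : 0 <= radial_kernel s p q t.
Proof. by rewrite mulr_ge0 ?pospow_ge0 ?powR_ge0. Qed.

Let integral_kernels_ge (p q t : R) : 0 < t ->
  (\int[lam]_(x in `[t, p]) (radial_kernel s q p x)%:E +
   \int[lam]_(x in `[t, q]) (radial_kernel s p q x)%:E <=
   \int[lam]_(x in `[t, +oo[) (radial_kernel s p q x + radial_kernel s q p x)%:E)%E.
Proof.
move=> t0.
have mk a b : measurable_fun `[t, +oo[ (EFin \o radial_kernel s a b).
  apply/measurable_EFinP; apply: (@measurable_kernel a b t _ t0) => // x.
  by rewrite /= in_itv /= andbT.
have sub (a b c : R) : (\int[lam]_(x in `[t, a]) (radial_kernel s b c x)%:E <=
    \int[lam]_(x in `[t, +oo[) (radial_kernel s b c x)%:E)%E.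
  apply: ge0_subset_integral => //.
  - exact: mk.
  - by move=> x _; rewrite lee_fin.
  - by move=> x; rewrite /= !in_itv /= andbT => /andP[].
under [leRHS]eq_integral do rewrite EFinD.
rewrite ge0_integralD; [|exact: measurable_itv|by move=> *; rewrite lee_fin|exact: mk
  |by move=> *; rewrite lee_fin|exact: mk].
by rewrite addeC; exact: (leeD (sub q p q) (sub p q p)).
Qed.


Lemma barrier_line_ge c r (x : 'rV[R]_N) : enorm (x - c) < r ->
  exists2 rho1, 0 < rho1 & forall rho, 0 < rho -> rho <= rho1 ->
  forall z, shell z ->
  (radial_integral s (fun z => (2 * barrier s c r x) * outside rho z)%R z <=
   radial_integral s (fun z => (barrier s c r (x + z) + barrier s c r (x - z)) * outside rho z)%R z
     + (4 * kappa s)%:E)%E.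
Proof.
move=> xr; have r0 : 0 < r by apply: le_lt_trans xr; exact: enorm_ge0.
pose q0 := r ^+ 2 - dot (x - c) (x - c).
have q00 : 0 < q0.
  by rewrite subr_gt0 -sqr_enorm ltrXn2r ?nnegrE ?enorm_ge0// ltW.
pose m := q0 / (8 * r); have m0 : 0 < m by rewrite divr_gt0// mulr_gt0.
pose M := m ^+ 2 * (4 * r ^+ 2) `^ (- s).
have M0 : 0 < M by rewrite mulr_gt0 ?exprn_gt0// powR_gt0// mulr_gt0// exprn_gt0.
have es0 : 0 < 2 - 2 * s by move: s1; lra.
exists (Num.min (m / 2) (M `^ (2 - 2 * s)^-1)).
  by rewrite lt_min divr_gt0//= powR_gt0.
move=> rho rho0; rewrite le_min => /andP[rhom rhoM] z zs.
have [p [q [p0 q0' pr qr [pq0 chord]]]] := barrier_chord s01 xr zs.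
have z1 : 1 <= enorm z by case/andP: zs.
have zp : 0 < enorm z by apply: lt_le_trans z1.
have zn0 : z != 0 by rewrite -enorm_gt0.
pose t := rho / enorm z; have t0 : 0 < t by rewrite divr_gt0.
have trho : t <= rho by rewrite ler_pdivrMr// ler_peMr// ltW.
have mmin (a b : R) : 0 < a -> 0 < b -> q0 / 4 <= a * b -> b <= 2 * r -> m <= a.
  move=> a0 b0 ab br; rewrite ler_pdivrMr ?mulr_gt0//.
  have : a * b <= a * (2 * r) by rewrite ler_wpM2l// ltW.
  by move: ab; lra.
have mp := mmin _ _ p0 q0' pq0 qr.
have mq : m <= q by apply: (mmin _ p) => //; rewrite [q * p]mulrC.
have tpow : t `^ (2 - 2 * s) <= M.
  apply: (@le_trans _ _ (rho `^ (2 - 2 * s))).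
    by rewrite ge0_ler_powR ?nnegrE ?(ltW es0) ?(ltW t0) ?(ltW rho0).
  have ME : M = (M `^ (2 - 2 * s)^-1) `^ (2 - 2 * s).
    by rewrite -powRrM mulVf ?gt_eqF// powRr1// ltW.
  rewrite [leRHS]ME.
  by rewrite ge0_ler_powR ?nnegrE ?(ltW es0) ?(ltW rho0) ?powR_ge0.
have tcond (a b : R) : 0 < a -> 0 < b -> m <= a -> a <= 2 * r -> b <= 2 * r ->
    t `^ (2 - 2 * s) <= a ^+ 2 * (a * b) `^ (- s).
  move=> a0 b0 ma ar br; apply: le_trans tpow _.
  have ab0 : 0 < a * b by rewrite mulr_gt0.
  apply: ler_pM; rewrite ?sqr_ge0 ?powR_ge0//.
    by rewrite lerXn2r ?nnegrE ?(ltW m0) ?(ltW a0).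
  have r40 : 0 < 4 * r ^+ 2 by rewrite mulr_gt0// exprn_gt0.
  rewrite !powRN lef_pV2 ?posrE ?powR_gt0//.
  rewrite ge0_ler_powR ?nnegrE ?(ltW s0) ?(ltW ab0) ?(ltW r40)//.
  have := ler_pM (ltW a0) (ltW b0) ar br; rewrite expr2; lra.
have t2 (a : R) : m <= a -> t <= a / 2 by lra.
have key : (((p * q) `^ s * t `^ (- (2 * s)) / s - kappa s)%:E <=
   \int[lam]_(x in `[t, +oo[) (radial_kernel s p q x + radial_kernel s q p x)%:E)%E.
  have [pq|/ltW qp] := leP p q.
    apply: le_trans (line_integral_ge s01 p0 pq t0 (t2 _ mp) (tcond _ _ p0 q0' mp pr qr)) _.
    exact: integral_kernels_ge.
  rewrite mulrC [p * q]mulrC mulrC.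
  under eq_integral do rewrite addrC.
  apply: le_trans (line_integral_ge s01 q0' qp t0 (t2 _ mq) (tcond _ _ q0' p0 mq qr pr)) _.
  exact: integral_kernels_ge.
set Z := (enorm z ^+ 2) `^ s in chord.
have Z0 : 0 <= Z by exact: powR_ge0.
have Z4 : Z <= 4.
  have z24 : enorm z ^+ 2 <= 4.
    rewrite (_ : 4 = 2 ^+ 2); last by rewrite -natrX.
    by rewrite lerXn2r ?nnegrE ?enorm_ge0//; case/andP: zs.
  apply: (@le_trans _ _ (4 `^ s)).
    by rewrite ge0_ler_powR ?nnegrE ?sqr_ge0 ?(ltW s0).
  by rewrite ler1_powR ?(ltW s1)// ler1n.
have w0 : barrier s c r x = Z * (p * q) `^ s.
  have := chord 0; rewrite scale0r !addr0 subr0 => ->.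
  by rewrite pospowE// mulr_ge0 ?ltW.
rewrite radial_integral_tail//; last by rewrite mulr_ge0 ?barrier_ge0.
rewrite (radial_integral_outside s (fun z => barrier s c r (x + z) + barrier s c r (x - z)))//.
rewrite -/t.
have -> : (\int[lam]_(t0 in `[t, +oo[)
    ((barrier s c r (x + t0 *: z) + barrier s c r (x - t0 *: z)) * t0 `^ (- (1 + 2 * s)))%:E =
    Z%:E * \int[lam]_(x in `[t, +oo[) (radial_kernel s p q x + radial_kernel s q p x)%:E)%E.
  rewrite -ge0_integralZl//.
  - apply: eq_integral => u _; rewrite -scaleNr !chord -EFinM /radial_kernel opprK.
    by rewrite [(p - u) * _]mulrC; congr EFin; ring.
  - apply/measurable_EFinP; apply: measurable_funD;
      [apply: (@measurable_kernel p q t _ t0)|apply: (@measurable_kernel q p t _ t0)] => // u;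
      by rewrite /= in_itv /= andbT.
  - by move=> u _; rewrite lee_fin addr_ge0.
apply: (@le_trans _ _ (Z%:E * ((p * q) `^ s * t `^ (- (2 * s)) / s - kappa s)%:E + (4 * kappa s)%:E)%E).
  rewrite -EFinM -EFinD lee_fin w0 -subr_ge0.
  have -> : Z * ((p * q) `^ s * t `^ (- (2 * s)) / s - kappa s) + 4 * kappa s -
    2 * (Z * (p * q) `^ s) * (t `^ (- (2 * s)) / (2 * s)) = (4 - Z) * kappa s.
    by field; rewrite gt_eqF.
  by rewrite mulr_ge0 ?subr_ge0 ?kappa_ge0.
by rewrite leeD2r// lee_wpmul2l// lee_fin.
Qed.

End barrier_on_subspaces.

Section kernel_integrals.
Context {R : realType} {N : nat}.
Local Notation E := (borel_rV R N).
Variable s : R.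
Hypothesis s01 : 0 < s < 1.
Variables (V : {vspace 'rV[R]_N}) (n : nat).
Hypotheses (n0 : (0 < n)%N) (dV : \dim V = n).
Local Notation H := (hausdorff n : set E -> \bar R).
Local Notation K := (frac_kernel s n).
Implicit Types (z c p : 'rV[R]_N) (r rho eps : R) (g phi : E -> R) (D : set E).

Let s0 : 0 < s. Proof. by case/andP: s01. Qed.
Let s1 : s < 1. Proof. by case/andP: s01. Qed.
Let mK : measurable_fun [set: E] (K : E -> R). Proof. exact: measurable_frac_kernel. Qed.
Let K0 z : 0 <= K z. Proof. exact: frac_kernel_ge0. Qed.
Let mV : measurable ([set` V] : set E). Proof. exact: measurable_vspace. Qed.

Local Open Scope ereal_scope.

Definition vtail rho : set E := [set` V] `\` (eball 0%R rho : set E).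

Lemma measurable_vtail rho : measurable (vtail rho).
Proof. by apply: measurableD => //; exact: measurable_eball. Qed.

Lemma integral_outside phi rho :
  \int[H]_(z in [set` V]) (phi z * outside rho z * K z)%R%:E =
  \int[H]_(z in vtail rho) (phi z * K z)%R%:E.
Proof.
rewrite /vtail setDE integral_mkcondr; apply: eq_integral => z _.
rewrite patchE /outside indicE; case: ifP; rewrite ?mulr1// mulr0 mul0r.
by [].
Qed.

Lemma kernel_tail_lty rho : (0 < rho)%R -> \int[H]_(z in vtail rho) (K z)%:E < +oo.
Proof.
move=> rho0; pose m : R := ((rho / 2) `^ (- (2 * s)) / (2 * s))%R.
have m0 : (0 <= m)%R by rewrite divr_ge0 ?powR_ge0// mulr_ge0// ltW.
have := @radial_compare R N s s01 V n (fun=> 0%R) (fun z => 1 * outside rho z)%R m n0 dV.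
rewrite (_ : (fun z => (1 * outside rho z * K z)%R%:E) = (fun z => ((fun=> 1%R) z * outside rho z * K z)%R%:E))//.
rewrite integral_outside.
under eq_integral do rewrite mul1r.
move=> /(_ _ _ _ _ m0 _)/le_lt_trans; apply => //.
- by apply: measurable_funM => //; exact: measurable_outside.
- by move=> z; rewrite mul1r; exact: outside_ge0.
- move=> z zV /andP[z1 z2]; have zp : (0 < enorm z)%R by apply: lt_le_trans z1.
  rewrite radial_integral_tail//; last by rewrite -enorm_gt0.
  rewrite mul1r (_ : radial_integral _ _ _ = 0) ?add0e ?lee_fin; last first.
    by rewrite /radial_integral; under eq_integral do rewrite mul0r; rewrite integral0.
  rewrite /m ler_pM2r ?invr_gt0 ?mulr_gt0// !powRN lef_pV2 ?posrE ?powR_gt0 ?divr_gt0//.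
  rewrite ge0_ler_powR ?nnegrE ?mulr_ge0 ?invr_ge0 ?enorm_ge0 ?(ltW s0) ?(ltW rho0)//.
  by rewrite ler_pM2l// lef_pV2 ?posrE.
- under eq_integral do rewrite mul0r.
  by rewrite integral0 add0e ltry.
Qed.

Lemma integrable_kernel D eps g (M : R) : (0 < eps)%R -> D `<=` vtail eps ->
  measurable D -> measurable_fun [set: E] g -> (forall z, D z -> (`|g z| <= M)%R) ->
  (H : measure _ _).-integrable D (fun z => (g z * K z)%R%:E).
Proof.
move=> e0 DV mD mg gM; apply/integrableP; split.
  by apply/measurable_EFinP; apply: measurable_funTS; exact: measurable_funM.
have M0 : (forall z, D z -> (0 <= M)%R) by move=> z /gM; apply: le_trans.
apply: (@le_lt_trans _ _ (\int[H]_(z in D) (`|M|%:E * (K z)%:E))).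
  apply: ge0_le_integral => //.
  - by apply/measurable_EFinP; apply: measurableT_comp => //; apply: measurable_funTS; exact: measurable_funM.
  - by apply/measurable_EFinP; apply: measurable_funTS; exact: measurable_funM.
  - move=> z Dz; rewrite /= lee_fin normrM (ger0_norm (K0 z)) ler_wpM2r//.
    exact: le_trans (gM _ Dz) (ler_norm _).
have mKD : measurable_fun D (fun z => (K z)%:E) by apply/measurable_EFinP; exact: measurable_funTS.
rewrite ge0_integralZl//; last by move=> z _; rewrite lee_fin.
have hle : \int[H]_(z in D) (K z)%:E <= \int[H]_(z in vtail eps) (K z)%:E.
  apply: ge0_subset_integral => //; first exact: measurable_vtail.
    by apply/measurable_EFinP; exact: measurable_funTS.
  by move=> z _; rewrite lee_fin.
have hlt := le_lt_trans hle (kernel_tail_lty e0).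
have fin1 : \int[H]_(z in D) (K z)%:E \is a fin_num.
  by rewrite ge0_fin_numE//; apply: integral_ge0 => z _; rewrite lee_fin.
by rewrite -(fineK fin1) -EFinM ltry.
Qed.

(** Odd parts cancel on symmetric sets. *)
Lemma kernel_symmetrize D eps g (M : R) : (0 < eps)%R -> D `<=` vtail eps ->
  measurable D -> (forall z, D z -> D (- z)%R) ->
  measurable_fun [set: E] g -> (forall z, D z -> (`|g z| <= M)%R) ->
  \int[H]_(z in D) (g z * K z)%R%:E + \int[H]_(z in D) (g z * K z)%R%:E =
  \int[H]_(z in D) ((g z + g (- (z : 'rV[R]_N))) * K z)%R%:E.
Proof.
move=> e0 DV mD sD mg gM.
have i1 := integrable_kernel e0 DV mD mg gM.
have mg' : measurable_fun [set: E] (fun z : E => g (- (z : 'rV[R]_N))%R).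
  exact: measurableT_comp mg measurable_opp_rV.
have i2 : (H : measure _ _).-integrable D (fun z => (g (- (z : 'rV[R]_N)) * K z)%R%:E).
  by apply: (integrable_kernel (M := M) e0 DV mD mg') => z /sD; exact: gM.
have mgK : measurable_fun [set: E] (fun z => (g z * K z)%R%:E).
  by apply/measurable_EFinP; exact: measurable_funM.
rewrite -[X in _ + X](hausdorff_integral_opp n mD sD mgK).
under [X in _ + X]eq_integral do rewrite frac_kernelN.
rewrite -integralD//; apply: eq_integral => z _.
by rewrite mulrDl EFinD.
Qed.

End kernel_integrals.

Section subspace_estimates.
Context {R : realType} {N : nat}.
Local Notation E := (borel_rV R N).
Local Notation lam := (@lebesgue_measure R).
Variable s : R.
Hypothesis s01 : 0 < s < 1.
Implicit Types (z c p : 'rV[R]_N) (r rho eps : R) (V : {vspace 'rV[R]_N}) (n : nat).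

Let s0 : 0 < s. Proof. by case/andP: s01. Qed.
Let s1 : s < 1. Proof. by case/andP: s01. Qed.

Local Open Scope ereal_scope.

Definition ball_bound n : R := (n.+1%:R^-1 ^+ n * (unit_ball_volume n / 2 ^+ n))%R.

Lemma ball_bound_gt0 n : (0 < ball_bound n)%R.
Proof.
by rewrite mulr_gt0 ?exprn_gt0 ?invr_gt0// divr_gt0 ?exprn_gt0// unit_ball_volume_gt0.
Qed.

Lemma hausdorff_ball_ge V n (v : 'rV[R]_N) (eta : R) : (0 < n)%N -> \dim V = n ->
  v \in V -> (0 < eta)%R ->
  (eta ^+ n * ball_bound n)%:E <= hausdorff n ([set` V] `&` eball v eta).
Proof.
move=> n0 dV vV eta0; have [e oe] := @orthonormal_exists R N V n (eq_leq (esym dV)).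
pose t : R := (eta / n.+1%:R)%R; have t0 : (0 < t)%R by rewrite divr_gt0.
apply: (@le_trans _ _ (hausdorff n ((fun x => x + v)%R @` ((fun x => t *: x)%R @` unit_cube V n e)))).
  rewrite (@hausdorff_isometry _ _ n _ (fun x => x + v)%R (fun x => x - v)%R); last 2 first.
  - by move=> x y; rewrite opprD addrACA subrr addr0.
  - by move=> x; rewrite addrK.
  rewrite hausdorffZ// mulrA -exprMn EFinM lee_wpmul2l ?lee_fin ?exprn_ge0 ?(ltW t0)//.
  exact: hausdorff_cube_ge.
apply: le_hausdorff => _ [_ [z [zV ze] <-] <-]; split.
  by rewrite /= memvD// memvZ.
rewrite /eball /= addrK enormZ (ger0_norm (ltW t0)) /t -mulrA gtr_pMr//.
rewrite ltr_pdivrMl// mulr1; apply: (@le_lt_trans _ _ n%:R); last by rewrite ltr_nat.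
rewrite enorm_le// -sqr_enorm {1}(onprojE dV oe zV) (sqr_enorm_onsum (fun i => dot z (e i)) oe).
apply: (@le_trans _ _ (\sum_(i < n) 1)%R).
  by apply: ler_sum => i _; have /andP[z0 z1] := ze i (ltn_ord i); rewrite expr_le1.
rewrite sumr_const card_ord -natrX ler_nat.
by case: (n) => // k; rewrite expnS expn1 leq_pmull.
Qed.

Let aux (a b c k : R) : (b <= a + 4 * k -> c + c = a - b -> - (2 * k) <= c)%R.
Proof. by move=> h1 h2; lra. Qed.

(** The oscillation of the barrier contributes at least a constant, whatever
    the point of the ball, the subspace and the (small) inner radius. *)
Lemma barrier_kernel_ge c r (x : 'rV[R]_N) : (enorm (x - c) < r)%R ->
  exists2 rho1, (0 < rho1)%R & forall rho, (0 < rho)%R -> (rho <= rho1)%R ->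
  forall V n, (0 < n)%N -> \dim V = n ->
  (- (2 * kappa s * shell_bound n))%:E <=
  \int[hausdorff n : set E -> \bar R]_(z in vtail V rho)
    ((barrier s c r (x + z) - barrier s c r x) * frac_kernel s n z)%R%:E.
Proof.
move=> xr; have [rho1 rho10 line] := barrier_line_ge s01 xr.
exists rho1 => // rho rho0 rhole V n n0 dV.
have r0 : (0 <= r)%R by apply: le_trans (ltW xr); exact: enorm_ge0.
set b := barrier s c r; have b0 y : (0 <= b y)%R by exact: barrier_ge0.
have mb : measurable_fun [set: E] (b : E -> R).
  by apply: continuous_measurable_rV; exact: continuous_barrier.
have mbD : measurable_fun [set: E] (fun z : E => b (x + (z : 'rV[R]_N))%R).
  by apply: (measurableT_comp mb); exact: measurable_shift.
have mopp : measurable_fun [set: E] (fun y : E => (x - (y : 'rV[R]_N))%R : E).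
  exact: (measurableT_comp (measurable_shift x) measurable_opp_rV).
have mbB : measurable_fun [set: E] (fun z : E => b (x - (z : 'rV[R]_N))%R).
  exact: (measurableT_comp mb mopp).
have bM y : (b y <= r `^ (2 * s))%R by exact: barrier_le.
have mD := @measurable_vtail R N V rho.
have := @radial_compare R N s s01 V n
  (fun z => (b (x + z) + b (x - z)) * outside rho z)%R
  (fun z => (2 * b x) * outside rho z)%R (4 * kappa s) n0 dV.
rewrite (integral_outside s V n (fun=> 2 * b x)%R) (integral_outside s V n (fun z => b (x + z) + b (x - z))%R).
set I1 := \int[_]_(z in _) (_ * _)%R%:E; set I2 := \int[_]_(z in _) _.
move=> key0; have {key0}key : I1 <= I2 + (4 * kappa s * shell_bound n)%:E.
  apply: key0.
  - by apply: measurable_funM; [exact: (measurable_funD mbD mbB)|exact: measurable_outside].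
  - by move=> z; rewrite mulr_ge0 ?outside_ge0// addr_ge0.
  - by apply: measurable_funM => //; exact: measurable_outside.
  - by move=> z; rewrite !mulr_ge0 ?outside_ge0.
  - by rewrite mulr_ge0// kappa_ge0.
  - by move=> z _; exact: line.
have i1 : (hausdorff n : {measure set E -> \bar R}).-integrable (vtail V rho)
    (fun z => ((b (x + z) + b (x - z)) * frac_kernel s n z)%R%:E).
  apply: (@integrable_kernel R N s s01 V n n0 dV _ rho _ (2 * r `^ (2 * s))%R) => //.
  - exact: (measurable_funD mbD mbB).
  - by move=> z _; rewrite ger0_norm ?addr_ge0// mulr_natl mulr2n lerD.
have i2 : (hausdorff n : {measure set E -> \bar R}).-integrable (vtail V rho)
    (fun z => ((fun=> 2 * b x)%R z * frac_kernel s n z)%R%:E).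
  by apply: (@integrable_kernel R N s s01 V n n0 dV _ rho _ `|2 * b x|%R).
have mg : measurable_fun [set: E] (fun z : E => b (x + (z : 'rV[R]_N)) - b x)%R.
  exact: (measurable_funB mbD (measurable_cst _)).
have gM z : (`|b (x + z) - b x| <= r `^ (2 * s))%R.
  have := bM (x + z)%R; have := bM x; have := b0 (x + z)%R; have := b0 x.
  move: (b (x + z)%R) (b x) (r `^ (2 * s))%R => B1 B2 M ????.
  by rewrite ler_norml; apply/andP; split; lra.
have ig := @integrable_kernel R N s s01 V n n0 dV (vtail V rho) rho _ _ rho0
  (@subset_refl _ _) mD mg (fun z _ => gM z).
have sD z : vtail V rho z -> vtail V rho (- z)%R.
  move=> [/= zV zr]; split; first by rewrite /= memvN.
  by move: zr; rewrite /eball /= !subr0 enormN.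
have sym := @kernel_symmetrize R N s s01 V n n0 dV (vtail V rho) rho _ _ rho0
  (@subset_refl _ _) mD sD mg (fun z _ => gM z).
have fing := integrable_fin_num mD ig.
set I := \int[_]_(z in _) _ in sym fing *.
have sym2 : I + I = I2 - I1.
  rewrite sym /I1 /I2 -integralB//; apply: eq_integral => z _ /=.
  by rewrite -EFinD; congr EFin; ring.
have := integrable_fin_num mD i1; rewrite -/I2 => /fineK fin2.
have := integrable_fin_num mD i2; rewrite -/I1 => /fineK fin1.
move: key sym2; clearbody I I1 I2; rewrite -(fineK fing) -fin1 -fin2 -!EFinD !lee_fin -!mulrA.
by move=> h1 h2; exact: (aux h1 (EFin_inj h2)).
Qed.

End subspace_estimates.

Section operator_estimates.
Context {R : realType} {N : nat}.
Local Notation E := (borel_rV R N).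
Local Notation lam := (@lebesgue_measure R).
Variable s : R.
Hypothesis s01 : 0 < s < 1.
Variables (V : {vspace 'rV[R]_N}) (n : nat).
Hypotheses (n0 : (0 < n)%N) (dV : \dim V = n).
Local Notation H := (hausdorff n : set E -> \bar R).
Local Notation K := (frac_kernel s n).
Implicit Types (z c p v x : 'rV[R]_N) (r rho eps : R).

Let s0 : 0 < s. Proof. by case/andP: s01. Qed.
Let s1 : s < 1. Proof. by case/andP: s01. Qed.
Let mK : measurable_fun [set: E] (K : E -> R). Proof. exact: measurable_frac_kernel. Qed.
Let K0 z : 0 <= K z. Proof. exact: frac_kernel_ge0. Qed.
Let mV : measurable ([set` V] : set E). Proof. exact: measurable_vspace. Qed.

Let aux (a b q : R) : a + a = (- q - q) * b -> a = - q * b.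
Proof. by move=> h; lra. Qed.

Local Open Scope ereal_scope.

(** Lower bound for the far part: the increments of u dominate those of a
    multiple of the barrier everywhere, with a gain of a on a ball. *)
Lemma outer_integral_ge (u w : 'rV[R]_N -> R) x (A a M rho eta B L : R) v :
  measurable_fun [set: E] (u : E -> R) -> (forall y, (`|u y| <= M)%R) ->
  measurable_fun [set: E] (w : E -> R) -> (forall y, (`|w y| <= M)%R) ->
  (0 < rho)%R -> (0 <= A)%R -> (0 <= a)%R -> (0 < eta)%R -> (0 < B)%R ->
  v \in V -> (eta + rho <= enorm v)%R -> (enorm v + eta <= B)%R ->
  (forall z, (A * (w (x + z) - w x) <= u (x + z) - u x)%R) ->
  (forall z, (enorm (z - v) < eta -> A * (w (x + z) - w x) + a <= u (x + z) - u x)%R) ->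
  (- L)%:E <= \int[H]_(z in vtail V rho) ((w (x + z) - w x) * K z)%R%:E ->
  (- (A * L) + a * ((B `^ (n%:R + 2 * s))^-1 * (eta ^+ n * ball_bound n)))%:E <=
  \int[H]_(z in vtail V rho) ((u (x + z) - u x) * K z)%R%:E.
Proof.
move=> mu uM mw wM rho0 A0 a0 eta0 B0 vV vl vB uw uwa wL.
have mD := @measurable_vtail R N V rho.
pose F : set E := [set` V] `&` (eball v eta : set E).
have mF : measurable F by apply: measurableI => //; exact: measurable_eball.
have FD : F `<=` vtail V rho.
  move=> z [zV]; rewrite /eball /= => zv; split=> //; rewrite /eball /= subr0.
  apply/negP; rewrite -leNgt; have := ler_enormB v z 0%R; rewrite !subr0 enormBC; lra.
have mshift (f : 'rV[R]_N -> R) : measurable_fun [set: E] (f : E -> R) ->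
    measurable_fun [set: E] (fun z : E => f (x + (z : 'rV[R]_N)) - f x)%R.
  move=> mf; apply: measurable_funB => //.
  by apply: (measurableT_comp mf); exact: measurable_shift.
have bshift (f : 'rV[R]_N -> R) z : (forall y, (`|f y| <= M)%R) -> (`|f (x + z) - f x| <= 2 * M)%R.
  by move=> fM; have := fM (x + z)%R; have := fM x; rewrite !ler_norml => /andP[??] /andP[??];
    apply/andP; split; lra.
have iu := integrable_kernel s01 n0 dV rho0 (@subset_refl _ _) mD (mshift _ mu)
  (fun z _ => bshift u z uM).
have iw := integrable_kernel s01 n0 dV rho0 (@subset_refl _ _) mD (mshift _ mw)
  (fun z _ => bshift w z wM).
have m1 : measurable_fun [set: E] (\1_F : E -> R) by exact: measurable_indic.
have i1 : (H : {measure set E -> \bar R}).-integrable (vtail V rho) (fun z => (\1_F z * K z)%R%:E).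
  apply: (integrable_kernel (M := 1%R) s01 n0 dV rho0 (@subset_refl _ _) mD m1) => z _.
  by rewrite indicE; case: (_ \in _); rewrite ?normr1 ?normr0.
have iAw := integrableZl mD A iw; have ia1 := integrableZl mD a i1.
have iS := integrableD mD iAw ia1.
have fin1 := integrable_fin_num mD i1; have finw := integrable_fin_num mD iw.
apply: (@le_trans _ _ (\int[H]_(z in vtail V rho)
   (A%:E * ((w (x + z) - w x) * K z)%R%:E + a%:E * (\1_F z * K z)%R%:E))); last first.
  apply: (@le_integral _ _ _ _ _ mD _ _ iS iu) => z; rewrite inE => -[zV _].
  rewrite -!EFinM -EFinD lee_fin !mulrA -mulrDl ler_wpM2r// indicE.
  case: (boolP (z \in F)) => [/set_mem[_ zF]|_]; first by rewrite mulr1; exact: uwa.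
  by rewrite mulr0 addr0; exact: uw.
rewrite integralD// !integralZl//.
rewrite EFinD; apply: leeD.
  by rewrite -mulrN EFinM lee_wpmul2l// lee_fin.
rewrite EFinM lee_wpmul2l ?lee_fin//.
have kB : (0 <= (B `^ (n%:R + 2 * s))^-1)%R by rewrite invr_ge0 powR_ge0.
apply: (@le_trans _ _ (\int[H]_(z in F) (cst (B `^ (n%:R + 2 * s))^-1%:E : E -> _) z)).
  rewrite integral_cst// EFinM lee_wpmul2l ?lee_fin//; exact: hausdorff_ball_ge.
apply: (@le_trans _ _ (\int[H]_(z in F) (\1_F z * K z)%R%:E)).
  apply: ge0_le_integral => //.
  - by apply/measurable_EFinP; apply: measurable_funTS; exact: measurable_funM.
  - move=> z Fz; rewrite indicE (mem_set Fz) mul1r lee_fin.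
    case: Fz => zV; rewrite /eball /= => zv.
    have z0 : (0 < enorm z)%R.
      have := ler_enormB v z 0%R; rewrite !subr0 enormBC; lra.
    have zB : (enorm z <= B)%R.
      have := ler_enormB z v 0%R; rewrite !subr0; lra.
    rewrite lef_pV2 ?posrE ?powR_gt0// ge0_ler_powR ?nnegrE ?(ltW z0) ?(ltW B0)//.
    by rewrite addr_ge0// mulr_ge0// ltW.
apply: ge0_subset_integral => //.
- by apply/measurable_EFinP; apply: measurable_funTS; exact: measurable_funM.
- by move=> z _; rewrite lee_fin mulr_ge0// indicE.
Qed.

Let near_set rho eps : set E := ([set` V] `&` (eball 0%R rho : set E)) `\` (eball 0%R eps : set E).

Let near_sub rho eps : near_set rho eps `<=` vtail V eps.
Proof. by move=> z [[zV _] ze]. Qed.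

Let measurable_near rho eps : measurable (near_set rho eps).
Proof.
apply: measurableD; last exact: measurable_eball.
by apply: measurableI => //; exact: measurable_eball.
Qed.

Let measurable_sqr : measurable_fun [set: E] (fun z : E => dot (z : 'rV[R]_N) z).
Proof.
under eq_fun do rewrite -sqr_enorm.
by apply: measurable_funX; exact: measurable_enorm.
Qed.

Lemma near_integral_le rho eps : (0 < eps)%R -> (eps <= rho)%R ->
  \int[H]_(z in near_set rho eps) (dot z z * K z)%R%:E <=
  (4 * rho `^ (2 - 2 * s) / (2 - 2 * s) * shell_bound n)%:E.
Proof.
move=> e0 er; have rho0 := lt_le_trans e0 er.
have es0 : (0 < 2 - 2 * s)%R by move: s1; lra.
have mI : measurable_fun [set: E] (\1_(eball 0%R rho) : E -> R).
  by apply: measurable_indic; exact: measurable_eball.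
have := @radial_compare R N s s01 V n (fun=> 0%R)
  (fun z => (dot z z * \1_(eball 0%R rho) z) * outside eps z)%R
  (4 * rho `^ (2 - 2 * s) / (2 - 2 * s)) n0 dV.
rewrite (integral_outside s V n (fun z => dot z z * \1_(eball 0%R rho) z)%R).
have -> : \int[H]_(z in vtail V eps) (dot z z * \1_(eball 0%R rho) z * K z)%R%:E =
   \int[H]_(z in near_set rho eps) (dot z z * K z)%R%:E.
  rewrite /near_set (_ : _ `\` _ = vtail V eps `&` (eball 0%R rho : set E)); last first.
    by rewrite /vtail !setDE -!setIA; congr (_ `&` _); rewrite setIC.
  rewrite [RHS]integral_mkcondr; congr (integral _ _ _); apply/funext => z.
  by rewrite patchE indicE; case: ifP; rewrite ?mulr1// mulr0 mul0r.
have -> : \int[H]_(z in [set` V]) (0 * K z)%R%:E = 0.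
  by under eq_integral do rewrite mul0r; rewrite integral0.
rewrite add0e => key; apply: key => //.
- by apply: measurable_funM; [exact: measurable_funM|exact: measurable_outside].
- by move=> z; rewrite !mulr_ge0 ?dot_ge0 ?outside_ge0// indicE.
- by rewrite divr_ge0 ?mulr_ge0 ?powR_ge0// ltW.
move=> z zV /andP[z1 z2]; have zp : (0 < enorm z)%R by apply: lt_le_trans z1.
rewrite [X in _ <= X + _](_ : _ = 0) ?add0e; last first.
  by rewrite /radial_integral; under eq_integral do rewrite mul0r; rewrite integral0.
rewrite (radial_integral_outside s (fun z => dot z z * \1_(eball 0%R rho) z)%R)//; last by rewrite -enorm_gt0.
set Z := enorm z in z1 z2 zp *.
have ez : (0 < eps / Z)%R by rewrite divr_gt0.
have erz : (eps / Z <= rho / Z)%R by rewrite ler_pM2r ?invr_gt0.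
have -> : \int[lam]_(t in `[(eps / Z)%R, +oo[)
    (dot (t *: z) (t *: z) * \1_(eball 0%R rho) (t *: z) * t `^ (- (1 + 2 * s)))%R%:E =
    \int[lam]_(t in `[(eps / Z)%R, (rho / Z)%R]) ((Z ^+ 2)%:E * (t `^ (1 - 2 * s))%:E).
  rewrite -integral_itv_bndo_bndc; last first.
    apply: measurable_funTS; apply/measurable_EFinP; apply: measurable_funM => //.
  have -> : `[(eps / Z)%R, (rho / Z)%R[%classic = `[(eps / Z)%R, +oo[ `&` [set t : R | (t < rho / Z)%R].
    apply/seteqP; split=> t /=; rewrite !in_itv /= ?andbT; first by move/andP.
    by move=> [-> ->].
  rewrite integral_mkcondr; apply: eq_integral => t; rewrite inE /= in_itv /= andbT => te.
  have t0 := lt_le_trans ez te.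
  have tE : (t \in [set t : R | (t < rho / Z)%R]) = ((t *: z)%R \in (eball 0%R rho : set 'rV[R]_N)).
    apply/idP/idP; rewrite !inE /eball /= subr0 enormZ (ger0_norm (ltW t0)) ltr_pdivlMr//.
  rewrite patchE indicE tE; case: ifP; rewrite ?mulr0 ?mul0r// mulr1 => _.
  rewrite -EFinM -sqr_enorm enormZ (ger0_norm (ltW t0)) exprMn mulrAC mulrC; congr (_ * _)%:E.
  by rewrite -powR_mulrn ?(ltW t0)// -powRD ?(gt_eqF t0) ?implybT//; congr (_ `^ _)%R; ring.
have mt : measurable_fun `[(eps / Z)%R, (rho / Z)%R] (fun t : R => (t `^ (1 - 2 * s))%:E).
  by apply/measurable_EFinP; exact: measurable_funTS (measurable_powR _).
rewrite ge0_integralZl; last 4 first.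
- exact: measurable_itv.
- exact: mt.
- by move=> t _; rewrite lee_fin powR_ge0.
- by rewrite lee_fin sqr_ge0.
rewrite integral_powR//; last by move: s1; lra.
have -> : (1 - 2 * s + 1 = 2 - 2 * s)%R by ring.
rewrite -EFinM lee_fin mulrA ler_pM2r ?invr_gt0//.
have Z4 : (Z ^+ 2 <= 4)%R.
  by rewrite (_ : 4%R = (2 ^+ 2)%R); [rewrite lerXn2r ?nnegrE ?(ltW zp)|rewrite -natrX].
apply: ler_pM; rewrite ?sqr_ge0//.
  rewrite subr_ge0 ge0_ler_powR ?nnegrE ?(ltW es0) ?(ltW ez)//.
  exact: le_trans (ltW ez) erz.
apply: (@le_trans _ _ ((rho / Z) `^ (2 - 2 * s))%R); first by rewrite gerBl powR_ge0.
have rz : (0 <= rho / Z)%R by rewrite divr_ge0 ?ltW.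
rewrite ge0_ler_powR ?nnegrE ?(ltW es0) ?(ltW rho0)//.
by rewrite ler_pdivrMr// ler_peMr// ltW.
Qed.

(** Near part of the operator for a quadratic test function: the linear term
    cancels in the principal value and the rest vanishes with the radius. *)
Lemma inner_pv_ge p (q rho : R) x (phi : 'rV[R]_N -> R) : (0 < rho)%R -> (0 <= q)%R ->
  (forall z, (phi (x + z) - phi x = dot p z - q * dot z z)%R) ->
  (- (q * (4 * rho `^ (2 - 2 * s) / (2 - 2 * s) * shell_bound n)))%:E <=
  pv_hausdorff_integral n ([set` V] `&` eball 0%R rho) (difference_quotient s n phi x).
Proof.
move=> rho0 q0 phiE.
pose g (z : E) : R := (dot p (z : 'rV[R]_N) - q * dot (z : 'rV[R]_N) z)%R.
have mg : measurable_fun [set: E] g.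
  apply: measurable_funB; last by apply: measurable_funM => //; exact: measurable_cst.
  have mp : measurable_fun [set: E] (fun y : E => dot (y : 'rV[R]_N) p).
    by apply: continuous_measurable_rV; exact: continuous_dotl.
  by apply: eq_measurable_fun mp => z _; exact: dotC.
pose G eps := \int[H]_(z in near_set rho eps) (dot z z * K z)%R%:E.
pose I eps := hausdorff_integral n (([set` V] `&` eball 0%R rho) `\` eball 0%R eps)
  (difference_quotient s n phi x).
have IE eps : (0 < eps)%R -> I eps = (- q)%:E * G eps.
  move=> e0.
  have -> : I eps = \int[H]_(z in near_set rho eps) (g z * K z)%R%:E.
    by apply: eq_integral => z _; rewrite /difference_quotient phiE.
  have zr z : near_set rho eps z -> (enorm z <= rho)%R.
    by move=> [[_]]; rewrite /eball /= subr0 => /ltW.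
  have gM z : near_set rho eps z -> (`|g z| <= enorm p * rho + q * rho ^+ 2)%R.
    move=> /zr z1; apply: le_trans (ler_normB _ _) _; apply: lerD.
      by apply: le_trans (cauchy_schwarz_abs _ _) _; rewrite ler_wpM2l ?enorm_ge0.
    rewrite ger0_norm ?mulr_ge0 ?dot_ge0// ler_wpM2l// -sqr_enorm.
    by rewrite lerXn2r ?nnegrE ?enorm_ge0// ltW.
  have sD z : near_set rho eps z -> near_set rho eps (- z)%R.
    move=> [[/= zV zr1] ze]; split; first split; first by rewrite /= memvN.
      by move: zr1; rewrite /eball /= !subr0 enormN.
    by move: ze; rewrite /eball /= !subr0 enormN.
  have sym := kernel_symmetrize s01 n0 dV e0 (@near_sub rho eps) (measurable_near rho eps) sD mg gM.
  have ig := integrable_kernel s01 n0 dV e0 (@near_sub rho eps) (measurable_near rho eps) mg gM.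
  have id : (H : {measure set E -> \bar R}).-integrable (near_set rho eps) (fun z => (dot z z * K z)%R%:E).
    apply: (integrable_kernel (M := (rho ^+ 2)%R) s01 n0 dV e0 (@near_sub rho eps) (measurable_near rho eps) measurable_sqr).
    move=> z /zr z1; rewrite ger0_norm ?dot_ge0// -sqr_enorm.
    by rewrite lerXn2r ?nnegrE ?enorm_ge0// ltW.
  have fing := integrable_fin_num (measurable_near rho eps) ig.
  have find := integrable_fin_num (measurable_near rho eps) id.
  have eG : \int[H]_(z in near_set rho eps) ((g z + g (- (z : 'rV[R]_N))) * K z)%R%:E =
      (- q - q)%:E * G eps.
    rewrite /G -integralZl//; apply: eq_integral => z _.
    by rewrite -EFinM /g !dotE; congr EFin; ring.
  move: sym; rewrite eG; rewrite -/(G eps) in find *.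
  rewrite -(fineK fing) -(fineK find) -!EFinM -!EFinD => h0; have h := EFin_inj h0; congr EFin.
  exact: aux h.
have Gle eps eps' : (eps <= eps')%R -> G eps' <= G eps.
  move=> ee; apply: ge0_subset_integral => //.
  - by apply/measurable_EFinP; apply: measurable_funTS; exact: measurable_funM.
  - by move=> z _; rewrite lee_fin mulr_ge0 ?dot_ge0.
  - move=> z [zV]; rewrite /eball /= => ze; split=> // ze'; apply: ze.
    exact: lt_le_trans ze' ee.
have cvI : cvg (I eps @[eps --> 0%R^'+]).
  apply: nondecreasing_at_right_is_cvge; near=> b => y z.
  rewrite !in_itv /= => /andP[y0 _] /andP[z0 _] yz.
  rewrite !IE// !EFinN !mulNe leeN2 lee_wpmul2l// ?lee_fin//.
  exact: Gle.
apply: lime_ge => //; near=> eps.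
have e0 : (0 < eps)%R by near: eps; exact: nbhs_right_gt.
have er : (eps <= rho)%R by near: eps; exact: nbhs_right_le.
rewrite -[X in _ <= X]/(I eps) IE// EFinN EFinN mulNe leeN2 EFinM lee_wpmul2l ?lee_fin//.
exact: near_integral_le.
Unshelve. all: by end_near. Qed.

End operator_estimates.

Section orthogonal_sums.
Context {R : realType} {N l : nat}.
Variable k : 'I_l -> nat.
Implicit Types (V : 'I_l -> {vspace 'rV[R]_N}).

Lemma orthogonal_family_decomposition V (x : 'rV[R]_N) :
  (\sum_(j < l) k j)%N = N -> orthogonal_families k V ->
  exists v : 'I_l -> 'rV[R]_N, [/\ forall i, v i \in V i, x = \sum_i v i &
    forall i, dot x (v i) = dot (v i) (v i)].
Proof.
move=> kN [dV oV].
have orth (v : 'I_l -> 'rV[R]_N) i : (forall i, v i \in V i) ->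
    dot (\sum_i v i) (v i) = dot (v i) (v i).
  move=> vV; rewrite dot_suml (bigD1 i)//= big1 ?addr0// => j ji.
  exact: (oV j i).
have dS : directv (\sum_i V i)%VS.
  apply/directv_sum_independent => v vV v0 i _; apply/eqP; rewrite -dot_eq0.
  by rewrite -(orth _ i (fun i => vV i isT)) v0 dot0l.
have full : (\sum_i V i)%VS = fullv.
  apply/eqP; rewrite eqEdim subvf /= (directvP dS) /= dimvf /dim /= mul1n -[X in (X <= _)%N]kN.
  by apply: leq_sum => i _; rewrite dV.
have : x \in (\sum_i V i)%VS by rewrite full memvf.
move=> /memv_sumP[v vV xE]; exists v; split=> [i||i]; first exact: vV.
  by [].
by rewrite xE; apply: orth => j; exact: vV.
Qed.

(** Some member of an orthogonal family spanning the space is close to a given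
    direction. *)
Lemma orthogonal_family_component V (x : 'rV[R]_N) : (0 < l <= N)%N ->
  (\sum_(j < l) k j)%N = N -> orthogonal_families k V -> enorm x = 1 ->
  exists i, exists2 v, v \in V i & [/\ N%:R^-1 <= enorm v, enorm v <= 1 &
    enorm (x - v) <= 1 - (2 * N%:R)^-1].
Proof.
move=> /andP[l0 lN] kN oV x1; have N0 := leq_trans l0 lN.
have NR : 0 < N%:R :> R by rewrite ltr0n.
have [v [vV xE xv]] := orthogonal_family_decomposition x kN oV.
have x2 : dot x x = 1 by rewrite -sqr_enorm x1 expr1n.
have [i vi] : exists i, N%:R^-1 <= dot (v i) (v i).
  apply: contrapT => nex.
  have : dot x x < 1.
    rewrite {2}xE dot_sumr; under eq_bigr do rewrite xv.
    have lt1 i : dot (v i) (v i) < N%:R^-1.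
      by rewrite ltNge; apply/negP => h; apply: nex; exists i.
    apply: (@lt_le_trans _ _ (\sum_(i < l) N%:R^-1)).
      case: (l) l0 v lt1 {vV xE xv nex oV lN kN} => // l' _ v lt1.
      rewrite !big_ord_recl; apply: ltr_leD => //.
      by apply: ler_sum => i _; exact: ltW.
    rewrite sumr_const card_ord -[leLHS]mulr_natl ler_pdivrMr// mul1r ler_nat//.
  by rewrite x2 ltxx.
have n1 : N%:R^-1 <= 1 :> R by rewrite invf_le1// ler1n.
have xv2 : dot (x - v i) (x - v i) = 1 - dot (v i) (v i).
  by rewrite !dotE (dotC (v i) x) xv x2; ring.
exists i, (v i) => //; split.
- rewrite -(@ler_pXn2r _ 2) ?nnegrE ?enorm_ge0 ?invr_ge0// sqr_enorm.
  by apply: le_trans vi; rewrite expr2 ler_piMr ?invr_ge0.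
- rewrite enorm_le// expr1n -subr_ge0 -xv2; exact: dot_ge0.
- have n2 : (2 * N%:R)^-1 = N%:R^-1 / 2 :> R by rewrite invfM mulrC.
  rewrite n2; rewrite enorm_le; last by lra.
  rewrite xv2; have := sqr_ge0 (N%:R^-1 : R); move: (N%:R^-1 : R) vi => t vi.
  by rewrite !expr2; lra.
Qed.

End orthogonal_sums.

Section quadratic_test_functions.
Context {R : realType} {N : nat}.
Implicit Types (x v p : 'rV[R]_N) (f : 'rV[R]_N -> R).

Lemma is_derive_quadratic f x v (a b : R) :
  (forall h : R, f (h *: v + x) = f x + h * a + h ^+ 2 * b) ->
  derivable f x v /\ 'D_v f x = a.
Proof.
move=> fE.
have lim : (fun h : R => h^-1 *: ((f \o shift x) (h *: v) - f x)) h @[h --> 0^'] --> a.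
  have -> : a = a + 0 * b by rewrite mul0r addr0.
  have : (fun h : R => a + h * b) h @[h --> 0^'] --> a + 0 * b.
    apply: cvg_within_filter.
    apply: (@cvgD R R R (nbhs (0:R))); first exact: cvg_cst.
    by apply: (@cvgM R R (nbhs (0:R))); [exact: cvg_id|exact: cvg_cst].
  apply: cvg_trans; apply: near_eq_cvg; near=> h.
  have h0 : h != 0 by near: h; exact: nbhs_dnbhs_neq.
  rewrite /=.
  have -> : f (h *: v + x) - f x = h * (a + h * b) by rewrite fE expr2; ring.
  by rewrite /GRing.scale /= mulKf.
split; first by apply/cvg_ex; exists a.
exact: cvg_lim lim.
Unshelve. all: by end_near. Qed.

Definition quadratic x0 p (q : R) x : R := dot p (x - x0) - q * dot (x - x0) (x - x0).

Lemma quadratic_diff x0 p q z :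
  quadratic x0 p q (x0 + z) - quadratic x0 p q x0 = dot p z - q * dot z z.
Proof.
have -> : x0 + z = z + x0 by rewrite addrC.
by rewrite /quadratic addrK subrr dot0r dot0l mulr0 !subr0.
Qed.

Lemma Ck_quadratic x0 p q (U : set 'rV[R]_N) : Ck_on 2 U (quadratic x0 p q).
Proof.
have cdot a : continuous (fun x => dot (x - x0) a).
  move=> x; apply: (@continuous_comp 'rV[R]_N 'rV[R]_N R (fun y => y - x0) (fun y => dot y a)).
    exact: continuous_subr.
  exact: continuous_dotl.
have cn : continuous (fun x => enorm (x - x0)).
  move=> x; apply: (@continuous_comp 'rV[R]_N 'rV[R]_N R (fun y => y - x0) (@enorm R N)).
    exact: continuous_subr.
  exact: continuous_enorm.
have cq : continuous (quadratic x0 p q).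
  move=> x; rewrite (_ : quadratic x0 p q = fun x => dot (x - x0) p - q * enorm (x - x0) ^+ 2); last first.
    by apply/funext => y; rewrite /quadratic sqr_enorm dotC.
  apply: (@cvgB R R _ (nbhs x)); first exact: cdot.
  apply: (@cvgM R _ (nbhs x)); first exact: (@cvg_cst R).
  by apply: (@cvgM R _ (nbhs x)); exact: cn.
have D1 v x : derivable (quadratic x0 p q) x v /\
    'D_v (quadratic x0 p q) x = dot p v - 2 * q * dot (x - x0) v.
  apply: (is_derive_quadratic (b := - q * dot v v)) => h.
  rewrite /quadratic (_ : h *: v + x - x0 = x - x0 + h *: v); last first.
    by rewrite -addrA addrC.
  by rewrite sqr_dotD !dotE; ring.
have E1 v : 'D_v (quadratic x0 p q) = fun x => dot p v - 2 * q * dot (x - x0) v.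
  by apply/funext => x; exact: (D1 v x).2.
have c1 v : continuous (fun x => dot p v - 2 * q * dot (x - x0) v).
  move=> x; apply: (@cvgB R R _ (nbhs x)); first exact: (@cvg_cst R).
  by apply: (@cvgM R _ (nbhs x)); [exact: (@cvg_cst R)|exact: cdot].
have D2 v w x : derivable (fun x => dot p v - 2 * q * dot (x - x0) v) x w /\
    'D_w (fun x => dot p v - 2 * q * dot (x - x0) v) x = - 2 * q * dot w v.
  apply: (is_derive_quadratic (b := 0)) => h.
  by rewrite -addrA !dotE; ring.
split=> [x _|i]; first exact: cq.
split=> [x _|]; first exact: (D1 _ _).1.
rewrite E1; split=> [x _|j]; first exact: c1.
split=> [x _|]; first exact: (D2 _ _ _).1.
rewrite (_ : 'D_(delta_mx 0 j) _ = cst (- 2 * q * dot (delta_mx 0 j) (delta_mx 0 i))); last first.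
  by apply/funext => x; exact: (D2 _ _ _).2.
by split=> // x _; exact: cst_continuous.
Qed.

End quadratic_test_functions.

Definition opening {R : realType} (N : nat) : R := 1 - (4 * N%:R)^-1.

Section touching.
Context {R : realType} {N l : nat}.
Variables (k : 'I_l -> nat) (s : R) (C : nat -> R -> R).
Hypothesis s01 : 0 < s < 1.
Hypothesis l0 : (0 < l <= N)%N.
Hypothesis k0 : forall i, (0 < k i)%N.
Hypothesis kN : (\sum_(i < l) k i)%N = N.
Hypothesis C0 : forall i, 0 < C (k i) s.
Implicit Types (c x z p : 'rV[R]_N) (V : 'I_l -> {vspace 'rV[R]_N}).

Let s0 : 0 < s. Proof. by case/andP: s01. Qed.
Let s1 : s < 1. Proof. by case/andP: s01. Qed.
Let N0 : (0 < N)%N. Proof. by case/andP: l0; exact: leq_trans. Qed.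
Let NR : 0 < N%:R :> R. Proof. by rewrite ltr0n. Qed.

(** A quadratic polynomial touches the barrier from below at any point of the
    ball. *)
Lemma barrier_ge_quadratic c r x : enorm (x - c) < r ->
  exists p q, 0 <= q /\ forall z, enorm z <= 1 ->
    dot p z - q * dot z z <= barrier s c r (x + z) - barrier s c r x.
Proof.
move=> xr; set y := x - c.
have r0 : 0 <= r by apply: le_trans (ltW xr); exact: enorm_ge0.
have q0 : 0 < r ^+ 2 - dot y y.
  by rewrite subr_gt0 -sqr_enorm ltrXn2r ?nnegrE ?enorm_ge0.
set q := r ^+ 2 - dot y y in q0.
have qn : q != 0 by rewrite gt_eqF.
pose t := (2 * enorm y + 1) / q.
exists ((q `^ s * (s * (- 2) / q)) *: y), (q `^ s * (s / q + t ^+ 2)); split.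
  by rewrite mulr_ge0 ?powR_ge0// addr_ge0 ?sqr_ge0// divr_ge0 ?ltW.
move=> z z1; pose d := (- 2 * dot y z - dot z z) / q.
have bz : barrier s c r (x + z) = q `^ s * pospow s (1 + d).
  rewrite -pospowM ?ltW// /barrier; congr (pospow s _).
  rewrite (_ : x + z - c = y + 1 *: z); last by rewrite scale1r addrAC.
  by rewrite sqr_dotD /d mulrDr mulr1 mulrCA divff// mulr1 /q; ring.
have b0 : barrier s c r x = q `^ s by rewrite /barrier pospowE ?ltW.
have d2 : d ^+ 2 <= t ^+ 2 * dot z z.
  rewrite -sqr_enorm -exprMn -[leLHS]real_normK ?num_real// lerXn2r ?nnegrE ?normr_ge0//.
    by rewrite mulr_ge0 ?enorm_ge0// divr_ge0 ?(ltW q0)// addr_ge0 ?mulr_ge0 ?enorm_ge0.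
  rewrite /d /t normrM normfV (gtr0_norm q0) mulrAC ler_wpM2r ?invr_ge0 ?(ltW q0)//.
  apply: le_trans (ler_normB _ _) _.
  rewrite normrM normrN normr_nat -sqr_enorm (ger0_norm (sqr_ge0 _)).
  rewrite (_ : _ * enorm z = 2 * (enorm y * enorm z) + enorm z); last by ring.
  apply: lerD; last by rewrite expr2 ler_piMr ?enorm_ge0.
  by rewrite ler_wpM2l// cauchy_schwarz_abs.
rewrite bz b0; have := pospow_ge_quadratic s01 (1 + d).
have -> : 1 + d - 1 = d by rewrite addrAC subrr add0r.
move=> h; apply: (@le_trans _ _ (q `^ s * (s * d - d ^+ 2))); last first.
  rewrite [leRHS](_ : _ = q `^ s * (pospow s (1 + d) - 1)); last by rewrite mulrBr mulr1.
  by rewrite ler_wpM2l ?powR_ge0//; lra.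
rewrite dotZl (_ : _ - _ = q `^ s * (s * d - t ^+ 2 * dot z z)); last first.
  by rewrite /d; field.
by rewrite ler_wpM2l ?powR_ge0// lerD2l lerN2.
Qed.

Lemma vspace_vector_of_norm (U : {vspace 'rV[R]_N}) (L : R) :
  (0 < \dim U)%N -> 0 < L -> exists2 v, v \in U & enorm v = L.
Proof.
rewrite lt0n dimv_eq0 => U0 L0.
have e0 : 0 < enorm (vpick U) by rewrite enorm_gt0 vpick0.
exists ((L / enorm (vpick U)) *: vpick U); first by rewrite memvZ// memv_pick.
by rewrite enormZ ger0_norm ?divr_ge0 ?ltW// divfK// gt_eqF.
Qed.

Lemma finite_pos_lower_bound n (f : 'I_n -> R) : (forall i, 0 < f i) ->
  exists2 c : R, 0 < c & forall i, c <= f i.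
Proof.
move=> f0; have S0 : 0 <= \sum_i (f i)^-1 by apply: sumr_ge0 => i _; rewrite invr_ge0 ltW.
exists (1 + \sum_i (f i)^-1)^-1 => [|i]; first by rewrite invr_gt0 ltr_wpDr.
rewrite -[leRHS]invrK lef_pV2 ?posrE ?invr_gt0 ?f0 ?ltr_wpDr//.
rewrite (bigD1 i)//= addrCA lerDl addr_ge0//.
by apply: sumr_ge0 => j _; rewrite invr_ge0 ltW.
Qed.

Lemma powR_small (e a b : R) : 0 < e -> 0 < a -> 0 < b ->
  exists2 rho, 0 < rho <= b & rho `^ a <= e.
Proof.
move=> e0 a0 b0; exists (Num.min b (e `^ a^-1)).
  by rewrite lt_min b0 powR_gt0//= ge_min lexx.
apply: (@le_trans _ _ ((e `^ a^-1) `^ a)).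
  apply: ge0_ler_powR; rewrite ?nnegrE ?powR_ge0 ?(ltW a0)//.
    by rewrite le_min (ltW b0) powR_ge0.
  by rewrite ge_min lexx orbT.
by rewrite -powRrM mulVf ?gt_eqF// powRr1// ltW.
Qed.

Let near_gain (v : 'rV[R]_N) w n (L : R) : 0 < L ->
  enorm (n - v) <= 1 - (2 * N%:R)^-1 -> enorm (w - L *: v) < L / (4 * N%:R) ->
  enorm (w - L *: n) < opening N * L.
Proof.
move=> L0 nv wv; apply: le_lt_trans (ler_enormB _ (L *: v) _) _.
rewrite -scalerBr enormZ (gtr0_norm L0) (enormBC v n).
have : L * enorm (n - v) <= L * (1 - (2 * N%:R)^-1) by rewrite ler_wpM2l// ltW.
have -> : (2 * N%:R)^-1 = 2 * (4 * N%:R)^-1 :> R by field; rewrite gt_eqF.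
by move: wv; rewrite /opening; lra.
Qed.


Let scale_kernel (n : nat) (L : R) : 0 < L ->
  ((2 * L) `^ (n%:R + 2 * s))^-1 * ((L / (4 * N%:R)) ^+ n * ball_bound n) =
  (L `^ (2 * s))^-1 * ((2 `^ (n%:R + 2 * s))^-1 * ((4 * N%:R)^-1 ^+ n * ball_bound n)).
Proof.
move=> L0; rewrite powRM ?(ltW L0)// [L `^ _]powRD; last by apply/implyP => _; rewrite gt_eqF.
rewrite powR_mulrn ?(ltW L0)// exprMn.
have Ln : L ^+ n != 0 by rewrite expf_neq0// gt_eqF.
have Ls : L `^ (2 * s) != 0 by rewrite gt_eqF// powR_gt0.
have t2 : 2 `^ (n%:R + 2 * s) != 0 :> R by rewrite gt_eqF// powR_gt0.
move: (L ^+ n) (L `^ (2 * s)) (2 `^ _) ((4 * N%:R)^-1 ^+ n) Ln Ls t2 => a b c d *.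
by field; apply/and3P.
Qed.

Let gap_arith (A Lam L2 a c0 q T : R) : 0 < L2 -> A * Lam * L2 < a * c0 ->
  q * T <= (a * c0 * L2^-1 - A * Lam) / 2 ->
  0 < - (q * T) - A * Lam + L2^-1 * (a * c0).
Proof.
move=> L20 h; have : A * Lam < a * c0 / L2 by rewrite ltr_pdivlMr.
by move=> ??; lra.
Qed.

Local Open Scope ereal_scope.

Let member_sum (F : 'I_l -> \bar R) (f : 'I_l -> R) :
  (forall i, (f i)%:E <= F i) ->
  (\sum_i C (k i) s * f i)%R%:E <= \sum_i (C (k i) s)%:E * F i.
Proof.
move=> h; rewrite -sumEFin; apply: lee_sum => i _.
by rewrite EFinM lee_wpmul2l// lee_fin ltW.
Qed.

Local Close Scope ereal_scope.

Lemma touching_estimate : exists c0 Lam : R, [/\ 0 < c0, 0 <= Lam &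
  forall Omega u c r A x n L a, Linfty u -> viscosity_supersolution k s C Omega u ->
  0 <= A -> enorm (x - c) < r -> Omega x ->
  (forall y, u x - A * barrier s c r x <= u y - A * barrier s c r y) ->
  enorm n = 1 -> 0 < L -> 0 <= a ->
  (forall y, enorm (y - (x + L *: n)) < opening N * L ->
     u x - A * barrier s c r x + a <= u y - A * barrier s c r y) ->
  a * c0 <= A * Lam * L `^ (2 * s)].
Proof.
pose Lm i := 2 * kappa s * shell_bound (k i) : R.
pose Lam := \sum_i C (k i) s * Lm i.
pose gn i := (2 `^ ((k i)%:R + 2 * s))^-1 * ((4 * N%:R)^-1 ^+ k i * ball_bound (k i)) : R.
have gn0 i : 0 < gn i.
  rewrite mulr_gt0 ?invr_gt0 ?powR_gt0// mulr_gt0 ?ball_bound_gt0// exprn_gt0//.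
  by rewrite invr_gt0 mulr_gt0.
have [c0 c00 c0l] := @finite_pos_lower_bound l (fun i => C (k i) s * gn i)
  (fun i => mulr_gt0 (C0 i) (gn0 i)).
exists c0, Lam; split=> //.
  apply: sumr_ge0 => i _; apply: mulr_ge0; first exact: ltW.
  by rewrite mulr_ge0 ?shell_bound_ge0// mulr_ge0// kappa_ge0.
move=> Om u c r A x n L a [[M uM] mu] visc A0 xr Ox tch n1 L0 a0 tcha.
rewrite leNgt; apply/negP => contra.
have r0 : 0 <= r by apply: le_trans (ltW xr); exact: enorm_ge0.
have [p [q [q0 pq]]] := barrier_ge_quadratic xr.
have [rho1 rho10 bk] := barrier_kernel_ge s01 xr.
pose L2 := L `^ (2 * s).
have L20 : 0 < L2 by rewrite powR_gt0.
pose tt i := 4 / (2 - 2 * s) * shell_bound (k i) : R.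
pose T := \sum_i C (k i) s * tt i.
have s2 : 0 < 2 - 2 * s by have := s1; lra.
have T0 : 0 <= T.
  apply: sumr_ge0 => i _; apply: mulr_ge0; first exact: ltW.
  by rewrite mulr_ge0 ?shell_bound_ge0// divr_ge0// ltW.
pose gap := (a * c0 * L2^-1 - A * Lam) / 2.
have gap0 : 0 < gap.
  by rewrite divr_gt0// subr_gt0 ltr_pdivlMr.
have e0 : 0 < gap / (A * q * T + 1).
  by rewrite divr_gt0// ltr_wpDl// !mulr_ge0.
have b0 : 0 < Num.min 1 (Num.min rho1 (L / (4 * N%:R))).
  by rewrite !lt_min ltr01 rho10 divr_gt0// mulr_gt0.
have [rho /andP[rho0 rhob] rhoe] := powR_small e0 s2 b0.
have {rhob} [rhol rho1l rhoL] : [/\ rho <= 1, rho <= rho1 & rho <= L / (4 * N%:R)].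
  by move: rhob; rewrite !le_min => /and3P[].
have small : A * q * (rho `^ (2 - 2 * s) * T) <= gap.
  apply: (@le_trans _ _ (rho `^ (2 - 2 * s) * (A * q * T + 1))).
    by have := powR_ge0 rho (2 - 2 * s); lra.
  by rewrite -ler_pdivlMr// ltr_wpDl// !mulr_ge0.
pose phi := quadratic x (A *: p) (A * q).
have uw z : A * (barrier s c r (x + z) - barrier s c r x) <= u (x + z) - u x.
  by have := tch (x + z); lra.
have phiE z : phi (x + z) - phi x = dot (A *: p) z - A * q * dot z z.
  exact: quadratic_diff.
have tphi y : eball x rho y -> u x - phi x <= u y - phi y.
  rewrite /eball /= => yx; have yE : x + (y - x) = y by rewrite addrC subrK.
  have := phiE (y - x); have := uw (y - x).
  have : A * (dot p (y - x) - q * dot (y - x) (y - x)) <=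
         A * (barrier s c r (x + (y - x)) - barrier s c r x).
    by rewrite ler_wpM2l// pq// ltW// (lt_le_trans yx).
  by rewrite yE dotZl; lra.
have := visc x rho phi Ox rho0 (Ck_quadratic _ _ _ _) tphi.
apply/negP; rewrite -ltNge.
pose low := - (A * q * (rho `^ (2 - 2 * s) * T)) - A * Lam + L2^-1 * (a * c0).
have low0 : 0 < low by exact: gap_arith contra small.
apply: (@lt_le_trans _ _ low%:E); first by rewrite lte_fin.
apply: le_ereal_inf_tmp => _ [V oV <-].
have [i0 [v vV [v1 v2 nv]]] := orthogonal_family_component l0 kN oV n1.
have dV i : \dim (V i) = k i by case: oV.
pose f i := - (A * q * (rho `^ (2 - 2 * s) * tt i)) - A * Lm i
  + (i == i0)%:R * (a * (L2^-1 * gn i)).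
pose M' := Num.max M (r `^ (2 * s)).
have uM' y : `|u y| <= M' by rewrite le_max uM.
have wM' y : `|barrier s c r y| <= M'.
  by rewrite ger0_norm ?barrier_ge0// le_max barrier_le ?orbT.
have mw : measurable_fun [set: borel_rV R N] (barrier s c r : borel_rV R N -> R).
  by apply: continuous_measurable_rV; exact: continuous_barrier.
have et0 : 0 < L / (4 * N%:R) by rewrite divr_gt0// mulr_gt0.
have et4 : L / (4 * N%:R) <= L / 4.
  by rewrite ler_pM2l// lef_pV2 ?posrE ?mulr_gt0// ler_peMr// ler1n.
have LN : L * N%:R^-1 = 4 * (L / (4 * N%:R)) by field; rewrite gt_eqF.
have out i (w : 'rV[R]_N) a' : w \in V i -> L * N%:R^-1 <= enorm w -> enorm w <= L -> 0 <= a' ->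
  (forall z, enorm (z - w) < L / (4 * N%:R) ->
     A * (barrier s c r (x + z) - barrier s c r x) + a' <= u (x + z) - u x) ->
  ((- (A * Lm i) + a' * (L2^-1 * gn i))%:E <=
  hausdorff_integral (k i) ([set` V i] `\` eball 0%R rho) (difference_quotient s (k i) u x))%E.
  move=> wV w1 w2 a'0 wa; rewrite -scale_kernel//.
  apply: (outer_integral_ge s01 (k0 i) (dV i) mu uM' mw wM' rho0 A0 a'0 et0 _ wV _ _ uw wa) => //.
  - by rewrite mulr_gt0.
  - by move: rhoL w1; rewrite LN; lra.
  - by lra.
  - exact: bk.
apply: (@le_trans _ _ (\sum_i C (k i) s * f i)%:E).
  rewrite lee_fin.
  have -> : \sum_i C (k i) s * f i = - (A * q * (rho `^ (2 - 2 * s) * T)) - A * Lam +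
      C (k i0) s * (a * (L2^-1 * gn i0)).
    rewrite /T /Lam !mulr_sumr -!sumrN -big_split/=.
    rewrite (bigD1 i0)//= [in RHS](bigD1 i0)//= /f eqxx mul1r.
    under eq_bigr => i ii0 do rewrite (negbTE ii0) mul0r addr0.
    rewrite [in RHS]addrAC; congr (_ + _); first by ring.
    by apply: eq_bigr => i _; ring.
  rewrite lerD2l (_ : C (k i0) s * _ = L2^-1 * (a * (C (k i0) s * gn i0))); last by ring.
  by rewrite ler_wpM2l ?invr_ge0 ?(ltW L20)// ler_wpM2l.
apply: member_sum => i; rewrite /f -addrA EFinD; apply: leeD.
  have Aq : 0 <= A * q by rewrite mulr_ge0.
  have := inner_pv_ge s01 (k0 i) (dV i) rho0 Aq phiE.
  by rewrite /tt (_ : 4 * _ / _ * _ = rho `^ (2 - 2 * s) * (4 / (2 - 2 * s) * shell_bound (k i)))//; ring.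
have [->|ii0] := eqVneq i i0.
  rewrite mul1r; apply: (out _ (L *: v)) => //.
  - by rewrite memvZ.
  - by rewrite enormZ (gtr0_norm L0) ler_wpM2l// ltW.
  - by rewrite enormZ (gtr0_norm L0) ler_piMr// ltW.
  - move=> z zv; have := tcha (x + z); rewrite (_ : x + z - _ = z - L *: n); last by rewrite opprD addrACA subrr add0r.
    by move=> /(_ (near_gain L0 nv zv)); lra.
have [w wV wL] := @vspace_vector_of_norm (V i) L ltac:(by rewrite dV) L0.
rewrite mul0r addr0 -[- _]addr0 -(mul0r (L2^-1 * gn i)); apply: (out _ w) => //.
- by rewrite wL ler_piMr ?(ltW L0)// invf_le1// ler1n.
- by rewrite wL.
- by move=> z _; rewrite addr0.
Qed.

End touching.

Section coordinate_increments.
Context {R : realType} {m : nat}.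
Implicit Types (f : 'rV[R]_m -> R) (x w h v : 'rV[R]_m).
Local Notation e j := (delta_mx 0 j : 'rV[R]_m).

Lemma derive_along_line f x v (t : R) : derivable f (x + t *: v) v ->
  is_derive t 1 (fun t : R => f (x + t *: v)) ('D_v f (x + t *: v)).
Proof.
move=> df.
have qE : (fun h : R => h^-1 *: (((fun t : R => f (x + t *: v)) \o shift t) (h *: 1) - f (x + t *: v))) =
    (fun h : R => h^-1 *: ((f \o shift (x + t *: v)) (h *: v) - f (x + t *: v))).
  apply/funext => h /=; congr (_ *: (f _ - _)).
  by rewrite [h *: 1]mulr1 scalerDl addrCA.
split; first by rewrite /derivable qE.
by rewrite /derive qE.
Qed.

Lemma MVT_coordinate f x v (a : R) : (forall y, derivable f y v) ->
  exists2 t : R, `|t| <= `|a| & f (x + a *: v) - f x = 'D_v f (x + t *: v) * a.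
Proof.
move=> df; pose phi (t : R) := f (x + t *: v).
have dphi (t : R) : is_derive t 1 phi ('D_v f (x + t *: v)) by exact: derive_along_line.
have cphi (t : R) : {for t, continuous phi}.
  by apply: differentiable_continuous; apply/derivable1_diffP; case: (dphi t).
have cp b c : {within `[b, c], continuous phi} by apply: continuous_subspaceT => t; exact: cphi.
have phi0 : phi 0 = f x by rewrite /phi scale0r addr0.
have [a0|/ltW a0] := leP 0 a.
  have [t /itvP ta] := MVT_segment a0 (fun t _ => dphi t) (cp _ _).
  rewrite phi0 subr0 => E; exists t; last exact: E.
  by rewrite !ger0_norm ?ta.
have [t /itvP ta] := MVT_segment a0 (fun t _ => dphi t) (cp _ _).
rewrite phi0 sub0r mulrN => E; exists t; last by rewrite -opprB E opprK.
by rewrite !ler0_norm ?ta// lerN2 ta.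
Qed.

(** Moving one coordinate at a time. *)
Lemma increment_coordinates f w h : (forall y j, derivable f y (e j)) ->
  exists xi : 'I_m -> 'rV[R]_m, (forall j i, `|(xi j - w) 0 i| <= `|h 0 i|) /\
    f (w + h) - f w = \sum_j 'D_(e j) f (xi j) * h 0 j.
Proof.
move=> df; pose pt n : 'rV[R]_m := \row_i (w 0 i + (i < n)%N%:R * h 0 i).
have ptS (j : 'I_m) : pt j.+1 = pt j + h 0 j *: e j.
  apply/rowP => i; rewrite !mxE eqxx /= -addrA; congr (_ + _).
  have [->|ij] := eqVneq i j; first by rewrite ltnn ltnSn mul1r mul0r add0r mulr1.
  by rewrite ltnS leq_eqVlt val_eqE (negbTE ij) mulr0 addr0.
have step (j : 'I_m) : exists t : R, `|t| <= `|h 0 j| /\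
    f (pt j.+1) - f (pt j) = 'D_(e j) f (pt j + t *: e j) * h 0 j.
  have [t t1 tE] := MVT_coordinate (pt j) (h 0 j) (df ^~ j).
  by exists t; split=> //; rewrite ptS.
pose t j := sval (cid (step j)).
have tP j : `|t j| <= `|h 0 j| /\
    f (pt j.+1) - f (pt j) = 'D_(e j) f (pt j + t j *: e j) * h 0 j.
  exact: svalP (cid (step j)).
exists (fun j : 'I_m => pt j + t j *: e j); split=> [j i|].
  rewrite !mxE eqxx /= addrAC [w 0 i + _]addrC addrK.
  have [->|ij] := eqVneq i j; first by rewrite ltnn mul0r add0r mulr1 (tP j).1.
  rewrite mulr0 addr0 normrM; case: (_ < _)%N; first by rewrite normr1 mul1r.
  by rewrite normr0 mul0r.
under eq_bigr do rewrite -(tP _).2.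
have -> : f (w + h) - f w = f (pt m) - f (pt 0%N).
  congr (f _ - f _); apply/rowP => i; rewrite !mxE ?ltn_ord ?mul1r//.
  by rewrite mul0r addr0.
by rewrite -(telescope_sumr (f \o pt))//= big_mkord.
Qed.

Lemma coord_le_enorm_le v w : (forall i, `|v 0 i| <= `|w 0 i|) -> enorm v <= enorm w.
Proof.
move=> vw; rewrite enorm_le ?enorm_ge0// sqr_enorm; apply: ler_sum => i _.
by rewrite -!expr2 -[leLHS]real_normK ?num_real// -[leRHS]real_normK ?num_real// lerXn2r ?nnegrE.
Qed.

(** Second order Taylor estimate, uniform on balls. *)
Lemma taylor_C2 f (D : R) : 0 <= D -> Ck_on 2 setT f ->
  exists2 K, 0 <= K & forall w h, enorm w <= D -> enorm h <= 1 ->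
    `|f (w + h) - f w - \sum_j 'D_(e j) f w * h 0 j| <= K * enorm h ^+ 2.
Proof.
move=> D0 [_ f1].
have df y j : derivable f y (e j) by exact: (f1 j).1.
have d2f y i j : derivable ('D_(e j) f) y (e i) by exact: ((f1 j).2.2 i).1.
pose B := [set x | enorm (x - 0) <= D + 1].
have bnd i j : exists2 K, 0 <= K & forall y, enorm y <= D + 1 -> `|'D_(e i) ('D_(e j) f) y| <= K.
  have cf : continuous ('D_(e i) ('D_(e j) f)) by move=> y; exact: ((f1 j).2.2 i).2.1.
  have : bounded_set ('D_(e i) ('D_(e j) f) @` (ceball 0 (D + 1))).
    apply: compact_bounded; apply: continuous_compact; last exact: compact_ceball.
    by apply: continuous_subspaceT => y; exact: cf.
  move=> [M [_ MP]]; exists (`|M| + 1); first by rewrite addr_ge0.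
  move=> y yD; apply: (MP (`|M| + 1)); first by rewrite ltr_pwDr// ler_norm.
  by exists y => //; rewrite /ceball /= subr0.
pose Kf i j := sval (cid2 (bnd i j)).
have Kf0 i j : 0 <= Kf i j by rewrite /Kf; case: cid2.
have KfP i j y : enorm y <= D + 1 -> `|'D_(e i) ('D_(e j) f) y| <= Kf i j.
  by rewrite /Kf; case: cid2 => //= K _; exact.
exists (\sum_j \sum_i Kf i j) => [|w h wD h1].
  by apply: sumr_ge0 => j _; apply: sumr_ge0.
have [xi [xi1 ->]] := increment_coordinates w h df.
rewrite -sumrB (le_trans (ler_norm_sum _ _ _))// mulr_suml ler_sum// => j _.
rewrite -mulrBl normrM expr2 mulrA.
apply: ler_pM => //; last exact: ler_coord_enorm.
have xiE : xi j = w + (xi j - w) by rewrite addrC subrK.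
rewrite {1}xiE; have [z [z1 ->]] := increment_coordinates w (xi j - w) (fun y i => d2f y i j).
rewrite (le_trans (ler_norm_sum _ _ _))// mulr_suml ler_sum// => i _.
rewrite normrM ler_pM//.
  apply: KfP; have := ler_enormD w (z i - w); rewrite addrC subrK.
  have : enorm (z i - w) <= enorm h.
    by apply: coord_le_enorm_le => q; apply: le_trans (z1 i q) (xi1 j q).
  by lra.
by apply: le_trans (xi1 j i) _; exact: ler_coord_enorm.
Qed.

End coordinate_increments.

Section tangent_balls.
Context {R : realType} {N : nat}.
Implicit Types (Omega : set 'rV[R]_N) (x y z h n : 'rV[R]_N) (r : R).

Lemma dot_col' (i : 'I_N) x y : dot x y = x 0 i * y 0 i + dot (col' i x) (col' i y).
Proof.
by rewrite {1}/dot (bigD1_ord i)//=; congr (_ + _); apply: eq_bigr => j _; rewrite !mxE.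
Qed.

Lemma enorm_col' (i : 'I_N) x : enorm (col' i x) <= enorm x.
Proof.
by rewrite enorm_le ?enorm_ge0// sqr_enorm (dot_col' i x x) lerDr -expr2 sqr_ge0.
Qed.

Lemma continuous_col' (i : 'I_N) : continuous (col' i : 'rV[R]_N -> 'rV[R]_N.-1).
Proof.
move=> x A /nbhs_eballP[r r0 rA]; apply/nbhs_eballP; exists r => // y; rewrite /eball /= => xy.
apply: rA; rewrite /eball /=; apply: le_lt_trans xy.
rewrite (_ : col' i y - col' i x = col' i (y - x)); first exact: enorm_col'.
by apply/matrixP => a b; rewrite !mxE.
Qed.

(** A differentiable function vanishing at a point with gradient of norm at
    least 1 is positive on a ball touching this point in the direction of the
    gradient. *)
Lemma touching_ball_positive (F : 'rV[R]_N -> R) y (g : 'rV[R]_N) (K r : R) :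
  1 <= enorm g -> 0 < r -> 2 * r <= 1 -> 2 * K * r <= 1 ->
  (forall h, enorm h <= 1 -> `|F (y + h) - dot g h| <= K * enorm h ^+ 2) ->
  forall h, enorm (h - r *: ((enorm g)^-1 *: g)) < r -> enorm h < 2 * r /\ 0 < F (y + h).
Proof.
move=> g1 r0 r1 Kr taylor h; set n := _ *: g => hn.
have g0 : 0 < enorm g by apply: lt_le_trans g1.
have nn : enorm n = 1 by rewrite /n enormZ ger0_norm ?invr_ge0 ?ltW// mulVf// gt_eqF.
have h2 : enorm h < 2 * r.
  have := ler_enormD (h - r *: n) (r *: n); rewrite subrK enormZ nn (gtr0_norm r0); lra.
have gh : dot g h = enorm g * dot n h by rewrite /n dotZl mulrA divff ?mul1r// gt_eqF.
move: n hn nn gh => n hn nn gh; split=> //.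
have hh : dot h h < 2 * r * dot n h.
  have : enorm (h - r *: n) ^+ 2 < r ^+ 2 by rewrite ltrXn2r ?nnegrE ?enorm_ge0 ?(ltW r0).
  rewrite sqr_enorm !dotE (dotC h n) (_ : dot n n = 1) -?sqr_enorm ?nn ?expr1n//.
  by rewrite expr2; lra.
have nh0 : 0 < dot n h.
  by have := le_lt_trans (dot_ge0 h) hh; rewrite pmulr_rgt0 ?mulr_gt0.
have gn : dot n h <= dot g h by rewrite gh ler_peMl// ltW.
have := taylor h (le_trans (ltW h2) r1); rewrite sqr_enorm ler_distl => /andP[lo _].
have [K0|K0] := leP K 0.
  by have := mulr_le0_ge0 K0 (dot_ge0 h); lra.
have : K * dot h h < K * (2 * r * dot n h) by rewrite ltr_pM2l.
have : 2 * K * r * dot n h <= dot n h by rewrite ler_piMl// ltW.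
by lra.
Qed.

(** Interior and exterior balls of radius r tangent to the boundary at y. *)
Definition tangent_pair Omega r y := exists n, [/\ enorm n = 1,
  eball (y + r *: n) r `<=` Omega & forall z, eball (y - r *: n) r z -> ~ Omega z].

Lemma open_frontier Omega : open Omega -> frontier Omega = closure Omega `\` Omega.
Proof. by move=> /interior_id; rewrite /frontier => ->. Qed.

Lemma tangent_pair_near Omega y0 : open Omega -> C2_boundary Omega -> frontier Omega y0 ->
  exists2 rho, 0 < rho & forall y r, frontier Omega y -> eball y0 rho y ->
    0 < r -> r <= rho -> tangent_pair Omega r y.
Proof.
move=> oO C2 /C2[R0 [i [b [gamma [R00 Cg OF]]]]].
pose F x := (-1) ^+ b * x 0 i - gamma (col' i x).
have FP x : eball y0 R0 x -> Omega x <-> 0 < F x by move=> /OF ->; rewrite subr_gt0.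
have cF : continuous F.
  move=> x; apply: (@cvgB R R _ (nbhs x)).
    apply: (@cvgM R _ (nbhs x)); first exact: (@cvg_cst R).
    exact: coord_continuous.
  apply: (@continuous_comp 'rV[R]_N 'rV[R]_N.-1 R (col' i) gamma); first exact: continuous_col'.
  exact: Cg.1.
have F0 y : frontier Omega y -> eball y0 R0 y -> F y = 0.
  rewrite open_frontier// => -[cy ny] yR.
  apply/eqP; rewrite eq_le; apply/andP; split.
    by rewrite leNgt; apply/negP => /(FP _ yR).
  rewrite leNgt; apply/negP => Fy.
  have nb : nbhs y (eball y0 R0 `&` [set z | F z < 0]).
    apply: open_nbhs_nbhs; split=> //; apply: openI; first exact: open_eball.
    rewrite (_ : [set z | F z < 0] = F @^-1` [set t | t < 0])//.
    by apply: open_comp => [z _|]; [exact: cF|exact: open_lt].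
  have [z [Oz [zR Fz]]] := cy _ nb.
  by move/(FP _ zR): Oz; rewrite ltNge (ltW Fz).
have D0 : 0 <= enorm y0 + R0 by rewrite addr_ge0 ?enorm_ge0// ltW.
have [K K0 taylor] := taylor_C2 D0 Cg.
pose rho := Num.min (R0 / 4) (Num.min (2^-1) ((2 * (K + 1))^-1)).
have rho0 : 0 < rho by rewrite !lt_min divr_gt0// !invr_gt0// mulr_gt0// ltr_wpDl.
exists rho => // y r fy y0y r0; rewrite !le_min => /and3P[rR r2 rK].
have rhoR : rho <= R0 / 4 by rewrite ge_min lexx.
have {rK} rK : 2 * K * r <= 1.
  move: rK; rewrite -[_^-1]mul1r ler_pdivlMr ?mulr_gt0 ?ltr_wpDl//; lra.
have yR : eball y0 R0 y by move: y0y; rewrite /eball /=; lra.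
have yD : enorm (col' i y) <= enorm y0 + R0.
  apply: le_trans (enorm_col' _ _) _; have := ler_enormD y0 (y - y0).
  by rewrite addrC subrK => h; move: h yR; rewrite /eball /=; lra.
pose g : 'rV[R]_N := \row_t if unlift i t is Some j then - 'D_(delta_mx 0 j) gamma (col' i y)
  else (-1) ^+ b.
have gi : g 0 i = (-1) ^+ b by rewrite mxE unlift_none.
have gj j : g 0 (lift i j) = - 'D_(delta_mx 0 j) gamma (col' i y) by rewrite mxE liftK.
have g1 : 1 <= enorm g.
  rewrite -(@ler_pXn2r _ 2) ?nnegrE ?enorm_ge0// sqr_enorm (dot_col' i) gi -expr2 sqrr_sign expr1n.
  by rewrite lerDl dot_ge0.
have tayl h : enorm h <= 1 -> `|F (y + h) - dot g h| <= K * enorm h ^+ 2.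
  move=> h1; have h'1 := le_trans (enorm_col' i h) h1.
  apply: (@le_trans _ _ (K * enorm (col' i h) ^+ 2)); last first.
    by rewrite ler_wpM2l// lerXn2r ?nnegrE ?enorm_ge0// enorm_col'.
  rewrite (_ : F (y + h) - dot g h = - (gamma (col' i y + col' i h) - gamma (col' i y) -
    \sum_j 'D_(delta_mx 0 j) gamma (col' i y) * (col' i h) 0 j)) ?normrN; first exact: taylor.
  have := F0 y fy yR; rewrite {1}/F => Fy0; rewrite /F (dot_col' i) gi.
  rewrite (_ : col' i (y + h) = col' i y + col' i h); last by apply/matrixP => p q; rewrite !mxE.
  rewrite (_ : dot (col' i g) (col' i h) =
      - \sum_j 'D_(delta_mx 0 j) gamma (col' i y) * (col' i h) 0 j); last first.
    by rewrite -sumrN; apply: eq_bigr => j _; rewrite mxE gj mulNr.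
  by rewrite mxE; lra.
have near_y h : enorm h < 2 * r -> eball y0 R0 (y + h).
  rewrite /eball /= => hr; have := ler_enormD (y - y0) h; rewrite addrAC.
  by move: y0y; rewrite /eball /=; lra.
have r21 : 2 * r <= 1 by lra.
exists ((enorm g)^-1 *: g); split.
- by rewrite enormZ ger0_norm ?invr_ge0 ?enorm_ge0// mulVf// gt_eqF// (lt_le_trans ltr01).
- move=> z zc; have [h2 Fz] := touching_ball_positive g1 r0 r21 rK tayl (h := z - y)
    ltac:(by move: zc; rewrite /eball /= opprD addrA).
  by move: Fz; have /FP := near_y _ h2; rewrite addrC subrK => <-.
- move=> z ze; have tayl' h : enorm h <= 1 -> `|- F (y + h) - dot (- g) h| <= K * enorm h ^+ 2.
    by rewrite dotNl -opprD normrN; exact: tayl.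
  have g1' : 1 <= enorm (- g) by rewrite enormN.
  have [|h2 Fz] := @touching_ball_positive (fun x => - F x) y _ K r g1' r0 r21 rK tayl' (z - y).
    by move: ze; rewrite /eball /= enormN !scalerN opprK opprB addrA [z + _ - y]addrAC.
  have /FP := near_y _ h2; move: Fz; rewrite addrC subrK oppr_gt0 => Fz ->.
  by rewrite ltNge (ltW Fz).
Qed.

Lemma compact_frontier Omega : bounded_set Omega -> compact (frontier Omega).
Proof.
move=> /bounded_setP[D D0 DO].
apply: (@subclosed_compact _ _ (ceball 0 D)); last 2 first.
- exact: compact_ceball.
- move=> x [cx _].
  have : closure Omega `<=` ceball 0 D.
    rewrite [X in _ `<=` X](closure_id _).1; last exact: closed_ceball.
    by apply: closure_subset => y /DO; rewrite /ceball /= subr0.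
  by apply.
- rewrite /frontier setDE; apply: closedI; first exact: closed_closure.
  by apply: open_closedC; exact: open_interior.
Qed.

(** The compact boundary has tangent balls of a uniform radius on both sides. *)
Lemma uniform_tangent_pair Omega : bounded_C2_domain Omega ->
  exists2 r, 0 < r & forall y, frontier Omega y -> tangent_pair Omega r y.
Proof.
move=> [_ oO _ bO C2].
have /compact_near_coveringP cov := compact_frontier bO.
have : \forall r \near 0^'+, frontier Omega `<=` (fun y => 0 < r -> frontier Omega y -> tangent_pair Omega r y).
  apply: (cov R 0^'+ (fun r y => 0 < r -> frontier Omega y -> tangent_pair Omega r y)) => y0 fy0.
  have [rho rho0 rhoP] := tangent_pair_near oO C2 fy0.
  exists (eball y0 rho, [set r | r <= rho]) => /=.
    split; first exact: nbhs_eball.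
    exact: nbhs_right_le.
  by move=> [y r] [/= yb rl] r0 fy; exact: rhoP.
move=> near0; have [r [rP r0]] := filter_ex (filterI near0 (nbhs_right_gt (0 : R))).
by exists r => // y fy; exact: rP.
Qed.

End tangent_balls.

Section boundary_points.
Context {R : realType} {N : nat}.
Implicit Types (Omega B : set 'rV[R]_N) (x y z n : 'rV[R]_N) (r : R).

(** A connected set cannot cross the frontier of an open set. *)
Lemma connected_avoid_frontier Omega B x : open Omega -> connected B ->
  (forall y, B y -> ~ frontier Omega y) -> B x -> Omega x -> B `<=` Omega.
Proof.
move=> oO cB fB Bx Ox; suff <- : B `&` Omega = B by move=> y [].
apply: cB; first by exists x.
  by exists Omega.
exists (closure Omega); first exact: closed_closure.
rewrite predeqE => y; split=> -[By]; first by move/subset_closure.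
move=> cy; split=> //; apply: contrapT => nOy; apply: (fB _ By).
by rewrite open_frontier.
Qed.

Lemma connected_line_segment x z : connected [set x + t *: (z - x) | t in `[(0 : R), 1]].
Proof.
apply: connected_continuous_connected; first exact: segment_connected.
apply: continuous_subspaceT => t.
by apply: (@cvgD R _ _ (nbhs t)); [exact: (@cvg_cst _ x _ (nbhs t))|exact: scalel_continuous].
Qed.

Lemma eball_sub_open Omega x r : open Omega -> Omega x ->
  (forall y, frontier Omega y -> r <= enorm (x - y)) -> eball x r `<=` Omega.
Proof.
move=> oO Ox fr z xz.
apply: (connected_avoid_frontier oO (@connected_line_segment x z) _ _ Ox).
- move=> _ [t /= t01 <-] /fr; rewrite leNgt => /negP; apply; rewrite opprD addNKr enormN enormZ.
  move: t01; rewrite in_itv /= => /andP[t0 t1]; rewrite ger0_norm//.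
  by apply: le_lt_trans xz; rewrite ler_piMl// enorm_ge0.
- by exists 0; rewrite /= ?in_itv /= ?lexx ?ler01// scale0r addr0.
- by exists 1; rewrite /= ?in_itv /= ?lexx ?ler01// scale1r addrC subrK.
Qed.

Lemma unit_vector : (0 < N)%N -> exists n, enorm n = 1.
Proof.
case: N => // N' _; exists (delta_mx 0 ord0).
rewrite /enorm /dot (bigD1 ord0)//= big1 ?addr0; first by rewrite !mxE !eqxx mulr1 sqrtr1.
by move=> i i0; rewrite !mxE (negbTE i0) andbF mul0r.
Qed.

Lemma frontier_neq0 Omega : (0 < N)%N -> Omega !=set0 -> open Omega -> bounded_set Omega ->
  frontier Omega !=set0.
Proof.
move=> N0 [x Ox] oO /bounded_setP[D D0 OD].
have [n n1] := unit_vector N0.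
apply: contrapT => nf; have : Omega ((D + 1) *: n).
  apply: (@eball_sub_open Omega x (enorm ((D + 1) *: n - x) + 1)) => //.
    by move=> y fy; case: nf; exists y.
  by rewrite /eball /= ltrDl.
move/OD; rewrite enormZ n1 mulr1 ger0_norm ?(addr_ge0 (ltW D0))//.
by rewrite leNgt ltrDl ltr01.
Qed.

Lemma nearest_frontier_point Omega x : bounded_set Omega -> frontier Omega !=set0 ->
  exists y, [/\ frontier Omega y, boundary_dist Omega x = enorm (x - y) &
    forall z, frontier Omega z -> enorm (x - y) <= enorm (x - z)].
Proof.
move=> bO f0.
have cf : {within frontier Omega, continuous (fun y => enorm (y - x))}.
  apply: continuous_subspaceT => y.
  apply: (@continuous_comp 'rV[R]_N 'rV[R]_N R (fun y => y - x) (@enorm R N)).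
    exact: continuous_subr.
  exact: continuous_enorm.
have [y yf ymin] := EVT_min_rV f0 (compact_frontier bO) cf.
rewrite inE in yf.
have ymin' z : frontier Omega z -> enorm (x - y) <= enorm (x - z).
  by move=> fz; rewrite !(enormBC x) ymin// inE.
exists y; split=> //; apply/eqP; rewrite eq_le; apply/andP; split.
  apply: ge_inf; last by exists y.
  by exists 0 => _ [z _ <-]; exact: enorm_ge0.
by apply: lb_le_inf; [exists (enorm (x - y)), y|move=> _ [z fz <-]; exact: ymin'].
Qed.

(** An inner ball centered at x touching the boundary at y extends along the
    normal of the exterior tangent ball. *)
Lemma normal_through_center Omega x y n r : 0 < r -> enorm n = 1 ->
  (forall z, eball (y - r *: n) r z -> ~ Omega z) ->
  eball x (enorm (x - y)) `<=` Omega -> 0 < enorm (x - y) ->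
  x = y + enorm (x - y) *: n.
Proof.
move=> r0 n1 ext int; set d := enorm (x - y) => d0.
set e := y - r *: n in ext.
have ye : y - e = r *: n by rewrite /e opprB addrC subrK.
have dr : d + r <= enorm (x - e).
  rewrite leNgt; apply/negP => lt.
  have dr0 : 0 < d + r by rewrite addr_gt0.
  pose z := x + (d / (d + r)) *: (e - x).
  apply: (ext z).
    rewrite /eball /= (_ : z - e = (r / (d + r)) *: (x - e)).
      rewrite enormZ ger0_norm ?divr_ge0 ?ltW// mulrAC ltr_pdivrMr// ltr_pM2l//.
    have -> : r / (d + r) = 1 - d / (d + r) by field; rewrite gt_eqF.
    rewrite scalerBl scale1r /z -(opprB x e) scalerN addrAC.
    by rewrite [_ *: (x - e)]scalerBr.
  apply: int; rewrite /eball /= /z addrAC subrr add0r enormZ ger0_norm ?divr_ge0 ?ltW//.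
  by rewrite mulrAC ltr_pdivrMr// enormBC ltr_pM2l.
have n2 : dot n n = 1 by rewrite -sqr_enorm n1 expr1n.
have xe : x - e = (x - y) + r *: n by rewrite -ye addrA subrK.
have xy2 : dot (x - y) (x - y) = d ^+ 2 by rewrite sqr_enorm.
have dn : d <= dot (x - y) n.
  have : (d + r) ^+ 2 <= dot (x - e) (x - e).
    by rewrite -sqr_enorm lerXn2r ?nnegrE ?enorm_ge0// addr_ge0 ?ltW.
  rewrite xe sqr_dotD n2 xy2 => h.
  have : r * d <= r * dot (x - y) n by lra.
  by rewrite ler_pM2l.
apply/eqP; rewrite -subr_eq0 -dot_eq0 opprD addrA eq_le dot_ge0 andbT.
rewrite (_ : x - y - d *: n = x - y + (- d) *: n); last by rewrite scaleNr.
have : d * d <= d * dot (x - y) n by rewrite ler_pM2l.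
by rewrite sqr_dotD n2 xy2 !expr2; lra.
Qed.

End boundary_points.

Section semicontinuity.
Context {R : realType}.

(** Lower semicontinuous functions attain their minimum on compact sets. *)
Lemma compact_lsc_min (T : topologicalType) (f : T -> R) (K : set T) (M : R) :
  compact K -> K !=set0 -> (forall x, K x -> M <= f x) ->
  (forall x a, K x -> a < f x -> \forall y \near x, a < f y) ->
  exists2 x, K x & forall y, K y -> f x <= f y.
Proof.
move=> /compact_near_coveringP cK [x1 Kx1] fM lsc.
pose S := [set f x | x in K].
have S0 : S !=set0 by exists (f x1), x1.
have hS : has_lbound S by exists M => _ [x Kx <-]; exact: fM.
apply: contrapT => nomin.
have gtinf x : K x -> inf S < f x.
  move=> Kx; rewrite ltNge; apply/negP => le; apply: nomin; exists x => // y Ky.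
  by apply: le_trans le _; apply: ge_inf => //; exists y.
have : \forall q \near (inf S)^'+, K `<=` (fun x => q < f x).
  apply: (cK R (inf S)^'+ (fun q x => q < f x)) => x Kx.
  pose q0 := (inf S + f x) / 2.
  have q1 : inf S < q0 by have := gtinf x Kx; rewrite /q0; lra.
  have q2 : q0 < f x by have := gtinf x Kx; rewrite /q0; lra.
  exists ([set y | q0 < f y], [set q | q <= q0]) => /=.
    by split; [exact: lsc|exact: nbhs_right_le].
  by move=> [y q] [/= h1 h2]; exact: le_lt_trans h2 h1.
move=> h; have [q [qP q0]] := filter_ex (filterI h (nbhs_right_gt (inf S))).
have : q <= inf S by apply: lb_le_inf => // _ [x Kx <-]; exact/ltW/qP.
by rewrite leNgt q0.
Qed.

Lemma LSC_near N (Omega : set 'rV[R]_N) (u : 'rV[R]_N -> R) x a : open Omega ->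
  LSC Omega u -> Omega x -> a < u x -> \forall y \near x, a < u y.
Proof.
move=> oO lsc Ox; rewrite -lte_fin => /lsc[V].
move=> nV VP; have {}nV : within Omega (nbhs x) V by rewrite nbhs_subspace_in.
have nO : nbhs x Omega by exact: open_nbhs_nbhs.
have {}nV : nbhs x [set y | Omega y -> V y] by exact: nV.
by apply: filterS (filterI nV nO) => y [h /h /VP]; rewrite lte_fin.
Qed.

End semicontinuity.

Section touching_points.
Context {R : realType} {N : nat}.
Implicit Types (Omega : set 'rV[R]_N) (u : 'rV[R]_N -> R) (x y z c e : 'rV[R]_N).

(** Sliding the barrier up to the graph of u. *)
Lemma touching_point s Omega u c r A x : 0 < s < 1 -> open Omega -> LSC Omega u ->
  Linfty u -> 0 <= A -> 0 <= r -> ceball c r `<=` Omega ->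
  (forall y, ~ eball c r y -> u x - A * barrier s c r x < u y) ->
  exists2 x0, eball c r x0 &
    forall y, u x0 - A * barrier s c r x0 <= u y - A * barrier s c r y.
Proof.
move=> s01 oO lsc [[M uM] _] A0 r0 cO out.
have b0 y : ~ eball c r y -> barrier s c r y = 0.
  by rewrite /eball /= => /negP; rewrite -leNgt => ?; exact: barrier_out.
have cx : ceball c r x.
  apply: ltW; apply: contrapT => /negP nx.
  by have := out x (elimN idP nx); rewrite (b0 x (elimN idP nx)) mulr0 subr0 ltxx.
pose v y := u y - A * barrier s c r y.
have vM y : ceball c r y -> - M - A * r `^ (2 * s) <= v y.
  move=> _; apply: lerB; first by have := uM y; rewrite ler_norml => /andP[].
  by rewrite ler_wpM2l// barrier_le.
have vlsc y a : ceball c r y -> a < v y -> \forall z \near y, a < v z.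
  move=> cy ay; pose eps := (v y - a) / 2.
  have e0 : 0 < eps by rewrite divr_gt0// subr_gt0.
  have nu : \forall z \near y, u y - eps < u z.
    by apply: (LSC_near oO lsc (cO _ cy)); rewrite ltrBlDr ltrDl.
  have nb : \forall z \near y, A * barrier s c r z < A * barrier s c r y + eps.
    have cb : (fun z => A * barrier s c r z) z @[z --> y] --> A * barrier s c r y.
      by apply: (@cvgM R _ (nbhs y)); [exact: (@cvg_cst R)|exact: continuous_barrier].
    by apply: (cvgr_lt _ cb); rewrite ltrDl.
  apply: filterS (filterI nu nb) => z [h1 h2].
  by move: e0; rewrite /eps /v in h1 h2 *; lra.
have [x0 cx0 x0min] := compact_lsc_min (@compact_ceball R N c r) (ex_intro _ x cx) vM vlsc.
have x0x : v x0 <= v x by exact: x0min.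
exists x0.
  apply: contrapT => nx0; have := out x0 nx0.
  by move: x0x; rewrite /v (b0 x0 nx0) mulr0 subr0; lra.
move=> y; have [cy|ny] := pselect (ceball c r y); first exact: x0min.
have nby : ~ eball c r y by move=> h; apply: ny; exact: ltW.
apply: le_trans x0x _; rewrite (b0 y nby) mulr0 subr0.
exact/ltW/out.
Qed.

(** From every point near the center of a ball of half the distance to the
    boundary, some ball of the complement is seen under a definite angle and
    at a distance comparable to the distance to the boundary. *)
Lemma exterior_region Omega : (0 < N)%N -> bounded_C2_domain Omega ->
  exists2 Q : R, 0 < Q & forall x, Omega x -> let d := boundary_dist Omega x in
    exists e, forall x0, enorm (x0 - x) < d / 2 ->
    [/\ 0 < enorm (e - x0), enorm (e - x0) <= Q * (d / 2) &
      forall y, enorm (y - e) < opening N * enorm (e - x0) -> ~ Omega y].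
Proof.
move=> N0 dO; have [r r0 tang] := uniform_tangent_pair dO.
have [neO oO _ bO _] := dO.
have f0 := frontier_neq0 N0 neO oO bO.
have [D D0 OD] := bounded_setP bO.
have NR : 1 <= N%:R :> R by rewrite ler1n.
pose K : R := 6 * N%:R; pose T := 8 * N%:R * D.
have K0 : 0 < K by rewrite mulr_gt0// (lt_le_trans ltr01).
have T0 : 0 < T by rewrite !mulr_gt0// (lt_le_trans ltr01).
have TD : 0 < T + D by rewrite addr_gt0.
have thE L : opening N * L = L - L / (4 * N%:R) by rewrite /opening; ring.
have N4 : 0 < 4 * N%:R :> R by lra.
exists (2 * K + 3 + 2 * (T + D) * K / r) => [|x Ox d].
  have : 0 < 2 * (T + D) * K / r by rewrite divr_gt0// mulr_gt0// mulr_gt0.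
  by lra.
have [y [fy dE ymin]] := nearest_frontier_point x bO f0.
move: (boundary_dist Omega x) dE @d => d dE.
have Oy : ~ Omega y by move: fy; rewrite open_frontier// => -[].
have d0 : 0 < d.
  rewrite dE enorm_gt0 subr_eq0; apply/eqP => xy; by rewrite xy in Ox.
have ballO : eball x d `<=` Omega.
  by apply: eball_sub_open => // z fz; rewrite dE ymin.
have Tr0 : 0 <= 2 * (T + D) * K / r.
  by rewrite ltW// divr_gt0// mulr_gt0// mulr_gt0.
have [Kdr|rKd] := leP (K * d) r.
  have [n [n1 _ ext]] := tang y fy.
  have xE : x = y + d *: n.
    by rewrite dE; apply: (normal_through_center r0 n1 ext); rewrite -dE.
  exists (y - (K * d) *: n) => x0 x0x.
  set e := y - _; have xe : enorm (e - x) = (K + 1) * d.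
    rewrite (_ : e - x = - ((K + 1) * d) *: n); last first.
      by rewrite /e xE; apply/rowP => i; rewrite !mxE; ring.
    by rewrite enormZ n1 mulr1 normrN ger0_norm// mulr_ge0 ?ltW// ltr_wpDr.
  have Kd0 : 0 < K * d by rewrite mulr_gt0.
  have up : enorm (e - x0) <= (K + 3 / 2) * d.
    by have := ler_enormB e x x0; rewrite xe (enormBC x x0); lra.
  have low : (K + 2^-1) * d <= enorm (e - x0).
    by have := ler_enormB e x0 x; rewrite xe; lra.
  split.
  - by apply: lt_le_trans low; rewrite mulr_gt0// addr_gt0.
  - apply: le_trans up _; rewrite [leRHS]mulrDl -[leLHS]addr0; apply: lerD; first lra.
    by rewrite mulr_ge0// divr_ge0// ltW.
  - move=> z; rewrite thE => ze; apply: ext; rewrite /eball /=.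
    have ze' : enorm (z - e) < K * d.
      apply: (lt_le_trans ze).
      have : (K + 2^-1) * d / (4 * N%:R) <= enorm (e - x0) / (4 * N%:R).
        by rewrite ler_pM2r// invr_gt0.
      have -> : (K + 2^-1) * d / (4 * N%:R) = 3 / 2 * d + d / 2 / (4 * N%:R).
        by rewrite /K; field; rewrite gt_eqF// (lt_le_trans ltr01).
      have : 0 <= d / 2 / (4 * N%:R) by apply: divr_ge0; [apply: divr_ge0 => //; exact: ltW|exact: ltW].
      by lra.
    have ee : enorm (e - (y - r *: n)) = r - K * d.
      rewrite (_ : e - _ = (r - K * d) *: n); last first.
        by rewrite /e; apply/rowP => i; rewrite !mxE; ring.
      by rewrite enormZ n1 mulr1 ger0_norm// subr_ge0.
    by have := ler_enormB z e (y - r *: n); rewrite ee; lra.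
have [n n1] := unit_vector (R := R) N0.
have e1 : enorm (T *: n) = T by rewrite enormZ n1 mulr1 gtr0_norm.
exists (T *: n) => x0 x0x.
have Ox0 : Omega x0 by apply: ballO; rewrite /eball /=; lra.
have x0D := OD _ Ox0.
have up : enorm (T *: n - x0) <= T + D.
  by have := ler_enormB (T *: n) 0 x0; rewrite subr0 sub0r enormN e1; lra.
have low : T - D <= enorm (T *: n - x0).
  by have := ler_enormD (T *: n - x0) x0; rewrite subrK e1; lra.
have DT : D < T.
  by rewrite /T -[ltLHS]mul1r ltr_pM2r//; lra.
split.
- by apply: lt_le_trans low; rewrite subr_gt0.
- apply: le_trans up _; rewrite [leRHS]mulrDl -[leLHS]add0r; apply: lerD.
    by apply: mulr_ge0; lra.
  rewrite (_ : _ * (d / 2) = (T + D) * ((K * d) / r)); last by field; rewrite gt_eqF.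
  by rewrite ler_peMr ?(ltW TD)// ler_pdivlMr// mul1r ltW.
- move=> z; rewrite thE => ze /OD zD.
  have : T <= enorm (z - T *: n) + D.
    by have := ler_enormB (T *: n) z 0; rewrite !subr0 e1 (enormBC _ z); lra.
  have th1 : 0 <= 1 - (4 * N%:R)^-1 :> R by rewrite subr_ge0 invf_le1//; lra.
  have : enorm (T *: n - x0) * (1 - (4 * N%:R)^-1) <= (T + D) * (1 - (4 * N%:R)^-1).
    by rewrite ler_wpM2r.
  have -> : (T + D) * (1 - (4 * N%:R)^-1) = T - D - D / (4 * N%:R).
    by rewrite /T; field; rewrite gt_eqF// (lt_le_trans ltr01).
  have : 0 <= D / (4 * N%:R) by rewrite divr_ge0// ltW.
  by lra.
Qed.

End touching_points.

Section supersolutions.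
Context {R : realType} {N : nat}.
Variables (s : R) (Omega : set 'rV[R]_N) (u : 'rV[R]_N -> R) (c0 Lam : R).
Hypothesis s01 : 0 < s < 1.
Hypothesis N0 : (0 < N)%N.
Hypothesis dO : bounded_C2_domain Omega.
Hypothesis uL : Linfty u.
Hypothesis lsc : LSC Omega u.
Hypothesis uext : forall x, ~ Omega x -> 0 <= u x.
Hypothesis c00 : 0 < c0.
Hypothesis Lam0 : 0 <= Lam.
Implicit Types (x y z c e n : 'rV[R]_N).
Local Notation b := (barrier s).
Hypothesis touch : forall c r A x n L a, 0 <= A -> enorm (x - c) < r -> Omega x ->
  (forall y, u x - A * b c r x <= u y - A * b c r y) ->
  enorm n = 1 -> 0 < L -> 0 <= a ->
  (forall y, enorm (y - (x + L *: n)) < opening N * L ->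
     u x - A * b c r x + a <= u y - A * b c r y) ->
  a * c0 <= A * Lam * L `^ (2 * s).

Let s0 : 0 < s. Proof. by case/andP: s01. Qed.
Let s20 : 0 <= 2 * s. Proof. by rewrite mulr_ge0// ltW. Qed.
Let NR : 1 <= N%:R :> R. Proof. by rewrite ler1n. Qed.
Let oO : open Omega. Proof. by case: dO. Qed.
Let bO : bounded_set Omega. Proof. by case: dO. Qed.
Let f0 : frontier Omega !=set0.
Proof. by case: dO => ? ? _ ? _; exact: frontier_neq0. Qed.
Let th0 : 0 < opening N :> R.
Proof.
have N4 : 4 <= 4 * N%:R :> R by have := NR; lra.
have : (4 * N%:R)^-1 <= 4^-1 :> R by rewrite lef_pV2 ?posrE// (lt_le_trans _ N4).
by rewrite /opening; lra.
Qed.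
Let th1 : opening N < 1 :> R.
Proof. by rewrite /opening ltrBlDr ltrDl invr_gt0; have := NR; lra. Qed.

Let touch_toward c r A x e a : 0 <= A -> enorm (x - c) < r -> Omega x ->
  (forall y, u x - A * b c r x <= u y - A * b c r y) ->
  0 < enorm (e - x) -> 0 <= a ->
  (forall y, enorm (y - e) < opening N * enorm (e - x) ->
     u x - A * b c r x + a <= u y - A * b c r y) ->
  a * c0 <= A * Lam * enorm (e - x) `^ (2 * s).
Proof.
move=> A0 xc Ox vmin L0 a0 gain.
have Ln : enorm (e - x) != 0 by rewrite gt_eqF.
apply: (touch (n := (enorm (e - x))^-1 *: (e - x)) A0 xc Ox vmin _ L0 a0).
  by rewrite enormZ ger0_norm ?invr_ge0 ?enorm_ge0// mulVf.
by move=> y; rewrite scalerA divff// scale1r [x + _]addrC subrK; exact: gain.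
Qed.

Let boundary_dist_ball x : Omega x -> 0 < boundary_dist Omega x /\
  eball x (boundary_dist Omega x) `<=` Omega.
Proof.
move=> Ox; have [y [fy -> ymin]] := nearest_frontier_point x bO f0.
split; last exact: eball_sub_open.
rewrite enorm_gt0 subr_eq0; apply/eqP => xy; move: fy.
by rewrite open_frontier// -xy => -[_]; exact.
Qed.

Let barrier_center c r : 0 < r -> b c r c = r `^ (2 * s).
Proof. by move=> r0; rewrite /b subrr dot0l subr0 pospowE ?sqr_ge0// powRrM powR_mulrn// ltW. Qed.

(** Weak maximum principle. At an almost minimal point the function, corrected
    by a small barrier, has a touching point from which the nonnegative
    exterior values are seen at a comparable distance. *)
Lemma supersolution_ge0 x : 0 <= u x.
Proof.
rewrite leNgt; apply/negP => ux.
have [M uM] := uL.1.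
pose S := range u; pose m := inf S.
have hS : has_inf S.
  split; first by exists (u x), x.
  by exists (- M) => _ [y _ <-]; have := uM y; rewrite ler_norml => /andP[].
have mle y : m <= u y by apply: ge_inf; [case: hS|exists y].
have m0 : m < 0 by apply: le_lt_trans ux; exact: mle.
have [Q Q0 ext] := exterior_region N0 dO.
pose W := Lam * Q `^ (2 * s).
have W0 : 0 <= W by rewrite mulr_ge0// powR_ge0.
pose eps := Num.min (- m) (- m * c0 / (2 * (W + 1))).
have W1 : 0 < 2 * (W + 1) by rewrite mulr_gt0// ltr_wpDl.
have m0' : 0 < - m by rewrite oppr_gt0.
have eps0 : 0 < eps by rewrite lt_min m0' divr_gt0// mulr_gt0.
have eps1 : eps <= - m by rewrite ge_min lexx.
have eps2 : 2 * eps * W < - m * c0.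
  have : eps <= - m * c0 / (2 * (W + 1)) by rewrite ge_min lexx orbT.
  by rewrite ler_pdivlMr//; lra.
have [_ [z _ <-] zm] := inf_adherent eps0 hS.
have Oz : Omega z by apply: contrapT => /uext; rewrite leNgt => /negP; apply; rewrite -/m in zm; lra.
have [] := boundary_dist_ball Oz; have [e] := ext z Oz.
move: (boundary_dist Omega z) => d eP d0 dball.
pose h := d / 2; have h0 : 0 < h by rewrite divr_gt0.
have hs : 0 < h `^ (2 * s) by rewrite powR_gt0.
pose A := 2 * eps / h `^ (2 * s).
have A0 : 0 <= A by rewrite divr_ge0 ?(ltW hs)// mulr_ge0// ltW.
have cO : ceball z h `<=` Omega.
  by move=> y; rewrite /ceball /= => yz; apply: dball; rewrite /eball /=; move: yz d0; rewrite /h; lra.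
have vz : u z - A * b z h z < m - eps.
  by rewrite barrier_center// /A divfK ?gt_eqF// /m -/S; move: zm; lra.
have [x0 x0z vmin] : exists2 x0, eball z h x0 &
    forall y, u x0 - A * b z h x0 <= u y - A * b z h y.
  apply: (touching_point s01 oO lsc uL A0 (ltW h0) cO (x := z)) => y _.
  by apply: (lt_le_trans vz); have := mle y; lra.
have [L0 LQ far] := eP x0 x0z.
have := touch_toward A0 x0z (cO _ (ltW x0z)) vmin L0 (ltW m0') _.
have gain y : enorm (y - e) < opening N * enorm (e - x0) ->
    u x0 - A * b z h x0 - m <= u y - A * b z h y.
  move=> /far nOy; have yh : h <= enorm (y - z).
    by rewrite leNgt; apply/negP => yz; apply: nOy; apply: cO; exact: ltW.
  rewrite [b z h y]barrier_out ?(ltW h0)// mulr0 subr0.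
  by have := uext nOy; have := vmin z; move: vz eps0; lra.
move/(_ gain); apply/negP; rewrite -ltNge.
apply: le_lt_trans eps2.
have -> : 2 * eps * W = A * Lam * (Q `^ (2 * s) * h `^ (2 * s)).
  by rewrite /A /W; field; rewrite gt_eqF.
rewrite -(powRM _ (ltW Q0) (ltW h0)); apply: ler_wpM2l; first exact: mulr_ge0.
apply: ge0_ler_powR; rewrite ?nnegrE ?enorm_ge0//.
by apply: mulr_ge0; exact: ltW.
Qed.

Let lsc_min_pos c r : ceball c r !=set0 -> (forall y, ceball c r y -> Omega y /\ 0 < u y) ->
  exists2 m, 0 < m & forall y, ceball c r y -> m <= u y.
Proof.
move=> K0 KP.
have [x cx xmin] := compact_lsc_min (@compact_ceball R N c r) K0 (fun y _ => supersolution_ge0 y)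
  (fun y a cy => LSC_near oO lsc (KP y cy).1).
by exists (u x) => //; exact: (KP x cx).2.
Qed.

(** Strong maximum principle. A zero of u nearest to the center of a ball of
    positivity is a minimum point touched by constants. *)
Lemma supersolution_gt0 x1 : Omega x1 -> u x1 != 0 -> forall x, Omega x -> 0 < u x.
Proof.
move=> Ox1 ux1; pose P := Omega `&` [set x | 0 < u x].
have P1 : P !=set0 by exists x1; split=> //=; rewrite lt_neqAle eq_sym ux1 supersolution_ge0.
have oP : open P.
  rewrite openE => x [Ox ux]; apply: filterI; first exact: open_nbhs_nbhs.
  exact: LSC_near oO lsc Ox ux.
suff PO : P = Omega by move=> x; rewrite -PO => -[].
have [_ _ cO _ _] := dO; apply: cO => //; first by exists P => //; rewrite /P setIA setIid.
exists (closure P); first exact: closed_closure.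
rewrite predeqE => z; split=> [Pz|[Oz cz]]; first by split; [case: Pz|exact: subset_closure].
split=> //=; rewrite lt_neqAle supersolution_ge0 andbT eq_sym; apply/negP => /eqP uz.
have [del del0 dball] := (nbhs_eballP z Omega).1 (open_nbhs_nbhs (conj oO Oz)).
have [p [[Op up] pz]] := cz _ (nbhs_eball z (divr_gt0 del0 (ltr0Sn R 1))).
have {}pz : enorm (p - z) < del / 2 by [].
pose K := ceball p (enorm (z - p)).
have KO : K `<=` Omega.
  move=> y; rewrite /K /ceball /= => yp; apply: dball; rewrite /eball /=.
  by have := ler_enormB y p z; rewrite (enormBC z p) in yp; lra.
have cZ : compact (K `&` ~` P).
  apply: (@subclosed_compact _ _ K) => [|//|]; last by apply: subIsetl.
    by apply: closedI; [exact: closed_ceball|exact: open_closedC].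
  exact: compact_ceball.
have Z0 : (K `&` ~` P) !=set0 by exists z; split; [rewrite /K /ceball /=|case=> _ /=; rewrite uz ltxx].
have cf : {within K `&` ~` P, continuous (fun y => enorm (y - p))}.
  apply: continuous_subspaceT => y.
  apply: (@continuous_comp 'rV[R]_N 'rV[R]_N R (fun y => y - p) (@enorm R N)).
    exact: continuous_subr.
  exact: continuous_enorm.
have [x0] := EVT_min_rV Z0 cZ cf; rewrite inE => -[Kx0 nPx0] x0min.
have Ox0 := KO _ Kx0.
have ux0 : u x0 = 0.
  apply/eqP; rewrite eq_le supersolution_ge0 andbT leNgt; apply/negP => h.
  by apply: nPx0.
have L0 : 0 < enorm (p - x0).
  by rewrite enorm_gt0 subr_eq0; apply/eqP => px; apply: nPx0; rewrite -px.
have near_pos y : ceball p (opening N * enorm (p - x0)) y -> Omega y /\ 0 < u y.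
  rewrite /ceball /= => yp; have yx : enorm (y - p) < enorm (x0 - p).
    by apply: le_lt_trans yp _; rewrite (enormBC x0) gtr_pMl.
  have Ky : K y by rewrite /K /ceball /=; apply/ltW/(lt_le_trans yx).
  have Oy := KO _ Ky; split=> //; rewrite ltNge; apply/negP => uy.
  have : enorm (x0 - p) <= enorm (y - p).
    by apply: x0min; rewrite inE; split=> // -[_ /=]; rewrite ltNge uy.
  by rewrite leNgt yx.
have [|m m0 mP] := lsc_min_pos _ near_pos.
  by exists p; rewrite /ceball /= subrr enorm0 mulr_ge0// ltW.
have := @touch_toward x0 1 0 x0 p m (lexx 0) _ Ox0 _ L0 (ltW m0) _.
rewrite subrr enorm0 !mul0r => /(_ ltr01) H.
suff : m * c0 <= 0 by rewrite leNgt mulr_gt0.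
apply: H => y; first by rewrite !mul0r ux0 !subr0 supersolution_ge0.
by move=> yp; rewrite !mul0r ux0 !subr0 add0r; apply: mP; exact: ltW.
Qed.

(** The barrier of a ball lies below u once u is bounded below near its
    center. *)
Lemma barrier_comparison : exists2 beta, 0 < beta & forall c r m, 0 < r -> 0 < m ->
  ceball c r `<=` Omega -> (forall y, enorm (y - c) < opening N * r -> m <= u y) ->
  forall x, beta * m / r `^ (2 * s) * b c r x <= u x.
Proof.
have L1 : 0 < 2 * (Lam + 1) by rewrite mulr_gt0// ltr_wpDl.
pose beta := Num.min 2^-1 (c0 / (2 * (Lam + 1))).
have be0 : 0 < beta by rewrite lt_min invr_gt0 divr_gt0// ltr0Sn.
have be1 : beta <= 2^-1 by rewrite ge_min lexx.
have be2 : beta * Lam < c0 / 2.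
  have : beta <= c0 / (2 * (Lam + 1)) by rewrite ge_min lexx orbT.
  by rewrite ler_pdivlMr//; lra.
exists beta => // c r m r0 m0 cO um x.
have rs : 0 < r `^ (2 * s) by rewrite powR_gt0.
set A := _ / _; have Ar : A * r `^ (2 * s) = beta * m by rewrite /A divfK// gt_eqF.
have A0 : 0 <= A by rewrite divr_ge0 ?(ltW rs)// mulr_ge0// ltW.
rewrite leNgt; apply/negP => ux.
have vx : u x - A * b c r x < 0 by rewrite subr_lt0.
have [x0 x0c vmin] : exists2 x0, eball c r x0 &
    forall y, u x0 - A * b c r x0 <= u y - A * b c r y.
  apply: (touching_point s01 oO lsc uL A0 (ltW r0) cO (x := x)) => y _.
  by apply: (lt_le_trans vx); exact: supersolution_ge0.
have v0 : u x0 - A * b c r x0 < 0 by apply: le_lt_trans vx; exact: vmin.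
have inner y : enorm (y - c) < opening N * r -> m / 2 <= u y - A * b c r y.
  move=> /um uy; have : A * b c r y <= A * r `^ (2 * s).
    by rewrite ler_wpM2l// barrier_le// ltW.
  rewrite Ar; have : beta * m <= 2^-1 * m by rewrite ler_pM2r.
  by lra.
have L0 : opening N * r <= enorm (c - x0).
  rewrite enormBC leNgt; apply/negP => /inner.
  by have := divr_gt0 m0 (ltr0Sn R 1); move: v0; lra.
have := touch_toward A0 x0c (cO _ (ltW x0c)) vmin (lt_le_trans (mulr_gt0 th0 r0) L0)
  (ltW (divr_gt0 m0 (ltr0Sn R 1))) _.
have gain y : enorm (y - c) < opening N * enorm (c - x0) ->
    u x0 - A * b c r x0 + m / 2 <= u y - A * b c r y.
  move=> yc; have /inner : enorm (y - c) < opening N * r.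
    by apply: lt_trans yc _; rewrite ltr_pM2l// enormBC.
  by move: v0; lra.
move/(_ gain); apply/negP; rewrite -ltNge.
apply: (@le_lt_trans _ _ (A * Lam * r `^ (2 * s))).
  apply: ler_wpM2l; first exact: mulr_ge0.
  apply: ge0_ler_powR; rewrite ?nnegrE ?enorm_ge0 ?(ltW r0)//.
  by rewrite enormBC; exact: ltW.
rewrite mulrAC Ar; have : beta * Lam * m < c0 / 2 * m by rewrite ltr_pM2r.
by lra.
Qed.


Let lower_bound_inside (a : R) : 0 < a -> (forall x, Omega x -> 0 < u x) ->
  exists2 m, 0 < m & forall x, Omega x ->
    (forall y, frontier Omega y -> a <= enorm (x - y)) -> m <= u x.
Proof.
move=> a0 upos.
pose K := closure Omega `&` \bigcap_(y in frontier Omega) ~` eball y a.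
have KO x : K x -> Omega x.
  move=> [cx far]; apply: contrapT => nOx; have fx : frontier Omega x by rewrite open_frontier.
  by apply: (far x fx); exact: eball_center.
have cK : compact K.
  have [D D0 OD] := bounded_setP bO.
  apply: (@subclosed_compact _ _ (ceball 0 D)); last 2 first.
  - exact: compact_ceball.
  - by move=> x /KO /OD; rewrite /ceball /= subr0.
  - apply: closedI; first exact: closed_closure.
    by apply: closed_bigI => y _; apply: open_closedC; exact: open_eball.
have inK x : Omega x -> (forall y, frontier Omega y -> a <= enorm (x - y)) -> K x.
  move=> Ox far; split; first exact: subset_closure.
  by move=> y /far; rewrite leNgt => /negP h xy; exact: h.
have [K0|K0] := pselect (K !=set0); last first.
  by exists 1 => // x Ox far; case: K0; exists x; exact: inK.
have [x Kx xmin] := compact_lsc_min cK K0 (fun y _ => supersolution_ge0 y)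
  (fun y b Ky => LSC_near oO lsc (KO y Ky)).
exists (u x); first exact/upos/KO.
by move=> y Oy far; apply: xmin; exact: inK.
Qed.

(** Hopf lemma, uniform in the boundary point: below u the barriers of slightly
    shrunk interior tangent balls grow like the power s of the distance. *)
Lemma supersolution_growth x1 : Omega x1 -> u x1 != 0 ->
  exists2 c : R, 0 < c &
    forall x, closure Omega x -> c * boundary_dist Omega x `^ s <= u x.
Proof.
move=> Ox1 ux1; have upos := supersolution_gt0 Ox1 ux1.
have [r r0 tang] := uniform_tangent_pair dO.
have [beta be0 cmp] := barrier_comparison.
have a0 : 0 < (1 - opening N) * r by rewrite mulr_gt0// subr_gt0.
have [m m0 mP] := lower_bound_inside a0 upos.
have [D D0 OD] := bounded_setP bO.
have [y0 fy0] := f0.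
pose T := D + enorm y0; have T0 : 0 < T by rewrite ltr_wpDr ?enorm_ge0.
have Ts : 0 < T `^ s by rewrite powR_gt0.
have rs : 0 < r `^ (2 * s) by rewrite powR_gt0.
pose c2 := beta * m / r `^ (2 * s) * (r / 4) `^ s.
have c20 : 0 < c2 by rewrite mulr_gt0 ?powR_gt0 ?divr_gt0// mulr_gt0.
exists (Num.min (m / T `^ s) c2); first by rewrite lt_min c20 divr_gt0.
move=> x cx; have [y [fy dE ymin]] := nearest_frontier_point x bO f0.
have [Ox|nOx] := pselect (Omega x); last first.
  have fx : frontier Omega x by rewrite open_frontier.
  have -> : boundary_dist Omega x = 0.
    apply/eqP; rewrite dE eq_le enorm_ge0 andbT.
    by have := ymin x fx; rewrite subrr enorm0.
  by rewrite powR0 ?mulr0 ?supersolution_ge0// gt_eqF.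
have [d0 dball] := boundary_dist_ball Ox.
move: (boundary_dist Omega x) dE d0 dball => d dE d0 dball.
have ds : 0 <= d `^ s by rewrite powR_ge0.
have [rd|dr] := leP r d.
  apply: (@le_trans _ _ (m / T `^ s * d `^ s)).
    by rewrite ler_wpM2r// ge_min lexx.
  apply: (@le_trans _ _ m); last first.
    apply: mP => // z fz; apply: le_trans (ymin z fz); rewrite -dE; apply: le_trans rd.
    by rewrite ler_piMl ?(ltW r0)// gerBl ltW.
  rewrite mulrAC ler_pdivrMr// ler_pM2l// ge0_ler_powR ?nnegrE ?(ltW s0) ?(ltW d0) ?(ltW T0)//.
  rewrite dE; apply: le_trans (ymin y0 fy0) _.
  by have := ler_enormB x 0 y0; have := OD x Ox; rewrite subr0 sub0r enormN /T; lra.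
have [n [n1 int ext]] := tang y fy.
have xE : x = y + d *: n.
  by rewrite dE; apply: (normal_through_center r0 n1 ext); rewrite -dE.
set c := y + r *: n in int.
have xc : enorm (x - c) = r - d.
  rewrite (_ : x - c = (d - r) *: n); last first.
    by rewrite xE /c; apply/rowP => i; rewrite !mxE; ring.
  by rewrite enormZ n1 mulr1 ler0_norm ?opprB// subr_le0 ltW.
pose r' := r - d / 2.
have r'r : r' < r by rewrite /r'; lra.
have r'0 : 0 < r' by rewrite /r'; lra.
have cO : ceball c r' `<=` Omega.
  by move=> z zc; apply: int; exact: le_lt_trans zc r'r.
have inner z : enorm (z - c) < opening N * r' -> m <= u z.
  move=> zc; have zr : opening N * r' <= opening N * r by rewrite ler_pM2l// ltW.
  have zO : Omega z.
    by apply: cO; apply/ltW/(lt_le_trans zc); rewrite ler_piMl ?(ltW r'0)// ltW.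
  apply: mP => // f ff; have cf : r <= enorm (c - f).
    rewrite leNgt; apply/negP => h; move: (ff); rewrite open_frontier// => -[_]; apply.
    by apply: int; rewrite /eball /= enormBC.
  by have := ler_enormB c z f; rewrite (enormBC c z); lra.
apply: le_trans (cmp c r' m r'0 m0 cO inner x).
apply: (@le_trans _ _ (c2 * d `^ s)).
  by rewrite ler_wpM2r// ge_min lexx orbT.
rewrite /c2 -mulrA; apply: ler_pM.
- by rewrite divr_ge0 ?(ltW rs)// mulr_ge0// ltW.
- by rewrite mulr_ge0 ?powR_ge0.
- rewrite ler_pM2l ?mulr_gt0// lef_pV2 ?posrE ?powR_gt0//.
  by apply: ge0_ler_powR; rewrite ?nnegrE ?(ltW r'0) ?(ltW r0)// ltW.
- have rd4 : 0 <= r / 4 by rewrite divr_ge0// ltW.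
  rewrite -powRM ?(ltW d0)// -pospowE; last by rewrite mulr_ge0// ltW.
  apply: le_pospow => //; rewrite -sqr_enorm xc.
  have : d * d <= d * r by rewrite ler_pM2l// ltW.
  by rewrite /r' !expr2; lra.
Qed.

End supersolutions.

Theorem proposition5p2 (R : realType) (N l : nat) (s : R) (k : 'I_l -> nat)
    (C : nat -> R -> R) (Omega : set 'rV[R]_N) (u : 'rV[R]_N -> R)
    (hs : 0 < s < 1)
    (hl : (1 <= l <= N)%N)
    (hk : forall j : 'I_l, (1 <= k j <= N)%N)
    (hkmono : forall i j : 'I_l, (i <= j)%N -> (k i <= k j)%N)
    (hksum : (\sum_(j < l) k j)%N = N)
    (hC : forall (n : nat) (t : R), (1 <= n)%N -> 0 < t < 1 -> 0 < C n t)
    (hOmega : bounded_C2_domain Omega)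
    (hubd : Linfty u)
    (hulsc : LSC Omega u)
    (hsuper : viscosity_supersolution k s C Omega u)
    (hext : forall x, ~ Omega x -> 0 <= u x)
    (hnz : exists2 x, Omega x & u x != 0) :
  exists2 c : R, 0 < c &
    forall x, closure Omega x -> c * boundary_dist Omega x `^ s <= u x.
Proof.
have lN : (0 < l <= N)%N by exact: hl.
have N0 : (0 < N)%N by case/andP: lN; exact: leq_trans.
have k0 i : (0 < k i)%N by case/andP: (hk i).
have [c0 [Lam [c00 Lam0 touch]]] :=
  touching_estimate hs lN k0 hksum (fun i => hC (k i) s (k0 i) hs).
have [x1 Ox1 ux1] := hnz.
exact: (supersolution_growth hs N0 hOmega hubd hulsc hext c00 Lam0
  (fun c r A x n L a => touch Omega u c r A x n L a hubd hsuper) Ox1 ux1).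
Qed.
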